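(* Let $n\ge3$ and let $\mathbf y=(y_1,\dots,y_n)^\top\in\mathbb R^n$ be generic. Among the complex solutions $(a_0,a_1,a_2)\in\mathbb C^3$ of the likelihood equations $\partial\ell/\partial a_0=\partial\ell/\partial a_1=\partial\ell/\partial a_2=0$ of the MA$(2)$ model, exactly $24n-30$ satisfy $\det(J_g^\top)=0$. Of these, (i) $2$ solutions have $a_1=0$ and $a_0=-a_2$; (ii) $2\cdot(4(n-1))$ solutions have $a_0=a_2$ and $a_1\ne0$; (iii) $4(2n-3)$ solutions satisfy $a_0-a_1+a_2=0$ with $a_1\neq0$; (iv) $4(2n-3)$ solutions satisfy $a_0+a_1+a_2=0$ with $a_1\ne0$. Moreover, for (i), let $\mathbf y_{\mathrm{odd}}=(y_1,y_3,y_5,\dots)^\top$ and $\mathbf y_{\mathrm{even}}=(y_2,y_4,y_6,\dots)^\top$ be the subvectors of odd- and even-indexed observations, and $k_1=\lceil n/2\rceil$, $k_2=\lfloor n/2\rfloor$. Then the two solutions are $(a_0,0,-a_0)$ with $$a_0=\pm\frac1{\sqrt n}\sqrt{\sum_{i,j=1}^{k_1}\frac{\min(i,j)\,[k_1+1-\max(i,j)]}{k_1+1}(\mathbf y_{\mathrm{odd}})_i(\mathbf y_{\mathrm{odd}})_j+\sum_{i,j=1}^{k_2}\frac{\min(i,j)\,[k_2+1-\max(i,j)]}{k_2+1}(\mathbf y_{\mathrm{even}})_i(\mathbf y_{\mathrm{even}})_j}\,.$$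
   Context: MA$(2)$ model: $Y_t=a_0Z_t+a_1Z_{t-1}+a_2Z_{t-2}$ with $(Z_t)_{t\in\mathbb Z}$ i.i.d. standard normal. The autocovariances are given by the map $$g(a_0,a_1,a_2)=(\gamma_0,\gamma_1,\gamma_2)=\big(a_0^2+a_1^2+a_2^2,\ a_1(a_0+a_2),\ a_0a_2\big).$$ The covariance matrix $\Sigma(a)$ of $(Y_1,\dots,Y_n)$ is the $n\times n$ symmetric pentadiagonal Toeplitz matrix with $(i,j)$ entry $\gamma_{|i-j|}$ if $|i-j|\le2$ and $0$ otherwise. The log-likelihood (up to constants) is $\ell(a)=-\log\det\Sigma(a)-\mathbf y^\top\Sigma(a)^{-1}\mathbf y$, and the likelihood equations are the rational equations $$-\operatorname{tr}\Big(\Sigma^{-1}\frac{\partial\Sigma}{\partial a_i}\Big)+\mathbf y^\top\Sigma^{-1}\frac{\partial\Sigma}{\partial a_i}\Sigma^{-1}\mathbf y=0,\qquad i=0,1,2,$$ for complex $a=(a_0,a_1,a_2)$ with $\det\Sigma(a)\neq0$; the number of their complex solutions for generic data is the parametric ML degree. $J_g$ is the Jacobian matrix of $g$; explicitly $$J_g^\top=\begin{pmatrix}2a_0&a_1&a_2\\2a_1&a_0+a_2&0\\2a_2&a_1&a_0\end{pmatrix},\qquad \det(J_g^\top)=2(a_0-a_2)(a_0-a_1+a_2)(a_0+a_1+a_2).$$ ''Generic'' means outside some proper algebraic subset of data space. *)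

(* Defs.v *)
From HB Require Import structures.
From mathcomp Require Import all_boot all_order all_algebra.
From mathcomp Require Import mathcomp_extra boolp classical_sets cardinality reals.
From mathcomp Require Import complex mpoly.

Set Implicit Arguments.
Unset Strict Implicit.
Unset Printing Implicit Defensive.

Import Order.TTheory GRing.Theory Num.Theory.

Local Open Scope classical_set_scope.
Local Open Scope ring_scope.

Definition algebraic_subset (F : fieldType) (n : nat) (V : set 'cV[F]_n) :=
  exists S : set {mpoly F[n]},
    V = [set y | forall p, S p -> p.@[fun i => y i 0] = 0].

Definition generically (F : fieldType) (n : nat) (P : 'cV[F]_n -> Prop) :=
  exists V : set 'cV[F]_n,
    [/\ algebraic_subset V, V <> setT & forall y, ~ V y -> P y].

Definition evalmx (K : fieldType) (p q : nat) (a : 'rV[K]_3)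
    (M : 'M[{mpoly K[3]}]_(p, q)) : 'M[K]_(p, q) :=
  map_mx (fun f : {mpoly K[3]} => f.@[fun i => a 0 i]) M.

(* The parameters a_0, a_1, a_2 are the indeterminates, so that partial
   derivatives in a_i are formal; indices k > 2 give 0. *)
Definition gamma (K : fieldType) (k : nat) : {mpoly K[3]} :=
  [:: 'X_0 ^+ 2 + 'X_1 ^+ 2 + 'X_2 ^+ 2; 'X_1 * ('X_0 + 'X_2); 'X_0 * 'X_2]`_k.

Definition jacobian_g (K : fieldType) : 'M[{mpoly K[3]}]_3 :=
  \matrix_(k, i) (gamma K k)^`M(i).

Definition Sigma (K : fieldType) (n : nat) : 'M[{mpoly K[3]}]_n :=
  \matrix_(i, j) gamma K `|i%:Z - j%:Z|%N.

Definition dSigma (K : fieldType) (n : nat) (i : 'I_3) : 'M[{mpoly K[3]}]_n :=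
  map_mx (mderiv i) (Sigma K n).

Definition likelihood_solution (K : fieldType) (n : nat) (y : 'cV[K]_n)
    (a : 'rV[K]_3) : Prop :=
  let S := evalmx a (Sigma K n) in
  \det S != 0 /\
  forall i : 'I_3, let dS := evalmx a (dSigma K n i) in
    - \tr (invmx S *m dS)
    + (y^T *m invmx S *m dS *m invmx S *m y) 0 0 = 0.

(* Solutions for real data y that lie in the locus det (J_g^T) = 0. *)
Definition singular_solutions (R : realType) (n : nat) (y : 'cV[R]_n) :
    set 'rV[R[i]]_3 :=
  [set a | likelihood_solution (map_mx (real_complex R) y) a /\
           \det (evalmx a (jacobian_g R[i]))^T = 0].

Fact odd_index_proof (n : nat) (i : 'I_(uphalf n)) : (i.*2 < n)%N.
Proof. by rewrite -gtn_uphalf_double; case: i. Qed.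

Fact even_index_proof (n : nat) (i : 'I_(n./2)) : (i.*2.+1 < n)%N.
Proof. by rewrite -gtn_half_double; case: i. Qed.

(* The indices of y start at 0 here, so y_1, y_3, ... sit at 0, 2, ... *)
Definition y_odd (R : realType) (n : nat) (y : 'cV[R]_n) : 'cV[R]_(uphalf n) :=
  \col_i y (Ordinal (odd_index_proof i)) 0.

Definition y_even (R : realType) (n : nat) (y : 'cV[R]_n) : 'cV[R]_(n./2) :=
  \col_i y (Ordinal (even_index_proof i)) 0.

(* The successors turn the indices 0 <= i, j < k into 1 <= i, j <= k. *)
Definition min_max_form (R : realType) (k : nat) (u : 'cV[R]_k) : R :=
  \sum_(i < k) \sum_(j < k)
    (minn i.+1 j.+1 * (k + 1 - maxn i.+1 j.+1))%:R / (k + 1)%:R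
    * u i 0 * u j 0.

Definition explicit_a0 (R : realType) (n : nat) (y : 'cV[R]_n) : R :=
  1 / Num.sqrt n%:R *
  Num.sqrt (min_max_form (y_odd y) + min_max_form (y_even y)).

Definition antisymmetric_point (R : realType) (r : R) : 'rV[R[i]]_3 :=
  \row_i [:: r%:C; 0; - r%:C]%C`_i.

(* Main.v *)
Require Import Defs.
From HB Require Import structures.
From mathcomp Require Import all_boot all_order all_fingroup all_algebra all_field.
From mathcomp Require Import ring zify.
From mathcomp Require Import finmap boolp classical_sets cardinality reals.
From mathcomp Require Import complex mpoly.

(** On each component of det J_g = 0 with a_1 <> 0 the covariance matrix is c^2 M(t), where M
    is a curve of symmetric matrices: (2 + t^2) I + 2 t T_1 + T_2 if a_0 = a_2, and
    (2 I + eps T_1) - x (2 I - T_2) if a_1 = eps (a_0 + a_2). With D = det M and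
    N = y^T (adj M) y, the likelihood equations become P = 0 and n c^2 D = N, where
    P = n N' D - (n - 1) N D', so every root t of P gives two values of c.

    It remains to see that P has the expected number of simple roots for generic y. Write P as
    a quadratic form in y with polynomial coefficients. Since M commutes with the reversal of
    indices, on the sum of a symmetric vector u and s times an antisymmetric vector w this form
    is f + s^2 h, and a pencil of coprime polynomials f + s^2 h is separable for almost all s.
    That f and h can be chosen coprime means that the form vanishes identically for no t,
    infinity included, which reduces to the separability of D. For a_0 = a_2, D is
    ((n + 2)^2 - U_(n+1)^2) / (4 - t^2) for a Chebyshev polynomial U, as one sees from explicit
    kernel vectors. In the other two cases M is a definite pencil, so that D is separable
    once the kernels of the matrices M(x) are at most one-dimensional. For a_1 = 0 and
    a_0 = - a_2 the covariance matrix is a_0^2 (2 I - T_2), whose inverse is explicit. *)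
Set Implicit Arguments.
Unset Strict Implicit.
Unset Printing Implicit Defensive.

Import Order.TTheory GRing.Theory Num.Theory.

Local Open Scope ring_scope.

(** * Zariski-generic data and quadratic forms *)

(** On a component with a_1 <> 0 the three partial derivatives of Sigma span only the plane of M and
    M'. The likelihood equations therefore express criticality on the family c^2 M(t): direction M
    fixes c^2, and eliminating c^2 from direction M' leaves P. With deg D = delta n and deg N =
    delta (n - 1) one has n deg N = (n - 1) deg D, so the top terms of P cancel and its degree is
    delta (2 n - 1) - 2, that is 4 (n - 1) for delta = 2 and 2 n - 3 for delta = 1. In the linear
    case x = rho (1 - rho) with rho = a_0 / (a_0 + a_2), so each root x gives two rho and four
    solutions; whence 2 + 8 (n - 1) + 8 (2 n - 3) = 24 n - 30. The obstacle is that the values of a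
    quadratic form are not a linear system: (y_1 + t y_2)^2 vanishes identically in y for no t, yet
    it is always a square. The reversal removes the cross term, leaving a pencil that is linear in
    s^2; the price is that the form must be shown nonzero on symmetric and on antisymmetric vectors
    separately. *)

Lemma poly_nat_nonroot (F : numDomainType) (p : {poly F}) :
  p != 0 -> exists k : nat, p.[k%:R] != 0.
Proof.
move=> p0; pose rs := [seq k%:R : F | k <- iota 0 (size p)].
have: ~~ all (root p) rs.
  apply/negP => /(max_poly_roots p0); rewrite map_inj_uniq ?iota_uniq; last first.
    by move=> i j /eqP; rewrite eqr_nat => /eqP.
  by move=> /(_ isT); rewrite size_map size_iota ltnn.
by case/allPn => _ /mapP[k _ ->]; exists k.
Qed.

Lemma meval_line (F : comNzRingType) (n : nat) (p : {mpoly F[n]})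
    (u v : 'cV[F]_n) :
  exists q : {poly F}, forall s, q.[s] = p.@[fun i => (u + s *: v) i 0].
Proof.
exists (\sum_(m <- msupp p)
   (p@_m)%:P * \prod_i ((u i 0)%:P + (v i 0) *: 'X) ^+ m i) => s.
rewrite mevalE horner_sum; apply: eq_bigr => m _.
rewrite hornerM hornerC horner_prod; congr (_ * _); apply: eq_bigr => i _.
by rewrite horner_exp !hornerE !mxE mulrC.
Qed.

(* The complement of a hypersurface suffices, and naming one nonzero value of its equation
   lets intersections and real points be handled by restriction to a line. *)
Definition zgeneric (F : fieldType) (n : nat) (P : 'cV[F]_n -> Prop) :=
  exists p : {mpoly F[n]},
    (exists z : 'cV[F]_n, p.@[fun i => z i 0] != 0) /\
    forall y : 'cV[F]_n, p.@[fun i => y i 0] != 0 -> P y.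

Section Zgeneric.
Variables (F : numFieldType) (n : nat).
Implicit Types P Q : 'cV[F]_n -> Prop.

Lemma zgenericW P Q : (forall y, P y -> Q y) -> zgeneric P -> zgeneric Q.
Proof. by move=> PQ [p [pz pP]]; exists p; split=> // y /pP/PQ. Qed.

Lemma zgenericT P : (forall y, P y) -> zgeneric P.
Proof.
by move=> PT; exists 1; split=> [|//]; exists 0; rewrite meval1 oner_neq0.
Qed.

Lemma zgeneric_and P Q :
  zgeneric P -> zgeneric Q -> zgeneric (fun y => P y /\ Q y).
Proof.
move=> [p [[z pz] pP]] [q [[w qw] qQ]]; exists (p * q); split; last first.
  by move=> y; rewrite mevalM mulf_eq0 negb_or => /andP[/pP ? /qQ].
have [f fE] := meval_line p z (w - z); have [g gE] := meval_line q z (w - z).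
have f0 : f != 0.
  by apply: contraNneq pz => f0; rewrite -[z]addr0 -(scale0r (w - z)) -fE f0 horner0.
have g0 : g != 0.
  apply: contraNneq qw => g0.
  by rewrite -[w](addrNK z) addrC -(scale1r (w - z)) -gE g0 horner0.
have [k] := poly_nat_nonroot (mulf_neq0 f0 g0); rewrite hornerM fE gE => fg.
by exists (z + k%:R *: (w - z)); rewrite mevalM.
Qed.

Lemma zgeneric_all (T : eqType) (s : seq T) (P : T -> 'cV[F]_n -> Prop) :
  (forall t, t \in s -> zgeneric (P t)) ->
  zgeneric (fun y => forall t, t \in s -> P t y).
Proof.
elim: s => [_|a s IHs sP]; first exact: zgenericT.
apply: zgenericW (zgeneric_and (sP a (mem_head _ _)) (IHs _)).
  by move=> y [Pa Ps] t; rewrite inE => /predU1P[->|/Ps].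
by move=> t ts; apply: sP; rewrite inE ts orbT.
Qed.

Lemma zgeneric_ex P : zgeneric P -> exists y, P y.
Proof. by move=> [p [[z pz] pP]]; exists z; apply: pP. Qed.

End Zgeneric.

Definition qform (R : pzRingType) (n : nat) (W : 'M[R]_n) (y : 'cV[R]_n) : R :=
  (y^T *m W *m y) 0 0.

Section Qform.
Variables (R : comPzRingType) (n : nat).
Implicit Types (W : 'M[R]_n) (y : 'cV[R]_n).

Lemma qformE W y : qform W y = \sum_i \sum_j y i 0 * y j 0 * W i j.
Proof.
rewrite /qform -mulmxA mxE; apply: eq_bigr => i _.
rewrite !mxE mulr_sumr; apply: eq_bigr => j _; ring.
Qed.

Lemma qformD W1 W2 y : qform (W1 + W2) y = qform W1 y + qform W2 y.
Proof. by rewrite /qform mulmxDr mulmxDl [LHS]mxE. Qed.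

Lemma qformN W y : qform (- W) y = - qform W y.
Proof. by rewrite /qform mulmxN mulNmx [LHS]mxE. Qed.

Lemma qformZ a W y : qform (a *: W) y = a * qform W y.
Proof. by rewrite /qform -scalemxAr -scalemxAl [LHS]mxE. Qed.

Lemma qform_conj W (A : 'M[R]_n) y :
  qform W (A *m y) = qform (A^T *m W *m A) y.
Proof. by rewrite /qform trmx_mul !mulmxA. Qed.

Lemma qformDr W u v : W^T = W ->
  qform W (u + v) = qform W u + qform W v + ((u^T *m W *m v) 0 0) *+ 2.
Proof.
move=> WT; have mxD (A B : 'M[R]_1) : (A + B) 0 0 = A 0 0 + B 0 0 by rewrite mxE.
rewrite /qform [(u + v)^T]linearD /= !mulmxDl !mulmxDr !mxD mulr2n.
have -> : (v^T *m W *m u) 0 0 = (u^T *m W *m v) 0 0.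
  by rewrite -[RHS]trace_mx11 -mxtrace_tr !trmx_mul trmxK WT mulmxA trace_mx11.
ring.
Qed.

Lemma qform_scale W a y : qform W (a *: y) = a ^+ 2 * qform W y.
Proof.
by rewrite /qform [(a *: y)^T]linearZ /= -!scalemxAl -!scalemxAr scalerA -expr2 [LHS]mxE.
Qed.

End Qform.

Lemma map_qform (R S : comPzRingType) (f : {rmorphism R -> S}) n
  (W : 'M[R]_n) (y : 'cV[R]_n) :
  f (qform W y) = qform (map_mx f W) (map_mx f y).
Proof. by rewrite /qform map_trmx -!map_mxM [RHS]mxE. Qed.

(** Polarization: if the form vanishes on both basis vectors, its value on their sum is
    [W i j *+ 2]. *)
Lemma qform_neq0 (F : numFieldType) n (W : 'M[F]_n) :
  W^T = W -> W != 0 -> exists y, qform W y != 0.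
Proof.
move=> WT /matrix0Pn[i [j Wij]].
have dE a b : (((delta_mx a 0 : 'cV_n)^T *m W *m (delta_mx b 0 : 'cV_n)) 0 0) = W a b.
  by rewrite trmx_delta -rowE -colE !mxE.
have [q0|] := eqVneq (qform W (delta_mx i 0)) 0; last by exists (delta_mx i 0).
have [q1|] := eqVneq (qform W (delta_mx j 0)) 0; last by exists (delta_mx j 0).
exists (delta_mx i 0 + delta_mx j 0).
by rewrite qformDr // q0 q1 !add0r dE mulrn_eq0.
Qed.

Definition mpqform (R : comNzRingType) (n : nat) (W : 'M[R]_n) : {mpoly R[n]} :=
  \sum_i \sum_j W i j *: ('X_i * 'X_j).

Lemma meval_mpqform (R : comNzRingType) n (W : 'M[R]_n) (y : 'cV[R]_n) :
  (mpqform W).@[fun i => y i 0] = qform W y.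
Proof.
rewrite qformE raddf_sum /=; apply: eq_bigr => i _.
rewrite raddf_sum /=; apply: eq_bigr => j _.
by rewrite mevalZ mevalM !mevalXU mulrC.
Qed.

Lemma zgeneric_qform (F : fieldType) n (W : 'M[F]_n) :
  (exists y, qform W y != 0) -> zgeneric (fun y => qform W y != 0).
Proof.
by move=> [z qz]; exists (mpqform W); split=> [|y];
  [exists z|]; rewrite meval_mpqform.
Qed.

(** * A Bertini theorem for pencils of quadratic forms *)

Definition mxeval (R : comNzRingType) (p q : nat) (t : R) (M : 'M[{poly R}]_(p, q)) :=
  map_mx (horner_eval t) M.

Definition mxcoef (R : nzRingType) (p q k : nat) (M : 'M[{poly R}]_(p, q)) :=
  map_mx (fun f : {poly R} => f`_k) M.

Definition pform (R : comNzRingType) (n : nat) (W : 'M[{poly R}]_n) (y : 'cV[R]_n) :=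
  qform W (map_mx polyC y).

Section Pform.
Variables (R : comNzRingType) (n : nat).
Implicit Types (W : 'M[{poly R}]_n) (y : 'cV[R]_n).

Lemma pformE W y : pform W y = \sum_i \sum_j (y i 0 * y j 0) *: W i j.
Proof.
rewrite /pform qformE; apply: eq_bigr => i _; apply: eq_bigr => j _.
by rewrite !mxE -polyCM mul_polyC.
Qed.

Lemma horner_pform W y t : (pform W y).[t] = qform (mxeval t W) y.
Proof.
rewrite -[LHS]/(horner_eval t _) /pform map_qform; congr (qform _ _).
by apply/matrixP => i j; rewrite !mxE /= /horner_eval hornerC.
Qed.

Lemma coef_pform W y k : (pform W y)`_k = qform (mxcoef k W) y.
Proof.
rewrite pformE qformE coef_sum; apply: eq_bigr => i _.
by rewrite coef_sum; apply: eq_bigr => j _; rewrite coefZ mxE.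
Qed.

Lemma size_pform W y d :
  (forall i j, (size (W i j) <= d)%N) -> (size (pform W y) <= d)%N.
Proof.
move=> sW; rewrite pformE; apply: (leq_trans (size_sum _ _ _)).
apply/bigmax_leqP => i _; apply: (leq_trans (size_sum _ _ _)).
by apply/bigmax_leqP => j _; apply: leq_trans (size_scale_leq _ _) (sW i j).
Qed.

End Pform.

(** The size of the Sylvester matrix depends on the degrees, so both leading coefficients must
    survive [f]. Evaluation at a data vector is not injective, hence this form. *)
Lemma map_resultant_gen (aR rR : nzRingType) (f : {rmorphism aR -> rR})
    (p q : {poly aR}) :
    f (lead_coef p) != 0 -> f (lead_coef q) != 0 ->
  f (resultant p q) = resultant (map_poly f p) (map_poly f q).
Proof.
move=> fp fq; rewrite /resultant /Sylvester_mx !size_map_poly_id0 // -det_map_mx.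
rewrite /= map_col_mx; congr (\det (col_mx _ _)); apply: map_lin1_mx => v;
  by rewrite map_poly_rV rmorphM /= map_rVpoly.
Qed.

Lemma resultant_deriv_neq0 (F : idomainType) (p : {poly F}) :
  p != 0 -> (resultant p p^`() != 0) = separable_poly p.
Proof.
move=> p0; rewrite resultant_eq0 separable_poly.unlock /coprimep -leqNgt.
by rewrite eqn_leq size_poly_gt0 gcdp_eq0 (negPf p0) andbT.
Qed.

Lemma size_coef_eq (R : nzRingType) (p : {poly R}) d :
  (size p <= d.+1)%N -> p`_d != 0 -> size p = d.+1.
Proof.
move=> sp pd; apply/eqP; rewrite eqn_leq sp /= ltnNge.
by apply: contra pd => /(nth_default 0) ->.
Qed.

Section GenericSeparable.
Variables (F : numFieldType) (n : nat) (W : 'M[{poly F}]_n) (d : nat).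
Hypotheses (d_gt0 : (0 < d)%N) (sW : forall i j, (size (W i j) <= d.+1)%N).

(** The form with indeterminate data: evaluating its coefficients at [y] gives [pform W y]. *)
Let PP : {poly {mpoly F[n]}} :=
  \sum_i \sum_j ('X_i * 'X_j)%:P * map_poly (@mpolyC n F) (W i j).

Let ev (y : 'cV[F]_n) : {rmorphism {mpoly F[n]} -> F} :=
  meval (fun i => y i 0).

Let map_PP y : map_poly (ev y) PP = pform W y.
Proof.
rewrite pformE rmorph_sum; apply: eq_bigr => i _.
rewrite rmorph_sum; apply: eq_bigr => j _.
rewrite rmorphM /= map_polyC /= mevalM !mevalXU mul_polyC; congr (_ *: _).
by apply/polyP => k; rewrite !coef_map /= mevalC.
Qed.

Let size_PP : (size PP <= d.+1)%N.
Proof.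
apply: (leq_trans (size_sum _ _ _)); apply/bigmax_leqP => i _.
apply: (leq_trans (size_sum _ _ _)); apply/bigmax_leqP => j _.
rewrite mul_polyC; apply: leq_trans (size_scale_leq _ _) _.
exact: leq_trans (size_poly _ _) (sW i j).
Qed.

Let ev_resultant y : (ev y) PP`_d != 0 ->
  (ev y) (resultant PP PP^`()) = resultant (pform W y) (pform W y)^`().
Proof.
move=> evd; have PPd : PP`_d != 0.
  by apply: contraNneq evd => ->; rewrite rmorph0.
have sPP := size_coef_eq size_PP PPd.
have cd : PP^`()`_d.-1 = PP`_d *+ d by rewrite coef_deriv prednK.
have evd' : (ev y) PP^`()`_d.-1 != 0.
  by rewrite cd rmorphMn mulrn_eq0 negb_or -lt0n d_gt0.
have PPd' : PP^`()`_d.-1 != 0.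
  by apply: contraNneq evd' => ->; rewrite rmorph0.
have sPP' : size PP^`() = d.
  rewrite -[RHS](prednK d_gt0); apply: size_coef_eq => //.
  rewrite prednK //; apply: leq_trans (leq_trans (size_poly _ _) _) (leqnn _).
  by rewrite sPP.
by rewrite map_resultant_gen -?deriv_map ?map_PP // lead_coefE ?sPP ?sPP'.
Qed.

(** Bad data lie on the hypersurface where the coefficient of degree [d] times the resultant with
    the derivative vanishes. The first factor keeps the degree and so allows the resultant to be
    specialized; in characteristic 0 it also controls the leading coefficient of the derivative. *)
Lemma zgeneric_separable :
  (exists z, size (pform W z) = d.+1 /\ separable_poly (pform W z)) ->
  zgeneric (fun y => size (pform W y) = d.+1 /\ separable_poly (pform W y)).
Proof.
have evd y : (ev y) PP`_d = (pform W y)`_d by rewrite -map_PP coef_map.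
move=> [z [sz sepz]]; exists (PP`_d * resultant PP PP^`()); split.
  have zd : (pform W z)`_d != 0.
    by have := lead_coef_eq0 (pform W z); rewrite lead_coefE sz /= => ->;
       rewrite -size_poly_eq0 sz.
  exists z; rewrite mevalM mulf_neq0 // ?[_.@[_]]evd //.
  rewrite [_.@[_]]ev_resultant ?evd // resultant_deriv_neq0 //.
  exact: separable_poly_neq0.
move=> y; rewrite mevalM mulf_eq0 negb_or => /andP[].
rewrite [_.@[_]]evd => yd; rewrite [_.@[_]]ev_resultant ?evd //.
have sy : size (pform W y) = d.+1 by apply: size_coef_eq yd; apply: size_pform.
by rewrite resultant_deriv_neq0 // -size_poly_eq0 sy.
Qed.

End GenericSeparable.

Lemma closed_roots (F : closedFieldType) (p : {poly F}) :
  p != 0 -> exists rs : seq F, forall t, root p t = (t \in rs).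
Proof.
move=> p0; have [rs pE] := closed_field_poly_normal p; exists rs => t.
by rewrite pE rootZ ?lead_coef_eq0 // root_prod_XsubC.
Qed.

Lemma closed_coprimepP (F : closedFieldType) (p q : {poly F}) :
  (forall t, ~~ (root p t && root q t)) -> coprimep p q.
Proof.
move=> pq; apply/negPn/negP => /closed_rootP[t].
by rewrite root_gcd (negPf (pq t)).
Qed.

(** If the Wronskian vanished, [f] would divide [f^]() * h[, hence by coprimality]f^[()], which is
    nonzero and of smaller degree. *)
Lemma pencil_wronskian_neq0 (F : numFieldType) (f h : {poly F}) :
  coprimep f h -> (1 < size f)%N -> f^`() * h - f * h^`() != 0.
Proof.
move=> cfh sf; apply/eqP => /eqP; rewrite subr_eq0 => /eqP e.
have: f %| f^`() * h by rewrite e dvdp_mulr.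
rewrite Gauss_dvdpl // => /dvdp_leq.
have f'0 : f^`() != 0.
  apply/eqP => /(congr1 (fun p : {poly F} => p`_(size f).-2)).
  rewrite coef_deriv coef0 => /eqP; rewrite mulrn_eq0 /=.
  have -> : (size f).-2.+1 = (size f).-1 by case: (size f) sf => [|[]].
  by rewrite -lead_coefE lead_coef_eq0 -size_poly_eq0; case: (size f) sf.
move=> /(_ f'0); rewrite leqNgt lt_size_deriv // -size_poly_eq0.
by case: (size f) sf.
Qed.

(* A double root of f + s h is a zero of the Wronskian, and there it determines s. *)
Lemma pencil_separable (F : numClosedFieldType) (f h : {poly F}) :
  coprimep f h -> (1 < size f)%N || (1 < size h)%N ->
  exists2 r : {poly F}, r != 0 &
    forall s, r.[s] != 0 -> separable_poly (f + s *: h).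
Proof.
move=> cfh sfh; pose w := f^`() * h - f * h^`().
have w0 : w != 0.
  case/orP: sfh => [|sh]; first exact: pencil_wronskian_neq0.
  have := pencil_wronskian_neq0 (etrans (coprimep_sym h f) cfh) sh.
  by apply: contraNneq => w0; rewrite -oppr_eq0 -w0 /w; apply/eqP; ring.
have [rs rsE] := closed_roots w0.
(* The roots [s] of this product are the parameters for which [f + s *: h] vanishes at some zero of
   the Wronskian; no factor is zero because [f] and [h] have no common root. *)
exists (\prod_(t <- rs) ((f.[t])%:P + h.[t] *: 'X)).
  rewrite prodf_seq_neq0; apply/allP => t _ /=; apply/eqP => e.
  have ft : root f t.
    by have := congr1 (fun p : {poly F} => p`_0) e;
      rewrite coefD coefC coefZ coefX mulr0 addr0 coef0 => /eqP.
  have ht : root h t.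
    by have := congr1 (fun p : {poly F} => p`_1) e;
      rewrite coefD coefC coefZ coefX mulr1 add0r coef0 => /eqP.
  by have := coprimep_root cfh ft; rewrite (eqP ht) eqxx.
move=> s rs0; rewrite separable_poly.unlock; apply: closed_coprimepP => t.
apply/negP => /andP[/rootP pt /rootP pt'].
rewrite derivD derivZ !hornerE in pt pt'.
have tw : t \in rs.
  rewrite -rsE /root /w !hornerE.
  have -> : f.[t] = - (s * h.[t]) by rewrite -[LHS](addrK (s * h.[t])) pt sub0r.
  have -> : f^`().[t] = - (s * h^`().[t]).
    by rewrite -[LHS](addrK (s * h^`().[t])) pt' sub0r.
  by apply/eqP; ring.
move/negP: rs0; apply; rewrite horner_prod (big_rem t) //= !hornerE.
by rewrite [h.[t] * s]mulrC pt mul0r.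
Qed.

Section Bertini.
Variables (F : numClosedFieldType) (n d : nat) (W1 W2 : 'M[{poly F}]_n).
Hypotheses (d_gt0 : (0 < d)%N).
Hypothesis sW1 : forall u, (size (pform W1 u) <= d.+1)%N.
Hypothesis sW2 : forall w, (size (pform W2 w) <= d.+1)%N.
Hypothesis bpf : forall t, (exists u, qform (mxeval t W1) u != 0) \/
                           (exists w, qform (mxeval t W2) w != 0).
Hypothesis bpf_infty : (exists u, qform (mxcoef d W1) u != 0) \/
                       (exists w, qform (mxcoef d W2) w != 0).
Hypotheses (W1_neq0 : exists u, pform W1 u != 0)
           (W2_neq0 : exists w, pform W2 w != 0).

Let zgeneric_imp (W : 'M[F]_n) :
  zgeneric (fun y => (exists u, qform W u != 0) -> qform W y != 0).
Proof.
have [ex|nex] := EM (exists u, qform W u != 0); last by apply: zgenericT.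
by apply: zgenericW (zgeneric_qform ex).
Qed.

(** Coprimality concerns roots that move with the vectors, so the choice is made in two rounds. An
    auxiliary [u0] confines to the finite set [rs1] the points where [W1] vanishes as a form; [w] is
    chosen to avoid zeros there whenever possible, then [u] to avoid zeros at the roots of [h]. At a
    common root [W1] would vanish as a form, so by [bpf] the form [W2] would not, against the choice
    of [w]. *)
Lemma bertini : exists u w s, let p := pform W1 u + s ^+ 2 *: pform W2 w in
  size p = d.+1 /\ separable_poly p.
Proof.
have [u0 pu0] := W1_neq0; have [rs1 rs1E] := closed_roots pu0.
have [w0 pw0] := W2_neq0; have [k w0k] := poly_nat_nonroot pw0.
have [w [hk hd hrs]] : exists w, [/\ qform (mxeval k%:R W2) w != 0,
    (exists w, qform (mxcoef d W2) w != 0) -> qform (mxcoef d W2) w != 0 &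
    forall t, t \in rs1 -> (exists w, qform (mxeval t W2) w != 0) ->
       qform (mxeval t W2) w != 0].
  apply: (@zgeneric_ex F); apply: zgenericW (zgeneric_and (zgeneric_and
    (@zgeneric_qform F n (mxeval k%:R W2) _) (zgeneric_imp (mxcoef d W2)))
    (zgeneric_all (fun t (_ : t \in rs1) => zgeneric_imp (mxeval t W2)))).
    by move=> y [[? ?] ?]; split.
  by exists w0; rewrite -horner_pform.
have h0 : pform W2 w != 0.
  by apply: contraNneq hk => h0; rewrite -horner_pform h0 horner0.
have [rs2 rs2E] := closed_roots h0.
have [u [fd frs]] : exists u,
    ((exists u, qform (mxcoef d W1) u != 0) -> qform (mxcoef d W1) u != 0) /\
    forall t, t \in rs2 -> (exists u, qform (mxeval t W1) u != 0) ->
       qform (mxeval t W1) u != 0.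
  apply: (@zgeneric_ex F); apply: (zgeneric_and (zgeneric_imp (mxcoef d W1))).
  exact: (zgeneric_all (fun t (_ : t \in rs2) => zgeneric_imp (mxeval t W1))).
set f := pform W1 u; set h := pform W2 w.
have cfh : coprimep f h.
  apply: closed_coprimepP => t; apply/negP => /andP[ft ht].
  have nW1 : ~ exists u, qform (mxeval t W1) u != 0.
    move/(frs t); rewrite -rs2E => /(_ ht).
    by rewrite -horner_pform (rootP ft) eqxx.
  have [//|W2t] := bpf t.
  have trs1 : t \in rs1.
    rewrite -rs1E /root horner_pform; apply/negP => /negP q0.
    by apply: nW1; exists u0.
  by have := hrs t trs1 W2t; rewrite -horner_pform (rootP ht) eqxx.
have fhd : (f`_d != 0) || (h`_d != 0).
  by rewrite !coef_pform; case: bpf_infty => [/fd ->|/hd ->] //; rewrite orbT.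
have sfh : (1 < size f)%N || (1 < size h)%N.
  case/orP: fhd => [fd0|hd0]; apply/orP; [left|right].
    by rewrite (size_coef_eq _ fd0) ?sW1.
  by rewrite (size_coef_eq _ hd0) ?sW2.
have [r r0 rP] := pencil_separable cfh sfh.
(* The coefficient of degree [d] of the pencil, as a polynomial in its parameter: the degree drops
   for at most one value. The parameter is then a natural number [j], and [s] is its square root. *)
have c0 : (f`_d)%:P + h`_d *: 'X != 0.
  apply/eqP => e; move: fhd.
  have := congr1 (fun p : {poly F} => p`_0) e.
  have := congr1 (fun p : {poly F} => p`_1) e.
  by rewrite !coefE mulr0 mulr1 add0r addr0 => -> ->; rewrite eqxx.
have [j] := poly_nat_nonroot (mulf_neq0 r0 c0).
rewrite !hornerE mulf_eq0 negb_or => /andP[rj cj].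
exists u, w, (sqrtC j%:R); rewrite sqrtCK /=; split; last exact: rP.
apply: size_coef_eq; last by rewrite coefD coefZ mulrC.
rewrite (leq_trans (size_polyD _ _)) // geq_max sW1 //=.
by rewrite (leq_trans (size_scale_leq _ _)) ?sW2.
Qed.

End Bertini.

(** * Polynomial matrices: derivative, evaluation and top coefficients *)

Definition dermx (R : comNzRingType) (p q : nat) (M : 'M[{poly R}]_(p, q)) :=
  map_mx (@deriv R) M.

Section PolyMatrix.
Variable R : comNzRingType.

Lemma dermx_mul p q r (A : 'M[{poly R}]_(p, q)) (B : 'M[{poly R}]_(q, r)) :
  dermx (A *m B) = dermx A *m B + A *m dermx B.
Proof.
apply/matrixP => i j; rewrite !mxE raddf_sum -big_split /=.
by apply: eq_bigr => k _; rewrite !mxE derivM.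
Qed.

Lemma dermx_const p q (A : 'M[R]_(p, q)) : dermx (map_mx polyC A) = 0.
Proof. by apply/matrixP => i j; rewrite !mxE derivC. Qed.

Lemma dermx_scalar n (f : {poly R}) : dermx f%:M = (f^`())%:M :> 'M_n.
Proof. by apply/matrixP => i j; rewrite !mxE; case: eqP; rewrite ?mulr1n ?mulr0n ?linear0. Qed.

Lemma deriv_pform n (W : 'M[{poly R}]_n) y : (pform W y)^`() = pform (dermx W) y.
Proof.
rewrite !pformE raddf_sum; apply: eq_bigr => i _; rewrite raddf_sum /=.
by apply: eq_bigr => j _; rewrite derivZ mxE.
Qed.

Lemma mxeval_const t p q (A : 'M[R]_(p, q)) : mxeval t (map_mx polyC A) = A.
Proof. by apply/matrixP => i j; rewrite !mxE /= /horner_eval hornerC. Qed.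

Lemma coefM_top (p q : {poly R}) a b : (size p <= a.+1)%N -> (size q <= b.+1)%N ->
  (p * q)`_(a + b) = p`_a * q`_b.
Proof.
move=> sp sq; have ha : (a < (a + b).+1)%N by lia.
rewrite coefM (bigD1 (Ordinal ha)) //= addKn big1 ?addr0 // => i.
rewrite -val_eqE /= => ia; have [lt|ge] := ltnP i a.
  by rewrite (nth_default _ (leq_trans sq _)) ?mulr0 //; lia.
by rewrite (nth_default _ (leq_trans sp _)) ?mul0r //; lia.
Qed.

(** Needed to study the critical form at infinity, where the top coefficients cancel and the next
    ones decide. *)
Lemma coefM_next (p q : {poly R}) a b :
  (size p <= a.+2)%N -> (size q <= b.+2)%N ->
  (p * q)`_(a + b).+1 = p`_a.+1 * q`_b + p`_a * q`_b.+1.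
Proof.
move=> sp sq; have ha : (a < (a + b).+2)%N by lia.
have ha1 : (a.+1 < (a + b).+2)%N by lia.
rewrite coefM (bigD1 (Ordinal ha1)) //= (bigD1 (Ordinal ha)) /=; last first.
  by rewrite -val_eqE /=; lia.
rewrite [X in _ + (_ + X)]big1 ?addr0; last first.
  move=> i; rewrite -!val_eqE /= => ia; have [lt|ge] := ltnP i a.
    by rewrite (nth_default _ (leq_trans sq _)) ?mulr0 //; lia.
  by rewrite (nth_default _ (leq_trans sp _)) ?mul0r //; lia.
have -> : ((a + b).+1 - a.+1)%N = b by lia.
by have -> : ((a + b).+1 - a)%N = b.+1 by lia.
Qed.

Lemma mxcoef_mul_top p q r (A : 'M[{poly R}]_(p, q)) (B : 'M[{poly R}]_(q, r)) a b :
  (forall i j, size (A i j) <= a.+1)%N -> (forall i j, size (B i j) <= b.+1)%N ->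
  mxcoef (a + b) (A *m B) = mxcoef a A *m mxcoef b B.
Proof.
move=> sA sB; apply/matrixP => i j; rewrite !mxE coef_sum.
by apply: eq_bigr => k _; rewrite !mxE coefM_top.
Qed.

Lemma mxcoef_mul_next p q r (A : 'M[{poly R}]_(p, q)) (B : 'M[{poly R}]_(q, r)) a b :
  (forall i j, size (A i j) <= a.+2)%N -> (forall i j, size (B i j) <= b.+2)%N ->
  mxcoef (a + b).+1 (A *m B) =
  mxcoef a.+1 A *m mxcoef b B + mxcoef a A *m mxcoef b.+1 B.
Proof.
move=> sA sB; apply/matrixP => i j; rewrite !mxE coef_sum -big_split.
by apply: eq_bigr => k _; rewrite !mxE coefM_next.
Qed.

Lemma mxcoef_scalar n (f : {poly R}) k : mxcoef k f%:M = (f`_k)%:M :> 'M_n.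
Proof. by apply/matrixP => i j; rewrite !mxE coefMn. Qed.

Lemma size_prod_bound (I : Type) (r : seq I) (f : I -> {poly R}) d :
  (forall i, size (f i) <= d.+1)%N ->
  (size (\prod_(i <- r) f i)%R <= (d * size r).+1)%N /\
  (\prod_(i <- r) f i)`_(d * size r) = \prod_(i <- r) (f i)`_d.
Proof.
move=> sf; elim: r => [|i r [IHs IHc]].
  by rewrite !big_nil muln0 size_poly1 coef1.
rewrite !big_cons [size (_ :: _)]/= mulnS coefM_top // IHc; split=> //.
apply: leq_trans (size_polyMleq _ _) _.
by move: (sf i) IHs; lia.
Qed.

Lemma det_bound n (M : 'M[{poly R}]_n) d :
  (forall i j, size (M i j) <= d.+1)%N ->
  (size (\det M) <= (d * n).+1)%N /\ (\det M)`_(d * n) = \det (mxcoef d M).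
Proof.
move=> sM; have ne : size (index_enum ('I_n : finType)) = n.
  by rewrite -[RHS](card_ord n) cardT /= enumT.
have sb (s : {perm 'I_n}) :=
  @size_prod_bound _ (index_enum ('I_n : finType)) (fun i => M i (s i)) d (fun i => sM i _).
rewrite ne in sb; split.
  apply: leq_trans (size_sum _ _ _) _; apply/bigmax_leqP => s _.
  rewrite -[(-1) ^+ s]/((-1) ^+ s) -signr_odd mulr_sign; case: ifP => _.
    by rewrite size_polyN; have [] := sb s.
  by have [] := sb s.
rewrite coef_sum; apply: eq_bigr => s _.
have [_ <-] : (True /\ \prod_i (M i (s i))`_d = \prod_i mxcoef d M i (s i)).
  by split=> //; apply: eq_bigr => i _; rewrite mxE.
rewrite -(sb s).2 -![(-1) ^+ s]signr_odd !mulr_sign.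
by case: ifP => _ //; rewrite coefN.
Qed.

Lemma size_adj n (M : 'M[{poly R}]_n) d :
  (forall i j, size (M i j) <= d.+1)%N ->
  forall i j, (size (\adj M i j) <= (d * n.-1).+1)%N.
Proof.
move=> sM i j; rewrite mxE /cofactor -signr_odd mulr_sign.
have sd : (size (\det (row' j (col' i M))) <= (d * n.-1).+1)%N.
  by apply: (proj1 (det_bound _)) => k l; rewrite !mxE.
by case: ifP => _ //; rewrite size_polyN.
Qed.

End PolyMatrix.

Lemma poly_eq0_horner (F : numDomainType) (p : {poly F}) :
  (forall k : nat, p.[k%:R] = 0) -> p = 0.
Proof.
move=> p0; have [//|/poly_nat_nonroot[k]] := eqVneq p 0.
by rewrite p0 eqxx.
Qed.

(** * Forms that commute with an involution *)

Section ReversalBertini.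
Variables (F : numClosedFieldType) (n d : nat) (J : 'M[F]_n) (W : 'M[{poly F}]_n).
Hypotheses (JT : J^T = J) (JJ : J *m J = 1%:M).
Hypotheses (WT : W^T = W) (WJ : map_mx polyC J *m W = W *m map_mx polyC J).
Hypotheses (d_gt0 : (0 < d)%N) (sW : forall i j, (size (W i j) <= d.+1)%N).
Hypothesis W_neq0 : forall t, mxeval t W != 0.
Hypothesis Wd_neq0 : mxcoef d W != 0.
Hypothesis Wsym_neq0 : exists u, pform W ((1%:M + J) *m u) != 0.
Hypothesis Wanti_neq0 : exists w, pform W ((1%:M - J) *m w) != 0.

(** The cross term contains [(1 + J) V (1 - J) = V (1 - J^2) = 0]. *)
Let qform_split (V : 'M[F]_n) u w : V^T = V -> J *m V = V *m J ->
  qform V ((1%:M + J) *m u + (1%:M - J) *m w) =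
  qform V ((1%:M + J) *m u) + qform V ((1%:M - J) *m w).
Proof.
move=> VT VJ; rewrite qformDr //; set X := _ *m _ *m _.
suff -> : X = 0 by rewrite mxE mul0rn addr0.
rewrite /X trmx_mul linearD /= trmx1 JT -!mulmxA.
suff -> : (1%:M + J) *m (V *m ((1%:M - J) *m w)) = 0 by rewrite mulmx0.
rewrite !mulmxA; suff -> : (1%:M + J) *m V *m (1%:M - J) = 0 by rewrite mul0mx.
rewrite mulmxDl mul1mx VJ mulmxBr mulmx1 mulmxDl -mulmxA JJ mulmx1.
by rewrite [_ + V]addrC subrr.
Qed.

Let WtT t : (mxeval t W)^T = mxeval t W.
Proof. by rewrite /mxeval map_trmx WT. Qed.

Let WtJ t : J *m mxeval t W = mxeval t W *m J.
Proof.
by have := congr1 (mxeval t) WJ; rewrite /mxeval !map_mxM /= -!/(mxeval t _) mxeval_const.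
Qed.

Let WdT : (mxcoef d W)^T = mxcoef d W.
Proof. by rewrite /mxcoef map_trmx WT. Qed.

Let WdJ : J *m mxcoef d W = mxcoef d W *m J.
Proof.
apply/matrixP => i j; have := congr1 (fun A : 'M[{poly F}]_n => (A i j)`_d) WJ.
rewrite !mxE !coef_sum => e; rewrite -[LHS]/(\sum_(k < n) _) in e *.
transitivity (\sum_k (map_mx polyC J i k * W k j)`_d).
  by apply: eq_bigr => k _; rewrite !mxE coefCM.
by rewrite e; apply: eq_bigr => k _; rewrite !mxE coefMC.
Qed.

Let split_neq0 (V : 'M[F]_n) : V^T = V -> J *m V = V *m J -> V != 0 ->
  (exists u, qform ((1%:M + J)^T *m V *m (1%:M + J)) u != 0) \/
  (exists w, qform ((1%:M - J)^T *m V *m (1%:M - J)) w != 0).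
Proof.
move=> VT VJ /(qform_neq0 VT)[y qy]; pose u := 2^-1 *: y.
have yE : y = (1%:M + J) *m u + (1%:M - J) *m u.
  rewrite -mulmxDl addrACA subrr addr0 mulmxDl mul1mx -mulr2n -scaler_nat scalerA.
  by rewrite mulfV ?scale1r // pnatr_eq0.
move: qy; rewrite yE qform_split // !qform_conj => q.
have [q0|] := eqVneq (qform ((1%:M + J)^T *m V *m (1%:M + J)) u) 0.
  by right; exists u; rewrite q0 add0r in q.
by left; exists u.
Qed.

Let pform_conj (A : 'M[F]_n) u :
  pform ((map_mx polyC A)^T *m W *m map_mx polyC A) u = pform W (A *m u).
Proof. by rewrite /pform -qform_conj -map_mxM. Qed.

Let mxeval_conj t (A : 'M[F]_n) :
  mxeval t ((map_mx polyC A)^T *m W *m map_mx polyC A) = A^T *m mxeval t W *m A.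
Proof. by rewrite map_trmx /mxeval !map_mxM /= -!/(mxeval t _) !mxeval_const. Qed.

Let mxcoef_conj (A : 'M[F]_n) :
  mxcoef d ((map_mx polyC A)^T *m W *m map_mx polyC A) = A^T *m mxcoef d W *m A.
Proof.
apply/matrixP => i j; rewrite !mxE coef_sum; apply: eq_bigr => k _.
rewrite !mxE coefMC coef_sum; congr (_ * _); apply: eq_bigr => l _.
by rewrite !mxE coefCM.
Qed.

(* On y = (1 + J) u + s (1 - J) w the form is f + s^2 h, without cross term. *)
Lemma reversal_bertini :
  zgeneric (fun y => size (pform W y) = d.+1 /\ separable_poly (pform W y)).
Proof.
apply: zgeneric_separable => //.
pose S (A : 'M[F]_n) := (map_mx polyC A)^T *m W *m map_mx polyC A.
have [||||||u [w [s]]] := @bertini F n d (S (1%:M + J)) (S (1%:M - J)) d_gt0.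
- by move=> u; rewrite pform_conj size_pform.
- by move=> u; rewrite pform_conj size_pform.
- by move=> t; rewrite !mxeval_conj; apply: split_neq0.
- by rewrite !mxcoef_conj; apply: split_neq0.
- by have [u] := Wsym_neq0; exists u; rewrite pform_conj.
- by have [u] := Wanti_neq0; exists u; rewrite pform_conj.
rewrite !pform_conj => sep.
exists ((1%:M + J) *m u + (1%:M - J) *m (s *: w)).
suff -> : pform W ((1%:M + J) *m u + (1%:M - J) *m (s *: w)) =
  pform W ((1%:M + J) *m u) + s ^+ 2 *: pform W ((1%:M - J) *m w) by [].
apply/eqP; rewrite -subr_eq0; apply/eqP/poly_eq0_horner => k.
rewrite !hornerE !horner_pform qform_split // -scalemxAr qform_scale.
exact: subrr.
Qed.

End ReversalBertini.

(** * Critical points along a curve of symmetric matrices *)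

(* [pform (critmx M) y] is n N' D - (n - 1) N D', with D = det M and N = y^T (adj M) y:
   up to the factor N^(n-1) / D^n, the derivative of N^n / D^(n-1). *)
Definition critmx (R : comNzRingType) (n : nat) (M : 'M[{poly R}]_n) : 'M[{poly R}]_n :=
  n%:R *: (\det M *: dermx (\adj M)) - n.-1%:R *: ((\det M)^`() *: \adj M).

Section CriticalCoef.
Variables (R : comNzRingType) (D N : {poly R}) (m e a b : nat).
Hypotheses (sD : (size D <= m.+3)%N) (sN : (size N <= e.+3)%N).
Hypothesis ab : (a * e.+2 = b * m.+2)%N.
Let P := a%:R * (D * N^`()) - b%:R * (D^`() * N).

Let size_deriv_bound (p : {poly R}) k : (size p <= k.+1 -> size p^`() <= k)%N.
Proof.
move=> sp; have [->|p0] := eqVneq p 0; first by rewrite deriv0 size_poly0.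
by rewrite -ltnS; apply: leq_trans (lt_size_deriv p0) sp.
Qed.

Let abR : a%:R * e.+2%:R = b%:R * m.+2%:R :> R.
Proof. by rewrite -!natrM ab. Qed.

Let coefP k : P`_k = a%:R * (D * N^`())`_k - b%:R * (D^`() * N)`_k.
Proof. by rewrite coefB -!polyC_natr !coefCM. Qed.

(** The coefficient of degree deg D + deg N - 1 is the product of the leading coefficients times
    [a (e + 2) - b (m + 2)], which [ab] makes zero; so P loses one more degree than a generic
    combination of this kind. *)
Lemma size_critical : (size P <= (m + e).+3)%N.
Proof.
have sD' := size_deriv_bound sD; have sN' := size_deriv_bound sN.
apply/leq_sizeP => k; rewrite leq_eqVlt coefP => /orP[/eqP <-|lt].
  have e1 : (m + e).+3 = (m.+2 + e.+1)%N by lia.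
  have e2 : (m + e).+3 = (m.+1 + e.+2)%N by lia.
  rewrite {1}e1 e2 !coefM_top // !coef_deriv -mulr_natr -[D`__ *+ _]mulr_natr.
  transitivity (D`_m.+2 * N`_e.+2 * (a%:R * e.+2%:R - b%:R * m.+2%:R)); first by ring.
  by rewrite abR subrr mulr0.
rewrite !(nth_default _ (leq_trans (size_polyMleq _ _) _)) ?mulr0 ?subrr //.
  by move: sD' sN; move: (size _) (size _) => u v; lia.
by move: sD sN'; move: (size _) (size _) => u v; lia.
Qed.

Lemma coef_critical :
  P`_(m + e).+2 = b%:R * (D`_m.+1 * N`_e.+2) - a%:R * (D`_m.+2 * N`_e.+1).
Proof.
have sD' := size_deriv_bound sD; have sN' := size_deriv_bound sN; rewrite coefP.
have -> : (D * N^`())`_(m + e).+2 = D`_m.+2 * N^`()`_e + D`_m.+1 * N^`()`_e.+1.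
  by rewrite -(coefM_next sD sN').
have -> : (D^`() * N)`_(m + e).+2 = D^`()`_m.+1 * N`_e.+1 + D^`()`_m * N`_e.+2.
  by rewrite -(coefM_next sD' sN) -addnS.
rewrite !coef_deriv -[N`__ *+ e.+1]mulr_natr -[N`__ *+ e.+2]mulr_natr.
rewrite -[D`__ *+ m.+1]mulr_natr -[D`__ *+ m.+2]mulr_natr.
transitivity (b%:R * (D`_m.+1 * N`_e.+2) - a%:R * (D`_m.+2 * N`_e.+1) +
  (D`_m.+1 * N`_e.+2 + D`_m.+2 * N`_e.+1) * (a%:R * e.+2%:R - b%:R * m.+2%:R)).
  rewrite -[e.+2%:R]natr1 -[m.+2%:R]natr1.
  by move: D`_m.+1 D`_m.+2 N`_e.+1 N`_e.+2 e.+1%:R m.+1%:R a%:R b%:R => *; ring.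
by rewrite abR subrr mulr0 addr0.
Qed.

End CriticalCoef.

Lemma trmx_cofactor (R : comPzRingType) n (M : 'M[R]_n) i j :
  cofactor M^T i j = cofactor M j i.
Proof.
rewrite /cofactor addnC; congr (_ * _).
by rewrite -det_tr; congr (\det _); apply/matrixP => k l; rewrite !mxE.
Qed.

Lemma trmx_adj_sym (R : comPzRingType) n (M : 'M[R]_n) :
  M^T = M -> (\adj M)^T = \adj M.
Proof. by move=> MT; apply/matrixP => i j; rewrite !mxE -[in LHS]MT trmx_cofactor. Qed.

Lemma mulmx_commZ (R : comPzRingType) n (A X : 'M[R]_n) a :
  A *m X = X *m A -> A *m (a *: X) = (a *: X) *m A.
Proof. by move=> AX; rewrite -scalemxAr -scalemxAl AX. Qed.

Lemma mulmx_commB (R : comPzRingType) n (A X Y : 'M[R]_n) :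
  A *m X = X *m A -> A *m Y = Y *m A -> A *m (X - Y) = (X - Y) *m A.
Proof. by move=> AX AY; rewrite mulmxBr mulmxBl AX AY. Qed.

(** Multiplying the last matrix relation by [X] on both sides eliminates [A] and [B]. With [X], [Y]
    the two top coefficients of M and [A], [B] those of its adjugate, this says that the critical
    form can vanish at infinity only if [Y] is a multiple of [X]. *)
Lemma proportional_of_crit (F : fieldType) n (X Y A B : 'M[F]_n) (a b c1 c0 : F) :
  c1 = c0 + 1 -> a != 0 -> X *m A = a%:M -> X *m B + Y *m A = b%:M ->
  (c0 * b) *: A - (c1 * a) *: B = 0 -> c1 != 0 -> exists c, Y = c *: X.
Proof.
move=> c1E a0 XA XBYA AB c10; exists (b / (c1 * a)).
have AX : A *m X = a%:M.
  have /mulmx1C : X *m (a^-1 *: A) = 1%:M.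
    by rewrite -scalemxAr XA scale_scalar_mx mulVf.
  rewrite -scalemxAl => /(congr1 ( *:%R a)).
  by rewrite scalerA mulfV // scale1r scale_scalar_mx mulr1.
have XBX : X *m B *m X = b *: X - a *: Y.
  rewrite -[X *m B](addrK (Y *m A)) XBYA mulmxBl -mulmxA AX.
  by rewrite mul_scalar_mx mul_mx_scalar.
have := congr1 (fun Z => X *m Z *m X) AB.
rewrite mulmx0 mul0mx mulmxBr mulmxBl -!scalemxAr -!scalemxAl XA XBX mul_scalar_mx.
move=> e; have : (c1 * a * a) *: Y = (b * a) *: X.
  apply/eqP; rewrite -subr_eq0 -[X in _ == X]e c1E; apply/eqP/matrixP => i j.
  by rewrite !mxE; ring.
move/(congr1 ( *:%R (c1 * a * a)^-1)); rewrite !scalerA mulVf ?mulf_neq0 // scale1r.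
by move=> ->; congr (_ *: _); field; rewrite a0 c10.
Qed.

Section Family.
Variables (F : numClosedFieldType) (n delta : nat) (J : 'M[F]_n).
Variable (M : 'M[{poly F}]_n).
Hypotheses (n_ge3 : (2 < n)%N) (delta_gt0 : (0 < delta)%N).
Hypotheses (JT : J^T = J) (JJ : J *m J = 1%:M).
Hypotheses (MT : M^T = M) (MJ : map_mx polyC J *m M = M *m map_mx polyC J).
Hypothesis sM : forall i j, (size (M i j) <= delta.+1)%N.
Hypothesis Mtop_unit : \det (mxcoef delta M) != 0.
Hypothesis Mnext_neq : forall c, mxcoef delta.-1 M != c *: mxcoef delta M.
Hypothesis D_separable : separable_poly (\det M).
Hypothesis Mder_neq : forall t c, mxeval t (dermx M) != c *: mxeval t M.
Hypothesis Mtop_sym : exists u, qform (mxcoef delta M) ((1%:M + J) *m u) != 0.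
Hypothesis Mtop_anti : exists u, qform (mxcoef delta M) ((1%:M - J) *m u) != 0.

Local Notation D := (\det M).
Local Notation adjM := (\adj M).
Local Notation W := (critmx M).
Let m := (delta * n)%N.
Let e := (delta * n.-1)%N.

Let D_neq0 : D != 0. Proof. exact: separable_poly_neq0. Qed.
Let sD : (size D <= m.+1)%N. Proof. by have [] := det_bound sM. Qed.
Let Dm : D`_m = \det (mxcoef delta M). Proof. by have [] := det_bound sM. Qed.
Let sadj i j : (size (adjM i j) <= e.+1)%N. Proof. exact: size_adj. Qed.
Let m_eq : m = (delta + e)%N.
Proof. by rewrite /m /e -mulnS prednK //; lia. Qed.
Let e_ge2 : (1 < e)%N.
Proof.
have n1 : (2 <= n.-1)%N by move: n_ge3; clear; lia.
by apply: (leq_trans n1); rewrite /e leq_pmull.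
Qed.

Let adjT : adjM^T = adjM. Proof. exact: trmx_adj_sym. Qed.

Let adjJ : map_mx polyC J *m adjM = adjM *m map_mx polyC J.
Proof.
apply/eqP; rewrite -subr_eq0; apply/eqP.
set X := _ - _; suff: D *: X = 0.
  by move/eqP; rewrite scalemx_eq0 (negPf D_neq0) => /eqP.
have := congr1 (fun Z => adjM *m Z *m adjM) MJ; rewrite !mulmxA mul_adj_mx.
rewrite -[adjM *m _ *m M *m adjM]mulmxA mul_mx_adj -[D%:M *m _ *m adjM]mulmxA.
by rewrite mul_mx_scalar mul_scalar_mx /X scalerBr => ->; rewrite subrr.
Qed.

Let dadjJ : map_mx polyC J *m dermx adjM = dermx adjM *m map_mx polyC J.
Proof.
have := congr1 (@dermx _ _ _) adjJ.
by rewrite !dermx_mul dermx_const mul0mx mulmx0 add0r addr0.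
Qed.

Let WT : W^T = W.
Proof.
have dT : (dermx adjM)^T = dermx adjM by rewrite /dermx map_trmx adjT.
by rewrite /critmx [LHS]linearB /= ![(_ *: _)^T]linearZ /= ![(_ *: _)^T]linearZ /= dT adjT.
Qed.

Let WJ : map_mx polyC J *m W = W *m map_mx polyC J.
Proof.
by apply: mulmx_commB; apply: mulmx_commZ; apply: mulmx_commZ; [exact: dadjJ|exact: adjJ].
Qed.

Let DM : M *m adjM = D%:M. Proof. exact: mul_mx_adj. Qed.
Let dDM : dermx M *m adjM + M *m dermx adjM = (D^`())%:M.
Proof. by rewrite -dermx_mul DM dermx_scalar. Qed.

Let Mdadj : M *m dermx adjM *m M = D^`() *: M - D *: dermx M.
Proof.
have := congr1 (fun Z => Z *m M) dDM; rewrite mulmxDl -[dermx M *m _ *m M]mulmxA.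
rewrite mul_adj_mx mul_scalar_mx mul_mx_scalar => <-.
by rewrite addrC addKr.
Qed.

Let MWM : M *m W *m M = D *: (D^`() *: M - n%:R *: (D *: dermx M)).
Proof.
rewrite /critmx mulmxBr mulmxBl -!scalemxAr -!scalemxAl Mdadj DM mul_scalar_mx.
have -> : n%:R = n.-1%:R + 1 :> {poly F} by rewrite natr1 prednK //; lia.
set c := n.-1%:R; set D' := D^`(); move: D D' c (dermx M) => a a' c dM.
by apply/matrixP => i j; rewrite !mxE; ring.
Qed.

Let adj_evalP t : mxeval t M *m mxeval t adjM = (D.[t])%:M.
Proof. by rewrite /mxeval -map_mxM DM map_scalar_mx. Qed.

Let eval_det t : \det (mxeval t M) = D.[t].
Proof. by rewrite /mxeval det_map_mx. Qed.

Let sep_root t : D.[t] = 0 -> D^`().[t] != 0.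
Proof.
move=> Dt; move: D_separable; rewrite separable_poly.unlock => /coprimep_root; apply.
exact/rootP.
Qed.

Let dDM_eval t : mxeval t (dermx M) *m mxeval t adjM +
   mxeval t M *m mxeval t (dermx adjM) = (D^`().[t])%:M.
Proof.
by have := congr1 (mxeval t) dDM; rewrite /mxeval map_mxD !map_mxM map_scalar_mx.
Qed.

(** Where the adjugate vanishes so does D, and differentiating [M *m adjM = D%:M] leaves
    [M *m dermx adjM = D'] at that point. Taking determinants gives D' = 0 there, so D would have a
    double root. *)
Lemma adj_eval_neq0 t : mxeval t adjM != 0.
Proof.
apply/eqP => a0; have Dt : D.[t] = 0.
  have := adj_evalP t; rewrite a0 mulmx0 => /matrixP.
  have i : 'I_n by exists 0%N; lia.
  by move=> /(_ i i); rewrite !mxE eqxx.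
have := dDM_eval t; rewrite a0 mulmx0 add0r => /(congr1 determinant).
rewrite det_mulmx eval_det Dt mul0r det_scalar => /esym/eqP.
by rewrite expf_eq0 (negPf (sep_root Dt)) andbF.
Qed.

(** At a root of D only the multiple [(n - 1) D'] of the adjugate survives, and neither factor
    vanishes. Elsewhere [MWM] would make M' proportional to M, which [Mder_neq] excludes. *)
Lemma critmx_eval_neq0 t : mxeval t W != 0.
Proof.
have WtE : mxeval t W = n%:R *: (D.[t] *: mxeval t (dermx adjM))
    - n.-1%:R *: (D^`().[t] *: mxeval t adjM).
  apply/matrixP => i j; rewrite !mxE /horner_eval !hornerE.
  by rewrite -!polyC_natr !hornerC.
apply/eqP => W0; have [Dt|Dt] := eqVneq D.[t] 0.
  move/eqP: W0; rewrite WtE Dt scale0r scaler0 sub0r oppr_eq0 !scalemx_eq0.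
  rewrite (negPf (sep_root Dt)) (negPf (adj_eval_neq0 t)) !orbF pnatr_eq0.
  by move: n_ge3; case: n => [|[]].
have := congr1 (mxeval t) MWM; rewrite /mxeval !map_mxM /= -!/(mxeval t _) W0.
rewrite mulmx0 mul0mx => /esym e1.
have {e1}: D.[t] *: (D^`().[t] *: mxeval t M - n%:R *: (D.[t] *: mxeval t (dermx M))) = 0.
  rewrite -[RHS]e1; apply/matrixP => i j; rewrite !mxE /horner_eval !hornerE.
  by rewrite -!polyC_natr !hornerC.
move/eqP; rewrite scalemx_eq0 (negPf Dt) subr_eq0 scalerA => /eqP e2.
have nD : n%:R * D.[t] != 0 by rewrite mulf_neq0 // pnatr_eq0; lia.
have := Mder_neq t ((n%:R * D.[t])^-1 * D^`().[t]).
by rewrite -scalerA e2 scalerA mulVf // scale1r eqxx.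
Qed.

Let adj_top : mxcoef delta M *m mxcoef e adjM = (D`_m)%:M.
Proof. by rewrite -mxcoef_mul_top // DM mxcoef_scalar m_eq. Qed.

Let adj_next :
  mxcoef delta M *m mxcoef e.-1 adjM + mxcoef delta.-1 M *m mxcoef e adjM = (D`_m.-1)%:M.
Proof.
have eE : e.-1.+1 = e by rewrite prednK // ltnW.
have := @mxcoef_mul_next _ _ _ _ M adjM delta.-1 e.-1.
rewrite eE prednK // => <- //; rewrite DM mxcoef_scalar m_eq.
by congr (_`__)%:M; lia.
Qed.

Let d := (delta * (2 * n - 1) - 2)%N.

Let m2 : m.-2.+2 = m. Proof. by move: e_ge2; rewrite m_eq; lia. Qed.
Let e2 : e.-2.+2 = e. Proof. by move: e_ge2; lia. Qed.
Let me : (n * e.-2.+2 = n.-1 * m.-2.+2)%N. Proof. by rewrite m2 e2 /m /e; lia. Qed.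
Let d_eq : d = (m.-2 + e.-2).+2.
Proof.
have me_eq : (m + e = delta * (2 * n - 1))%N.
  by rewrite /m /e -mulnDr; congr (_ * _)%N; lia.
by rewrite /d -me_eq; move: m2 e2; lia.
Qed.

Let critmxE i j : W i j =
  n%:R * (D * (adjM i j)^`()) - n.-1%:R * (D^`() * adjM i j).
Proof. by rewrite /critmx; move: adjM => A; rewrite !mxE. Qed.

Let size_critmx i j : (size (W i j) <= d.+1)%N.
Proof. by rewrite critmxE d_eq size_critical // ?m2 ?e2. Qed.

Let critmx_top : mxcoef d W =
  (n.-1%:R * D`_m.-1) *: mxcoef e adjM - (n%:R * D`_m) *: mxcoef e.-1 adjM.
Proof.
apply/matrixP => i j; move: (critmxE i j) (sadj i j); move: adjM => A WE sA.
rewrite [LHS]mxE WE d_eq !mxE (coef_critical _ _ me) ?m2 ?e2 // !mulrA.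
by congr (_ * _`__ * _`__ - _ * _ * _`__); lia.
Qed.

(** The analogue at t = infinity, with the two top coefficients of M in place of M(t) and M'(t). *)
Lemma critmx_top_neq0 : mxcoef d W != 0.
Proof.
have Dm0 : D`_m != 0 by rewrite Dm.
have nE : n%:R = n.-1%:R + 1 :> F by rewrite natr1 prednK //; lia.
have n0 : n%:R != 0 :> F by rewrite pnatr_eq0; lia.
apply/eqP => W0; have [c cE] := proportional_of_crit nE Dm0 adj_top adj_next
  (etrans (esym critmx_top) W0) n0.
by have := Mnext_neq c; rewrite cE eqxx.
Qed.

Let adj_top_neq0 : mxcoef e adjM != 0.
Proof.
apply: contraNneq Mtop_unit => a0; move: adj_top; rewrite a0 mulmx0 -Dm => /matrixP.
have i : 'I_n by exists 0%N; lia.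
by move=> /(_ i i); rewrite !mxE eqxx mulr1n => <-.
Qed.

Section Projection.
Variable E : 'M[F]_n.
Hypothesis EM : map_mx polyC E *m M = M *m map_mx polyC E.
Hypothesis Mtop_E : exists u, qform (mxcoef delta M) (E *m u) != 0.

Let evE t (u : 'cV[F]_n) : E *m (mxeval t M *m u) = mxeval t M *m (E *m u).
Proof.
rewrite !mulmxA; congr (_ *m _); have := congr1 (mxeval t) EM.
by rewrite /mxeval !map_mxM /= -!/(mxeval t _) !mxeval_const.
Qed.

Let mu_neq0 u : qform (mxcoef delta M) (E *m u) != 0 -> pform M (E *m u) != 0.
Proof. by apply: contraNneq => mu0; rewrite -coef_pform mu0 coef0. Qed.

(** On data [M(k) E u] the sandwich [M adj(M) M = D M] reduces the value at [k] to D times the form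
    of M itself, which is known to be nonzero through its top coefficient. *)
Lemma adj_proj_neq0 : exists u, pform adjM (E *m u) != 0.
Proof.
have [u qu] := Mtop_E; have := mulf_neq0 D_neq0 (mu_neq0 qu).
case/poly_nat_nonroot => k; rewrite hornerM horner_pform => qk.
exists (mxeval k%:R M *m u); apply: contraNneq qk => p0.
have := horner_pform adjM (E *m (mxeval k%:R M *m u)) k%:R.
rewrite p0 horner0 evE qform_conj => ->; rewrite -qformZ; apply/eqP; congr (qform _ _).
have -> : (mxeval k%:R M)^T = mxeval k%:R M by rewrite /mxeval map_trmx MT.
by rewrite adj_evalP mul_scalar_mx.
Qed.

(** With the same data the value is [D (D' mu - n D mu')], where [mu] is the form of M on [E u].
    Were it zero for every [k], D would divide [D' mu], hence [mu]; but [mu] has degree at most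
    [delta], less than deg D = [delta * n]. *)
Lemma critmx_proj_neq0 : exists u, pform W (E *m u) != 0.
Proof.
have [u qu] := Mtop_E; set mu := pform M (E *m u).
have mu0 : mu != 0 := mu_neq0 qu.
suff: D * (D^`() * mu - n%:R * (D * mu^`())) != 0.
  case/poly_nat_nonroot => k qk.
  exists (mxeval k%:R M *m u); apply: contraNneq qk => p0.
  have := horner_pform W (E *m (mxeval k%:R M *m u)) k%:R.
  rewrite p0 horner0 evE qform_conj => ->.
  have -> : (mxeval k%:R M)^T = mxeval k%:R M by rewrite /mxeval map_trmx MT.
  have -> : mxeval k%:R M *m mxeval k%:R W *m mxeval k%:R M =
    D.[k%:R] *: (D^`().[k%:R] *: mxeval k%:R M -
       n%:R *: (D.[k%:R] *: mxeval k%:R (dermx M))).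
    rewrite /mxeval -!map_mxM MWM; move: D D^`() (dermx M) => a a' dM.
    apply/matrixP => i j; rewrite !mxE /= /horner_eval !hornerE.
    by rewrite -polyC_natr hornerC.
  apply/eqP; rewrite qformZ qformD qformN !qformZ -!horner_pform -/mu -deriv_pform.
  by rewrite !hornerE -polyC_natr hornerC.
apply: contraTneq isT => /eqP; rewrite mulf_eq0 (negPf D_neq0) /= subr_eq0 => /eqP e1.
have: D %| D^`() * mu by rewrite e1 mulrCA dvdp_mulr.
have cD : coprimep D D^`() by move: D_separable; rewrite separable_poly.unlock.
rewrite Gauss_dvdpr // => /(dvdp_leq mu0); rewrite leqNgt => /negP[].
have /(leq_ltn_trans) -> // : (size mu <= delta.+1)%N by apply: size_pform.
have Dm1 : D`_m != 0 by rewrite Dm.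
rewrite (size_coef_eq sD Dm1) /m ltnS; move: n_ge3 delta_gt0; clear; nia.
Qed.

End Projection.

Let plusJM : map_mx polyC (1%:M + J) *m M = M *m map_mx polyC (1%:M + J).
Proof. by rewrite map_mxD map_mx1 mulmxDl mulmxDr mul1mx mulmx1 MJ. Qed.

Let minusJM : map_mx polyC (1%:M - J) *m M = M *m map_mx polyC (1%:M - J).
Proof. by rewrite map_mxB map_mx1 mulmxBl mulmxBr mul1mx mulmx1 MJ. Qed.

Lemma adj_generic :
  zgeneric (fun y => size (pform adjM y) = e.+1 /\ separable_poly (pform adjM y)).
Proof.
apply: (reversal_bertini JT JJ) => //; first by rewrite ltnW.
- exact: adj_eval_neq0.
- exact: adj_proj_neq0.
- exact: adj_proj_neq0.
Qed.

Lemma critmx_generic :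
  zgeneric (fun y => size (pform W y) = d.+1 /\ separable_poly (pform W y)).
Proof.
apply: (reversal_bertini JT JJ) => //; first by rewrite d_eq.
- exact: critmx_eval_neq0.
- exact: critmx_top_neq0.
- exact: critmx_proj_neq0.
- exact: critmx_proj_neq0.
Qed.

Let eval_sym t (V : 'M[{poly F}]_n) : V^T = V -> (mxeval t V)^T = mxeval t V.
Proof. by move=> VT; rewrite /mxeval map_trmx VT. Qed.

Lemma critmx_horner_generic t : zgeneric (fun y => (pform W y).[t] != 0).
Proof.
apply: zgenericW (zgeneric_qform (qform_neq0 (eval_sym t WT) (critmx_eval_neq0 t))).
by move=> y; rewrite -horner_pform.
Qed.

Lemma pform_critmx y : pform W y =
  n%:R * (D * (pform adjM y)^`()) - n.-1%:R * (D^`() * pform adjM y).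
Proof. by rewrite deriv_pform /pform /critmx qformD qformN !qformZ. Qed.

(* P = 0 = D forces N = 0 since D is separable; P = 0 = N <> D forces N' = 0. *)
Lemma critical_points_generic :
  zgeneric (fun y => [/\ size (pform W y) = d.+1, separable_poly (pform W y) &
    forall t, root (pform W y) t -> D.[t] != 0 /\ (pform adjM y).[t] != 0]).
Proof.
have [rs rsE] := closed_roots D_neq0.
have gD : zgeneric (fun y => forall t, t \in rs -> (pform adjM y).[t] != 0).
  apply: zgeneric_all => t _.
  apply: zgenericW (zgeneric_qform (qform_neq0 (eval_sym t adjT) (adj_eval_neq0 t))).
  by move=> y; rewrite -horner_pform.
apply: zgenericW (zgeneric_and (zgeneric_and gD adj_generic) critmx_generic).
move=> y [[yD [_ sepN]] [sP sepP]]; split=> // t /rootP; rewrite pform_critmx.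
rewrite hornerD hornerN !hornerM -!polyC_natr !hornerC => Pt.
have n1 : n.-1%:R != 0 :> F by rewrite pnatr_eq0; lia.
have n0 : n%:R != 0 :> F by rewrite pnatr_eq0; lia.
have Dt : D.[t] != 0.
  apply/eqP => Dt; have := yD t; rewrite -rsE => /(_ (introT rootP Dt)).
  move: Pt; rewrite Dt mul0r mulr0 sub0r => /eqP; rewrite oppr_eq0 !mulf_eq0.
  by rewrite (negPf n1) (negPf (sep_root Dt)) /= => ->.
split=> //; apply/eqP => Nt; move: Pt; rewrite Nt !mulr0 subr0 => /eqP.
rewrite !mulf_eq0 (negPf n0) (negPf Dt) /= => /eqP N't.
move: sepN; rewrite separable_poly.unlock => /coprimep_root/(_ (introT rootP Nt)).
by rewrite N't eqxx.
Qed.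

End Family.

(** * Banded Toeplitz matrices *)

(** With truncated subtraction the index is the distance of [i] and [j], and the default value 0 of
    the list lookup fills everything outside the band. *)
Definition toep (R : nmodType) (n : nat) (c0 c1 c2 : R) : 'M[R]_n :=
  \matrix_(i, j) [:: c0; c1; c2]`_(i - j + (j - i)).

Lemma map_toep (R S : nmodType) (f : {additive R -> S}) n (c0 c1 c2 : R) :
  map_mx f (toep n c0 c1 c2) = toep n (f c0) (f c1) (f c2).
Proof.
by apply/matrixP => i j; rewrite !mxE; case: (_ + _)%N => [|[|[|k]]] //=;
  rewrite !nth_nil raddf0.
Qed.

Section Toep.
Variables (R : comNzRingType) (n : nat).
Implicit Types c : R.

Lemma trmx_toep c0 c1 c2 : (toep n c0 c1 c2)^T = toep n c0 c1 c2.
Proof. by apply/matrixP => i j; rewrite !mxE addnC. Qed.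

Lemma toepD c0 c1 c2 d0 d1 d2 :
  toep n c0 c1 c2 + toep n d0 d1 d2 = toep n (c0 + d0) (c1 + d1) (c2 + d2).
Proof.
by apply/matrixP => i j; rewrite !mxE; case: (_ + _)%N => [|[|[|k]]] //=;
  rewrite !nth_nil addr0.
Qed.

Lemma toepZ a c0 c1 c2 : a *: toep n c0 c1 c2 = toep n (a * c0) (a * c1) (a * c2).
Proof.
by apply/matrixP => i j; rewrite !mxE; case: (_ + _)%N => [|[|[|k]]] //=;
  rewrite !nth_nil mulr0.
Qed.

Lemma toepN c0 c1 c2 : - toep n c0 c1 c2 = toep n (- c0) (- c1) (- c2).
Proof. by rewrite -scaleN1r toepZ !mulN1r. Qed.

Lemma toep100 : toep n 1 0 0 = 1%:M :> 'M[R]_n.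
Proof.
apply/matrixP => i j; rewrite !mxE -val_eqE /=; have [ij|ij] := eqVneq (i : nat) j.
  by rewrite ij subnn.
case E: (i - j + (j - i))%N => [|[|[|k]]] //=; last by rewrite nth_nil.
by move: ij E => /eqP; lia.
Qed.

(* [w] is [v] shifted by 2 and padded with zeros, so that the band never leaves its domain. *)
Lemma toep_mul c0 c1 c2 (w : nat -> R) (i : 'I_n) :
  w 0%N = 0 -> w 1%N = 0 -> w n.+2 = 0 -> w n.+3 = 0 ->
  (toep n c0 c1 c2 *m \col_j w j.+2) i 0 =
  c2 * w i + c1 * w i.+1 + c0 * w i.+2 + c1 * w i.+3 + c2 * w i.+4.
Proof.
move=> w0 w1 w2 w3; pose f k := [:: c0; c1; c2]`_(i.+2 - k + (k - i.+2)) * w k.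
transitivity (\sum_(0 <= k < n.+4) f k).
  rewrite big_nat_recl // big_nat_recl // {1 2}/f w0 w1 !mulr0 !add0r.
  rewrite big_nat_recr // big_nat_recr //= {2 3}/f w2 w3 !mulr0 !addr0.
  by rewrite mxE big_mkord; apply: eq_bigr => j _; rewrite !mxE.
have lt_in := ltn_ord i.
rewrite (big_cat_nat (n := i)) //=; last by lia.
rewrite (big_cat_nat (m := i) (n := i.+4.+1)) //=; last by lia.
rewrite big_nat big1 ?add0r; last first.
  move=> k /andP[_ ki]; rewrite /f nth_default ?mul0r //=; lia.
rewrite [X in _ + X]big_nat [X in _ + X]big1 ?addr0; last first.
  move=> k /andP[ki _]; rewrite /f nth_default ?mul0r //=; lia.
do 5! (rewrite big_ltn; last by lia); rewrite big_geq // addr0 /f.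
have -> : (i.+2 - i + (i - i.+2) = 2)%N by lia.
have -> : (i.+2 - i.+1 + (i.+1 - i.+2) = 1)%N by lia.
have -> : (i.+2 - i.+2 + (i.+2 - i.+2) = 0)%N by lia.
have -> : (i.+2 - i.+3 + (i.+3 - i.+2) = 1)%N by lia.
have -> : (i.+2 - i.+4 + (i.+4 - i.+2) = 2)%N by lia.
by rewrite /= !addrA.
Qed.

(** The test [1 < k] is needed because truncated subtraction sends [k = 0] and [k = 1] to the valid
    index 0. *)
Definition padded (v : 'cV[R]_n) (k : nat) : R :=
  if insub (k - 2)%N is Some j then if (1 < k)%N then v j 0 else 0 else 0.

Lemma padded0 v : padded v 0%N = 0.
Proof. by rewrite /padded; case: insub. Qed.
Lemma padded1 v : padded v 1%N = 0.
Proof. by rewrite /padded; case: insub. Qed.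
Lemma padded_out v k : padded v (n.+2 + k) = 0.
Proof. by rewrite /padded; case: insubP => // j; rewrite !addSn subSS subSS subn0; lia. Qed.
Lemma padded_in v (j : 'I_n) : padded v j.+2 = v j 0.
Proof. by rewrite /padded !subSS subn0 valK. Qed.

Lemma toep_mul_padded c0 c1 c2 v (i : 'I_n) : let w := padded v in
  (toep n c0 c1 c2 *m v) i 0 =
  c2 * w i + c1 * w i.+1 + c0 * w i.+2 + c1 * w i.+3 + c2 * w i.+4.
Proof.
move=> w; rewrite -toep_mul ?/w ?padded0 ?padded1 //; last 2 first.
- by have := padded_out v 0; rewrite addn0.
- by have := padded_out v 1; rewrite addn1.
by congr ((_ *m _) _ _); apply/colP => j; rewrite mxE padded_in.
Qed.

End Toep.

Lemma singular_ker (F : fieldType) n (A : 'M[F]_n) (v : 'cV[F]_n) :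
  A *m v = 0 -> v != 0 -> \det A = 0.
Proof.
move=> Av v0; apply/eqP; apply: contraNT v0; rewrite -unitfE -unitmxE => Au.
by rewrite -(mulKmx Au v) Av mulmx0.
Qed.

Lemma ker_singular (F : fieldType) n (A : 'M[F]_n) :
  \det A = 0 -> exists2 v : 'cV[F]_n, v != 0 & A *m v = 0.
Proof.
move=> /eqP; rewrite -det_tr => /det0P[v v0 vA]; exists v^T.
  by apply: contra v0 => /eqP e; rewrite -[v]trmxK e trmx0.
by rewrite -[A]trmxK -trmx_mul vA trmx0.
Qed.

(** * Chebyshev polynomials *)

Section Cheb.
Variable R : comNzRingType.

(* S_k(t) = sin (k x) / sin x with t = - 2 cos x. *)
Fixpoint cheb (k : nat) : {poly R} :=
  match k with
  | 0 => 0
  | k1.+1 => match k1 with 0 => 1 | k2.+1 => - ('X * cheb k1) - cheb k2 end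
  end.

Lemma chebSS k : cheb k.+2 = - ('X * cheb k.+1) - cheb k. Proof. by []. Qed.

Lemma horner_chebSS k t : (cheb k.+2).[t] = - (t * (cheb k.+1).[t]) - (cheb k).[t].
Proof. by rewrite chebSS hornerD !hornerN mulrC hornerMX mulrC. Qed.

(** The form [a^2 + t a b + b^2] is invariant under a step of the recurrence. *)
Lemma cheb_conserved k t : (cheb k.+1).[t] ^+ 2 +
  t * (cheb k.+1).[t] * (cheb k).[t] + (cheb k).[t] ^+ 2 = 1.
Proof.
elim: k => [|k <-]; first by rewrite /= hornerC horner0; ring.
by rewrite horner_chebSS; ring.
Qed.

(** The derivative of sin (m x) / sin x in t = - 2 cos x. The factors of [k.+1%:R] and [k%:R] are
    both - 2 cos (m x), for m = k + 1 and m = k, written with the neighbour below and above; the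
    recurrence of order 2 needs the two together. *)
Lemma cheb_derivE k t :
  ((t ^+ 2 - 4) * (cheb k.+1)^`().[t] =
     k.+1%:R * (t * (cheb k.+1).[t] + 2 * (cheb k).[t]) - t * (cheb k.+1).[t]) /\
  ((t ^+ 2 - 4) * (cheb k)^`().[t] =
     k%:R * (- (t * (cheb k).[t]) - 2 * (cheb k.+1).[t]) - t * (cheb k).[t]).
Proof.
elim: k => [|k [IH1 IH2]].
  by rewrite /= !derivE !hornerE; split; ring.
split; last first.
  rewrite IH1 horner_chebSS; move: (cheb k.+1).[t] (cheb k).[t] k.+1%:R => a b c; ring.
rewrite chebSS !derivE !hornerE -/(cheb k.+1).
transitivity (- ((t ^+ 2 - 4) * (cheb k.+1).[t]) - t * ((t ^+ 2 - 4) * (cheb k.+1)^`().[t])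
  - (t ^+ 2 - 4) * (cheb k)^`().[t]); first by ring.
rewrite IH1 IH2 -[k.+2%:R]natr1 -[k.+1%:R]natr1.
move: (cheb k.+1).[t] (cheb k).[t] k%:R => a b c; ring.
Qed.

Lemma size_cheb k : (size (cheb k) <= k)%N /\ (size (cheb k.+1) <= k.+1)%N.
Proof.
elim: k => [|k [IH1 IH2]]; first by rewrite size_poly0 size_poly1.
split=> //; rewrite chebSS (leq_trans (size_polyD _ _)) // !size_polyN geq_max.
rewrite (leq_trans (size_polyMleq _ _)) ?size_polyX //= ?(leq_trans IH1) //; lia.
Qed.

Lemma cheb_lead k : (cheb k.+1)`_k = (-1) ^+ k.
Proof.
elim: k => [|k IH]; first by rewrite coef1.
rewrite chebSS coefB coefN coefXM /= IH exprS mulN1r.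
by rewrite (nth_default _ (leq_trans (proj1 (size_cheb _)) _)) ?subr0.
Qed.

End Cheb.

(** * The pencil of the component a_0 = a_2 *)

Section ToepPoly.
Variables (R : comNzRingType) (n : nat).
Implicit Types c : {poly R}.

Lemma mxeval_toep t c0 c1 c2 :
  mxeval t (toep n c0 c1 c2) = toep n c0.[t] c1.[t] c2.[t].
Proof. by rewrite /mxeval map_toep. Qed.

Lemma dermx_toep c0 c1 c2 :
  dermx (toep n c0 c1 c2) = toep n c0^`() c1^`() c2^`().
Proof. by rewrite /dermx map_toep. Qed.

Lemma mxcoef_toep k c0 c1 c2 :
  mxcoef k (toep n c0 c1 c2) = toep n c0`_k c1`_k c2`_k.
Proof. exact: (map_toep (coefp k)). Qed.

Lemma size_toep d c0 c1 c2 :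
  (size c0 <= d)%N -> (size c1 <= d)%N -> (size c2 <= d)%N ->
  forall i j, (size (toep n c0 c1 c2 i j) <= d)%N.
Proof.
move=> s0 s1 s2 i j; rewrite mxE; case: (_ + _)%N => [|[|[|k]]] //=.
by rewrite nth_nil size_poly0.
Qed.

Definition revmx : 'M[R]_n := \matrix_(i, j) (i == rev_ord j)%:R.

Lemma trmx_revmx : revmx^T = revmx.
Proof.
by apply/matrixP => i j; rewrite !mxE [in LHS]eq_sym (can2_eq (@rev_ordK n) (@rev_ordK n)).
Qed.

Lemma mul_revmx p (A : 'M[R]_(n, p)) : revmx *m A = \matrix_(i, j) A (rev_ord i) j.
Proof.
apply/matrixP => i j; rewrite !mxE (bigD1 (rev_ord i)) //= mxE rev_ordK eqxx mul1r.
rewrite big1 ?addr0 // => k; rewrite mxE -[i == _](inj_eq (@rev_ord_inj n)) rev_ordK.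
by rewrite eq_sym => /negPf ->; rewrite mul0r.
Qed.

Lemma revmx_invol : revmx *m revmx = 1%:M.
Proof.
by apply/matrixP => i j; rewrite mul_revmx !mxE (inj_eq (@rev_ord_inj n)).
Qed.

End ToepPoly.

Lemma map_revmx (R S : comNzRingType) (f : {rmorphism R -> S}) n :
  map_mx f (revmx R n) = revmx S n.
Proof. by apply/matrixP => i j; rewrite !mxE rmorph_nat. Qed.

Lemma revmx_toep (R : comNzRingType) n (c0 c1 c2 : R) :
  revmx R n *m toep n c0 c1 c2 = toep n c0 c1 c2 *m revmx R n.
Proof.
have tr (A : 'M[R]_n) : A *m revmx R n = \matrix_(i, j) A i (rev_ord j).
  rewrite -[LHS]trmxK trmx_mul trmx_revmx mul_revmx.
  by apply/matrixP => i j; rewrite !mxE.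
rewrite tr mul_revmx; apply/matrixP => i j; rewrite !mxE /=.
by congr _`__; have := ltn_ord i; have := ltn_ord j; lia.
Qed.

Section QuadPencil.
Variables (F : numClosedFieldType) (n : nat).
Hypothesis n_ge3 : (2 < n)%N.

Definition quadmx : 'M[{poly F}]_n := toep n (2%:P + 'X ^+ 2) (2 *: 'X) 1.

Lemma quadmx_eval t : mxeval t quadmx = toep n (2 + t ^+ 2) (2 * t) 1.
Proof. by rewrite mxeval_toep !hornerE. Qed.

Lemma quadmx_der : dermx quadmx = toep n (2 *: 'X) 2%:P 0.
Proof. by rewrite dermx_toep !derivE alg_polyC mul1r mulr1 add0r scaler_nat mulr2n. Qed.

Lemma quadmx_top : mxcoef 2 quadmx = 1%:M.
Proof. by rewrite mxcoef_toep !coefE /= mulr0 add0r toep100. Qed.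

Let s k t := (cheb F k).[t].
Let sSS k t : s k.+2 t = - (t * s k.+1 t) - s k t. Proof. exact: horner_chebSS. Qed.

(* The kernel vector is v_k = (n + 1 - k) s_k - sigma k s_(n+1-k); it satisfies the
   recurrence with characteristic polynomial (q^2 + t q + 1)^2 and vanishes at
   k = -1, 0, n + 1, n + 2. Below, [w] and [p] are v and s with indices shifted by 1. *)
Lemma quadmx_singular t sigma : t ^+ 2 != 4 -> sigma ^+ 2 = 1 ->
  s n.+2 t = sigma * n.+2%:R -> \det (mxeval t quadmx) = 0.
Proof.
move=> t4 sg sn.
pose p k := if k is k1.+1 then s k1 t else -1.
have pSS k : p k.+2 = - (t * p k.+1) - p k.
  by case: k => [|k]; rewrite /p ?sSS // /s /= hornerC horner0; ring.
pose w k := (n.+2%:R - k%:R) * p k - sigma * (k%:R - 1) * p (n.+3 - k)%N.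
have w0 : w 0%N = 0.
  by rewrite /w [p 0%N]/= [p (_ - _)%N]/= sn; move: n.+2%:R => a; ring: sg.
have w1 : w 1%N = 0 by rewrite /w /= /s /= horner0; ring.
have w2 : w n.+2 = 0.
  by rewrite /w subSnn /= /s /= horner0; ring.
have w3 : w n.+3 = 0.
  rewrite /w subnn /= -/(s n.+2 t) sn -[n.+3%:R]natr1; move: n.+2%:R => a; ring.
apply: (@singular_ker _ _ _ (\col_(j < n) w j.+2)).
  apply/colP => i; rewrite quadmx_eval (toep_mul _ _ _ _ w0 w1 w2 w3) mxE /w.
  have lt_in := ltn_ord i.
  have e (k : nat) : (k < 5)%N -> (n.+3 - (i + k) = (n.+3 - (i + 4)) + (4 - k))%N by lia.
  move: (e 0%N isT) (e 1%N isT) (e 2%N isT) (e 3%N isT).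
  rewrite addn0 addn1 addn2 addn3 addn4 => -> -> -> ->.
  rewrite !pSS -[i.+4%:R]natr1 -[i.+3%:R]natr1 -[i.+2%:R]natr1 -[i.+1%:R]natr1.
  set N := (n.+3 - i.+4)%N.
  have -> : (N + (4 - 0) = N.+4)%N by lia.
  have -> : (N + (4 - 1) = N.+3)%N by lia.
  have -> : (N + (4 - 2) = N.+2)%N by lia.
  have -> : (N + (4 - 3) = N.+1)%N by lia.
  rewrite !pSS; move: (p i) (p i.+1) (p N) (p N.+1) n.+2%:R i%:R => *; ring.
(* If the first two entries of the kernel vector vanished, then s_n = sigma n and (n + 1) t = - 2
   sigma s_(n+1); inserted in s_(n+2) = sigma (n + 2) this gives (n + 1) (t^2 - 4) = 0. *)
apply: contra t4 => /eqP/colP v0.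
have i0 : (0 < n)%N by lia.
have i1 : (1 < n)%N by lia.
have := v0 (Ordinal i0); have := v0 (Ordinal i1); rewrite !mxE /= /w => w3' w2'.
have p1 : p 2%N = 1 by rewrite /p /s /= hornerC.
have p2 : p 3%N = - t by rewrite pSS p1 /p /s /= horner0; ring.
have e2 : (n.+3 - 2 = n.+1)%N by lia.
have e3 : (n.+3 - 3 = n)%N by lia.
have nE : n.+2%:R = n%:R + 2 :> F by rewrite -addn2 natrD.
have pn3 : p n.+3 = sigma * n.+2%:R := sn.
rewrite e2 p1 nE in w2'; rewrite e3 p2 nE in w3'; rewrite pSS nE in pn3.
have pnE : p n = - (t * p n.+1) - p n.+2 by rewrite pSS; ring.
move: w2' w3' pn3; rewrite pnE.
move: (p n.+1) (p n.+2) => x r w2' w3' pn3.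
have xE : x = sigma * n%:R.
  transitivity (sigma ^+ 2 * x); first by rewrite sg mul1r.
  apply/eqP; rewrite -subr_eq0 -[_ == _]orFb; apply/eqP.
  transitivity (- sigma * ((n%:R + 2 - 2) * 1 - sigma * (2 - 1) * x)); first by ring.
  by rewrite w2' mulr0.
have tr : (n%:R + 1) * t = - (2 * sigma * r).
  apply/eqP; rewrite -subr_eq0; apply/eqP; rewrite -[RHS]w3' xE.
  transitivity ((n%:R + 1) * t + 2 * sigma * r - (1 - sigma ^+ 2) * (2 * n%:R * t)).
    by rewrite sg; ring.
  by ring.
have : (n%:R + 1) * (t ^+ 2 - 4) = 0.
  transitivity (t * ((n%:R + 1) * t) - 4 * (n%:R + 1)); first by ring.
  rewrite tr; transitivity (2 * sigma * (- (t * r) - x) + 2 * sigma * x - 4 * (n%:R + 1)).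
    by ring.
  rewrite pn3 xE; transitivity (sigma ^+ 2 * (4 * n%:R + 4) - 4 * (n%:R + 1)).
    by ring.
  by rewrite sg; ring.
move/eqP; rewrite mulf_eq0 natr1 pnatr_eq0 subr_eq0 //.
Qed.


(** Covers t = 2 and t = -2, where the relation of [cheb_derivE] carries a zero factor and says
    nothing about the derivative. *)
Let cheb_at2 (a : F) k : a ^+ 2 = 1 ->
  s k.+1 (- (2 * a)) = a ^+ k * k.+1%:R /\
  6 * (cheb F k.+1)^`().[- (2 * a)] = - (a ^+ k.+1 * (k.+1%:R ^+ 3 - k.+1%:R)).
Proof.
move=> a2; have: (s k (- (2 * a)) = a * a ^+ k * k%:R /\
    6 * (cheb F k)^`().[- (2 * a)] = - (a ^+ k * (k%:R ^+ 3 - k%:R))) /\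
   (s k.+1 (- (2 * a)) = a ^+ k * k.+1%:R /\
    6 * (cheb F k.+1)^`().[- (2 * a)] = - (a ^+ k.+1 * (k.+1%:R ^+ 3 - k.+1%:R))).
  elim: k => [|k [[IH1 IH2] [IH3 IH4]]].
    by rewrite /s /= !derivE !hornerE; split; split; ring.
  split; first by split=> //; rewrite exprS mulrA -expr2 a2 mul1r.
  split; first by rewrite sSS IH3 IH1 -[k.+2%:R]natr1 -[k.+1%:R]natr1 exprS; ring.
  rewrite chebSS !derivE -/(cheb F k.+1) !hornerE -/(s k.+1 _).
  transitivity (- (6 * s k.+1 (- (2 * a))) + 2 * a * (6 * (cheb F k.+1)^`().[- (2 * a)])
     - 6 * (cheb F k)^`().[- (2 * a)]); first by rewrite /s; ring.
  rewrite IH2 IH3 IH4 -[k.+2%:R]natr1 -[k.+1%:R]natr1 !exprS.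
  move: (a ^+ k) k%:R => x y; ring: a2.
by case.
Qed.

(* A constant multiple of (4 - t^2) det (quadmx n). *)
Definition cheb_level : {poly F} := (n.+2%:R ^+ 2)%:P - cheb F n.+2 ^+ 2.

Lemma size_cheb_level : size cheb_level = (2 * n).+3.
Proof.
have c0 : (cheb F n.+2)`_n.+1 != 0 by rewrite cheb_lead signr_eq0.
have sc : size (cheb F n.+2) = n.+2 by apply: size_coef_eq (size_cheb F n.+1).2 c0.
have sc2 : size (cheb F n.+2 ^+ 2) = (2 * n).+3.
  by rewrite expr2 size_mul -?size_poly_eq0 sc //; lia.
rewrite /cheb_level addrC size_polyDl size_polyN sc2 //.
by rewrite (leq_ltn_trans (size_polyC_leq1 _)).
Qed.

(** With m = n + 2, a double root has s_m^2 = m^2 and s_m' = 0. The derivative formula and the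
    conserved form then give (t^2 - 4) (m^2 - 1) = 0, while at t = 2 and t = -2 the derivative is
    (m^3 - m) / 6 up to sign, not zero. *)
Lemma cheb_level_separable : separable_poly cheb_level.
Proof.
rewrite separable_poly.unlock; apply: closed_coprimepP => t.
apply/negP => /andP[/rootP Ht /rootP H't].
have m0 : n.+2%:R != 0 :> F by rewrite pnatr_eq0.
have m1 : n.+2%:R ^+ 2 - 1 != 0 :> F.
  rewrite subr_eq0 sqrf_eq1 negb_or -[1]/(1%:R) eqr_nat /=.
  by rewrite -subr_eq0 opprK natr1 pnatr_eq0.
have s2 : s n.+2 t ^+ 2 = n.+2%:R ^+ 2.
  move: Ht; rewrite /cheb_level hornerD hornerN hornerC horner_exp => /eqP.
  by rewrite subr_eq0 => /eqP.
have s0 : s n.+2 t != 0 by rewrite -sqrf_eq0 s2 sqrf_eq0.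
have s'0 : (cheb F n.+2)^`().[t] = 0.
  move: H't; rewrite /cheb_level derivB derivC sub0r expr2 derivM hornerN hornerD !hornerM.
  rewrite -/(s n.+2 t) mulrC -mulr2n => /eqP.
  by rewrite oppr_eq0 mulrn_eq0 mulf_eq0 (negPf s0) => /eqP.
have [e _] := cheb_derivE (n.+1) t; rewrite s'0 mulr0 -!/(s _ _) in e.
have c := cheb_conserved (R := F) n.+1 t; rewrite -!/(s _ _) in c.
have t4 : (t ^+ 2 - 4) * (n.+2%:R ^+ 2 - 1) = 0.
  move: e c s2; move: (s n.+2 t) (s n.+1 t) s0 n.+2%:R m0 m1 => x r x0 m m0 m1 e c s2.
  have tx : (t * x) ^+ 2 = m ^+ 2 * (t * x + 2 * r) ^+ 2.
    have tx0 : t * x = m * (t * x + 2 * r).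
      by apply/eqP; rewrite -subr_eq0 -oppr_eq0 opprB -e.
    by rewrite {1}tx0 exprMn.
  have y : (t * x + 2 * r) ^+ 2 = 4 + (t ^+ 2 - 4) * x ^+ 2.
    transitivity (4 * (x ^+ 2 + t * x * r + r ^+ 2) + (t ^+ 2 - 4) * x ^+ 2); first by ring.
    by rewrite c mulr1.
  rewrite y exprMn s2 in tx.
  apply: (mulfI (expf_neq0 2 m0)); rewrite mulr0.
  transitivity (m ^+ 2 * (4 + (t ^+ 2 - 4) * m ^+ 2) - t ^+ 2 * m ^+ 2); first by ring.
  by rewrite tx subrr.
move/eqP: t4; rewrite mulf_eq0 (negPf m1) orbF subr_eq0 => /eqP t4.
pose a := - (t / 2).
have nz2 : 2 != 0 :> F by rewrite pnatr_eq0.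
have a2 : a ^+ 2 = 1.
  by rewrite /a sqrrN expr_div_n t4 -natrX divff // pnatr_eq0.
have tE : t = - (2 * a) by rewrite /a mulrN opprK mulrC mulfVK.
have [_] := cheb_at2 n.+1 a2; rewrite -tE s'0 mulr0 => /esym/eqP.
rewrite oppr_eq0 mulf_eq0 expf_eq0 /= -sqrf_eq0 a2 oner_eq0 /=.
have -> : n.+2%:R ^+ 3 - n.+2%:R = n.+2%:R * (n.+2%:R ^+ 2 - 1) :> F by ring.
by rewrite mulf_eq0 (negPf m0) (negPf m1).
Qed.

(** Counting replaces the determinant identity: [cheb_level] has 2 n + 2 distinct roots, at least 2
    n of them differ from 2 and -2 and are roots of the determinant by [quadmx_singular], and the
    determinant has degree 2 n. *)
Lemma quadmx_separable : separable_poly (\det quadmx).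
Proof.
have sM : forall i j, (size (quadmx i j) <= 3)%N.
  apply: size_toep; rewrite ?size_poly1 //.
    by rewrite (leq_trans (size_polyD _ _)) // geq_max size_polyXn size_polyC; case: eqP.
  by rewrite (leq_trans (size_scale_leq _ _)) // size_polyX.
have [sD cD] := det_bound sM; rewrite quadmx_top det1 in cD.
have D0 : (\det quadmx)`_(2 * n) != 0 by rewrite cD oner_eq0.
have {}sD := size_coef_eq sD D0.
have Dn0 : \det quadmx != 0 by rewrite -size_poly_eq0 sD.
have [rs HE] := closed_field_poly_normal cheb_level.
have lH0 : lead_coef cheb_level != 0.
  by rewrite lead_coef_eq0 separable_poly_neq0 // cheb_level_separable.
have urs : uniq rs.
  by rewrite -separable_prod_XsubC -(eqp_separable (eqp_scale _ lH0)) -HE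
    cheb_level_separable.
have srs : size rs = (2 * n).+2.
  by have := size_cheb_level; rewrite HE size_scale // size_prod_XsubC => -[].
pose qs := [seq t <- rs | t ^+ 2 != 4].
have rqs : all (root (\det quadmx)) qs.
  apply/allP => t; rewrite mem_filter => /andP[t4 trs]; apply/rootP.
  have Ht : root cheb_level t by rewrite HE rootZ // root_prod_XsubC.
  have m0 : n.+2%:R != 0 :> F by rewrite pnatr_eq0.
  pose sigma := s n.+2 t / n.+2%:R.
  rewrite -[_.[t]]/(horner_eval t _) -det_map_mx -/(mxeval t _) (@quadmx_singular t sigma) //.
    move: Ht; rewrite /root /cheb_level hornerD hornerN hornerC horner_exp.
    by rewrite subr_eq0 /sigma expr_div_n /s => /eqP <-; rewrite divff // expf_neq0.
  by rewrite /sigma divfK.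
have uqs : uniq qs by rewrite filter_uniq.
have sqs : size qs = (2 * n)%N.
  apply/eqP; rewrite eqn_leq; apply/andP; split.
    by rewrite -ltnS -sD; apply: max_poly_roots.
  have : (size rs <= size [:: 2%R, (- 2)%R & qs])%N.
    apply: uniq_leq_size => // t trs; rewrite !inE mem_filter trs andbT.
    have -> : (t ^+ 2 != 4) = (t != 2) && (t != -2).
      rewrite -subr_eq0 -[4]/(4%:R) (_ : 4%:R = 2 ^+ 2) ?subr_sqr ?mulf_eq0; last first.
        by rewrite -natrX.
      by rewrite negb_or subr_eq0 addr_eq0.
    by case: (t == 2); case: (t == -2).
  by rewrite srs /=; lia.
have := all_roots_prod_XsubC (etrans sD (congr1 S (esym sqs))) rqs.
rewrite uniq_rootsE => /(_ uqs) ->.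
rewrite (eqp_separable (eqp_scale _ _)) ?lead_coef_eq0 //.
by rewrite separable_prod_XsubC.
Qed.

End QuadPencil.

(** * The pencils of the components a_0 - a_1 + a_2 = 0 and a_0 + a_1 + a_2 = 0 *)

Section SecondDifference.
Variables (F : numFieldType) (n : nat) (tau : F).
Implicit Types u E : nat -> F.

Let diff2 u k := u k - 2 * u k.+1 + u k.+2.

(** Kernel vectors of the linear pencil, after a change of signs: 1 is a double root of the
    characteristic polynomial of their recurrence of order 4, so their second differences obey a
    recurrence of order 2. *)
Let admissible u := [/\ u 0%N = 0, u 1%N = 0, u n.+2 = 0, u n.+3 = 0 &
  forall k, (k < n)%N -> diff2 u k.+2 = tau * diff2 u k.+1 - diff2 u k].

(** This sum and the next one telescope to boundary values, all zero for an admissible sequence when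
    [m = n.+2]. *)
Let sum_diff2 u m : \sum_(k < m) diff2 u k = u m.+1 - u m - (u 1%N - u 0%N).
Proof.
elim: m => [|m IH]; first by rewrite big_ord0; ring.
by rewrite big_ord_recr /= IH /diff2; ring.
Qed.

Let sum_index_diff2 u m :
  \sum_(k < m) k%:R * diff2 u k = (m%:R - 1) * u m.+1 - m%:R * u m + u 1%N.
Proof.
elim: m => [|m IH]; first by rewrite big_ord0; ring.
by rewrite big_ord_recr /= IH /diff2 -natr1; ring.
Qed.

(* If the second differences of two admissible sequences were independent, the sums
   of E_k and of k E_k over a window of length n + 2 would vanish for every solution E
   of the recurrence; comparing E with its shift gives E_0 = 0, which is absurd. *)
Lemma diff2_dependent u1 u2 : admissible u1 -> admissible u2 ->
  diff2 u1 0 * diff2 u2 1 = diff2 u1 1 * diff2 u2 0.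
Proof.
move=> [a0 a1 a2 a3 ar] [b0 b1 b2 b3 br].
apply/eqP; rewrite -subr_eq0; apply/negPn/negP; set kappa := _ - _ => k0.
have sol E : (forall k, E k.+2 = tau * E k.+1 - E k) ->
    \sum_(k < n.+2) E k = 0 /\ \sum_(k < n.+2) k%:R * E k = 0.
  move=> Er.
  pose al := (E 0%N * diff2 u2 1 - E 1%N * diff2 u2 0) / kappa.
  pose be := (E 1%N * diff2 u1 0 - E 0%N * diff2 u1 1) / kappa.
  have EE k : (k <= n)%N -> E k = al * diff2 u1 k + be * diff2 u2 k /\
      E k.+1 = al * diff2 u1 k.+1 + be * diff2 u2 k.+1.
    elim: k => [_|k IH kn].
      by rewrite /al /be /kappa; split; field.
    have [E0 E1] := IH (ltnW kn).
    by split=> //; rewrite Er E0 E1 ar ?br //; ring.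
  have EE' (k : 'I_n.+2) : E k = al * diff2 u1 k + be * diff2 u2 k.
    case: k => -[|k] kn; first by have [] := EE 0%N isT.
    by have [] := EE k kn.
  have sa := sum_diff2 u1 n.+2; have sb := sum_diff2 u2 n.+2.
  have ta := sum_index_diff2 u1 n.+2; have tb := sum_index_diff2 u2 n.+2.
  rewrite a0 a1 a2 a3 b0 b1 b2 b3 !subr0 !mulr0 !addr0 ?subr0 in sa sb ta tb.
  split.
    under eq_bigr do rewrite EE'.
    by rewrite big_split -!mulr_sumr /= sa sb !mulr0 addr0.
  under eq_bigr do rewrite EE' mulrDr mulrCA [_ * (be * _)]mulrCA.
  by rewrite big_split -!mulr_sumr /= ta tb !mulr0 addr0.
have [E [E0 Er]] : exists E : nat -> F, E 0%N = 1 /\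
    forall k, E k.+2 = tau * E k.+1 - E k.
  by exists (fix E k : F := match k with 0 => 1 | k1.+1 =>
    match k1 with 0 => 0 | k2.+1 => tau * E k1 - E k2 end end).
have [s0 s1] := sol E Er; have [t0 t1] := sol (fun k => E k.+1) (fun k => Er k.+1).
have Em : E n.+2 = E 0%N.
  transitivity (\sum_(k < n.+3) E k); first by rewrite big_ord_recr /= s0 add0r.
  by rewrite big_ord_recl [X in _ + X](_ : _ = 0) ?addr0.
have : \sum_(k < n.+3) k%:R * E k = 0.
  rewrite big_ord_recl mul0r add0r.
  under eq_bigr => k _ do rewrite lift0 -natr1 mulrDl mul1r.
  by rewrite big_split /= t0 t1 addr0.
rewrite big_ord_recr /= s1 add0r => /eqP.
by rewrite mulf_eq0 pnatr_eq0 /= Em E0 oner_eq0.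
Qed.

End SecondDifference.

(** * Hermitian forms and positivity of 2 I - T_2 *)

Section Hermitian.
Variables (F : numClosedFieldType) (n : nat).

Definition herm (A : 'M[F]_n) (v : 'cV[F]_n) : F :=
  ((map_mx Num.conj v)^T *m A *m v) 0 0.

Lemma hermE A v : herm A v = \sum_i \sum_j (v i 0)^* * A i j * v j 0.
Proof.
rewrite /herm -mulmxA mxE; apply: eq_bigr => i _.
by rewrite !mxE mulr_sumr; apply: eq_bigr => j _; rewrite mulrA.
Qed.

Lemma herm_real (A : 'M[F]_n) v :
  (forall i j, (A i j)^* = A i j) -> A^T = A -> (herm A v)^* = herm A v.
Proof.
move=> Ar At; rewrite !hermE rmorph_sum exchange_big; apply: eq_bigr => i _.
rewrite rmorph_sum; apply: eq_bigr => j _; rewrite !rmorphM /= conjCK Ar.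
by rewrite -[in LHS]At mxE; ring.
Qed.

(* Summation by parts: sum_i w_(i+2)^* (2 w_(i+2) - w_i - w_(i+4)) = sum_l |w_(l+2) - w_l|^2. *)
Lemma herm_toepE v : let w := padded v in
  herm (toep n 2 0 (-1)) v = \sum_(l < n.+2) `|w l.+2 - w l| ^+ 2.
Proof.
move=> w; have w0 : w 0%N = 0 := padded0 v; have w1 : w 1%N = 0 := padded1 v.
have w2 : w n.+2 = 0 by rewrite -[n.+2]addn0 /w padded_out.
have w3 : w n.+3 = 0 by rewrite -[n.+3]addn1 /w padded_out.
rewrite /herm -mulmxA mxE.
transitivity (\sum_(i < n) (2 * (w i.+2 * (w i.+2)^*) - w i * (w i.+2)^*
                - w i.+4 * (w i.+2)^*)).
  apply: eq_bigr => i _; rewrite toep_mul_padded -/w 2!mxE -padded_in -/w; ring.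
rewrite !sumrB -mulr_sumr.
under [RHS]eq_bigr => l _ do rewrite normCK rmorphB /= mulrBl !mulrBr opprB addrA.
rewrite sumrB big_split sumrB /=.
rewrite [X in _ = X - _ + _ - _]big_ord_recr big_ord_recr /=.
have -> : \sum_(l < n.+2) w l * (w l)^* = \sum_(l < n) w l.+2 * (w l.+2)^*.
  by rewrite !big_ord_recl /= w0 w1 !mul0r !add0r.
have -> : \sum_(l < n.+2) w l.+2 * (w l)^* = \sum_(l < n) w l.+4 * (w l.+2)^*.
  by rewrite !big_ord_recl /= w0 w1 rmorph0 !mulr0 !add0r.
have -> : \sum_(l < n.+2) w l * (w l.+2)^* = \sum_(l < n) w l * (w l.+2)^*.
  by rewrite !big_ord_recr /= w2 w3 rmorph0 !mulr0 !addr0.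
rewrite w2 w3 !mul0r !addr0; ring.
Qed.

(** If the sum of squares vanishes, the padded vector is constant along each parity class, and both
    classes start at 0. *)
Lemma herm_toep_gt0 v : v != 0 -> 0 < herm (toep n 2 0 (-1)) v.
Proof.
rewrite lt_def herm_toepE /= sumr_ge0 ?andbT => [|l _]; last by rewrite exprn_ge0.
apply: contraNneq => h0; pose w := padded v.
have w0 : w 0%N = 0 := padded0 v; have w1 : w 1%N = 0 := padded1 v.
have wS l : (l < n.+2)%N -> w l.+2 = w l.
  move=> ln; have := psumr_eq0P (fun (l : 'I_n.+2) _ => exprn_ge0 2 (normr_ge0 (w l.+2 - w l))) h0.
  move=> /(_ (Ordinal ln) isT) /eqP; rewrite sqrf_eq0 normr_eq0 subr_eq0 => /eqP //.
have wz l : (l <= n)%N -> w l = 0 /\ w l.+1 = 0.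
  elim: l => [|l IH] ln; first by rewrite w0 w1.
  by have [z0 z1] := IH (ltnW ln); rewrite z1 wS ?z0 // ltnW // ltnW.
apply/eqP/colP => i; rewrite mxE -padded_in -/w.
have lt_in := ltn_ord i; have [wi _] := wz i (ltnW lt_in).
by rewrite wS //; lia.
Qed.


Lemma herm_toep_neq0 v : v != 0 -> herm (toep n 2 0 (-1)) v != 0.
Proof. by move=> /herm_toep_gt0 /lt0r_neq0. Qed.

End Hermitian.

Section LinPencil.
Variables (F : numClosedFieldType) (n : nat) (eps : F).
Hypotheses (n_ge3 : (2 < n)%N) (eps2 : eps ^+ 2 = 1).

(* The curve B - x A with B = toep n 2 eps 0 and A = toep n 2 0 (-1) positive definite. *)
Definition linmx : 'M[{poly F}]_n := toep n (2%:P - 2 *: 'X) eps%:P 'X.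

Lemma linmx_eval x : mxeval x linmx = toep n (2 - 2 * x) eps x.
Proof. by rewrite mxeval_toep !hornerE. Qed.

Lemma linmx_der : dermx linmx = - toep n 2 0 (-1).
Proof.
rewrite dermx_toep !derivE alg_polyC sub0r toepN oppr0 opprK.
by rewrite polyC_natr.
Qed.

Lemma linmx_top : mxcoef 1 linmx = - toep n 2 0 (-1).
Proof.
rewrite mxcoef_toep !coefE /= toepN.
by congr (toep _ _ _ _); ring.
Qed.

Let eps0 : eps != 0. Proof. by rewrite -sqrf_eq0 eps2 oner_eq0. Qed.

Let epsJ : eps^* = eps.
Proof.
have /eqP := eps2; rewrite sqrf_eq1 => /orP[] /eqP ->; first by rewrite rmorph1.
by rewrite rmorphN1.
Qed.

(** These signs turn the off-diagonal [eps] into -1 in either case, which places the double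
    characteristic root at 1. *)
Let flip (v : 'cV[F]_n) k := (- eps) ^+ k * padded v k.

Let flip_eq0 v k : (flip v k == 0) = (padded v k == 0).
Proof. by rewrite /flip mulf_eq0 expf_eq0 oppr_eq0 (negPf eps0) andbF. Qed.

Let padded_ends (v : 'cV[F]_n) : [/\ padded v 0 = 0, padded v 1 = 0,
  padded v n.+2 = 0 & padded v n.+3 = 0].
Proof.
split; [exact: padded0|exact: padded1|by rewrite -[n.+2]addn0 padded_out|].
by rewrite -[n.+3]addn1 padded_out.
Qed.

Let flip_rec x v : mxeval x linmx *m v = 0 -> forall k, (k < n)%N ->
  x * flip v k - flip v k.+1 + (2 - 2 * x) * flip v k.+2 - flip v k.+3
    + x * flip v k.+4 = 0.
Proof.
move=> Mv k kn; have := congr1 (fun A : 'cV_n => A (Ordinal kn) 0) Mv.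
rewrite linmx_eval toep_mul_padded mxE /= /flip !exprS => e.
rewrite -[RHS](mulr0 ((- eps) ^+ k)) -[in RHS]e.
move: ((- eps) ^+ k) (padded v k) (padded v k.+1) (padded v k.+2) (padded v k.+3) => a b c d f.
ring: eps2.
Qed.

Let padded_eq0 (v : 'cV[F]_n) :
  (forall k, (k < n.+2)%N -> flip v k = 0) -> v = 0.
Proof.
move=> v0; apply/colP => i; rewrite mxE -padded_in; apply/eqP.
by rewrite -flip_eq0 v0 // !ltnS ltn_ord.
Qed.

(** At [x = 0] the recurrence loses its leading term and is treated apart: it says that second
    differences vanish, so the sequence is linear, and zero at both ends. *)
Lemma linmx0_det : \det (mxeval 0 linmx) != 0.
Proof.
apply/eqP => /ker_singular[v v0 Mv]; move/eqP: v0; apply.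
have [p0 p1 p2 p3] := padded_ends v.
have u1 : flip v 1 = 0 by rewrite /flip p1 mulr0.
have uE k : (k <= n)%N -> flip v k.+1 = k%:R * flip v 2 /\
     flip v k.+2 = k.+1%:R * flip v 2.
  elim: k => [|k IH] kn; first by rewrite u1 mul0r mul1r.
  have [e0 e1] := IH (ltnW kn); split=> //; have := flip_rec Mv kn.
  rewrite e0 e1 -[k.+2%:R]natr1 -[k.+1%:R]natr1 => e.
  by apply/eqP; rewrite -subr_eq0 -oppr_eq0 -[X in _ == X]e; apply/eqP; ring.
have u2 : flip v 2 = 0.
  have [_] := uE n (leqnn n); rewrite /flip p2 mulr0 => /esym/eqP.
  by rewrite mulf_eq0 pnatr_eq0 => /eqP.
apply: padded_eq0 => -[|[|k]] kn; [by rewrite /flip p0 mulr0|by []|].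
by have [_ ->] := uE k (ltnW kn); rewrite u2 mulr0.
Qed.

Section Kernel.
Variable x : F.
Hypothesis x0 : x != 0.

Let ker (v : 'cV[F]_n) := mxeval x linmx *m v = 0.

Let ker_eq0 v : ker v -> flip v 2 = 0 -> flip v 3 = 0 -> v = 0.
Proof.
move=> Mv u2 u3; have [p0 p1 _ _] := padded_ends v.
have u0 : flip v 0 = 0 by rewrite /flip p0 mulr0.
have u1 : flip v 1 = 0 by rewrite /flip p1 mulr0.
have uz k : (k <= n)%N -> [/\ flip v k = 0, flip v k.+1 = 0, flip v k.+2 = 0 & flip v k.+3 = 0].
  elim: k => [//|k IH] kn; have [z0 z1 z2 z3] := IH (ltnW kn); split=> //.
  have := flip_rec Mv kn; rewrite z0 z1 z2 z3 !mulr0 !subr0 !add0r => /eqP.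
  by rewrite mulf_eq0 (negPf x0) => /eqP.
apply: padded_eq0 => -[|k] kn; first by [].
by have [] := uz k kn.
Qed.

Let ker_dependent v z : ker v -> ker z -> flip v 2 * flip z 3 = flip v 3 * flip z 2.
Proof.
(* The characteristic polynomial [x q^4 - q^3 + (2 - 2 x) q^2 - q + x] is
   [(q - 1)^2 (x q^2 - (1 - 2 x) q + x)]; hence the coefficient [(1 - 2 x) / x]. *)
move=> Mv Mz; have adm (y : 'cV[F]_n) : ker y ->
   [/\ flip y 0 = 0, flip y 1 = 0, flip y n.+2 = 0, flip y n.+3 = 0 &
    forall k, (k < n)%N -> flip y k.+2 - 2 * flip y k.+3 + flip y k.+4 =
     (1 - 2 * x) / x * (flip y k.+1 - 2 * flip y k.+2 + flip y k.+3)
      - (flip y k - 2 * flip y k.+1 + flip y k.+2)].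
  move=> My; have [p0 p1 p2 p3] := padded_ends y.
  split; rewrite /flip ?(p0, p1, p2, p3) ?mulr0 // => k kn; rewrite -!/(flip y _).
  have -> : flip y k.+4 = - (x * flip y k - flip y k.+1 + (2 - 2 * x) * flip y k.+2
     - flip y k.+3) / x.
    apply: (mulIf x0); rewrite divfK //; apply/eqP.
    by rewrite -addr_eq0 addrC [flip y k.+4 * x]mulrC (flip_rec My kn).
  by field.
have [v0 v1 v2 v3 vr] := adm v Mv; have [z0 z1 z2 z3 zr] := adm z Mz.
have := diff2_dependent (And5 v0 v1 v2 v3 vr) (And5 z0 z1 z2 z3 zr).
rewrite v0 v1 z0 z1 !mulr0 !subr0 !add0r => e.
apply/eqP; rewrite -subr_eq0; apply/eqP.
transitivity (flip v 2 * (- (2 * flip z 2) + flip z 3)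
  - (- (2 * flip v 2) + flip v 3) * flip z 2); first by ring.
by rewrite e subrr.
Qed.

Lemma linmx_ker_line v z : ker v -> ker z -> v != 0 -> exists c, z = c *: v.
Proof.
move=> Mv Mz v0; have dep := ker_dependent Mv Mz.
have flipZ c k : flip (z - c *: v) k = flip z k - c * flip v k.
  rewrite /flip /padded; case: insub => [j|]; last by rewrite !mulr0 subr0.
  by case: ifP => _; rewrite ?mxE; ring.
have kerZ c : ker (z - c *: v).
  by rewrite /ker mulmxBr -scalemxAr Mv Mz scaler0 subr0.
have [v2|v2] := eqVneq (flip v 2) 0; last first.
  exists (flip z 2 / flip v 2); apply/eqP; rewrite -subr_eq0; apply/eqP.
  apply: ker_eq0 => //; rewrite flipZ; first by field.
  apply: (mulfI v2); rewrite mulrBr dep mulr0; by field.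
have v3 : flip v 3 != 0 by apply: contraNneq v0 => v3; rewrite (ker_eq0 Mv v2 v3).
have z2 : flip z 2 = 0.
  by move/esym/eqP: dep; rewrite v2 mul0r mulf_eq0 (negPf v3) => /eqP.
exists (flip z 3 / flip v 3); apply/eqP; rewrite -subr_eq0; apply/eqP.
by apply: ker_eq0 => //; rewrite flipZ ?z2 ?v2; [ring|field].
Qed.

End Kernel.

Let dmx_conj (A : 'M[F]_n) (v z : 'cV[F]_n) :
  (forall i j, (A i j)^* = A i j) -> A^T = A -> A *m v = 0 ->
  ((map_mx Num.conj v)^T *m (A *m z)) 0 0 = 0.
Proof.
move=> Ar At Av; rewrite mulmxA; suff -> : (map_mx Num.conj v)^T *m A = 0.
  by rewrite mul0mx mxE.
apply/rowP => j; rewrite !mxE.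
transitivity ((\sum_k A j k * v k 0)^*); last first.
  by have := congr1 (fun B : 'cV_n => B j 0) Av; rewrite !mxE => ->; rewrite rmorph0.
rewrite rmorph_sum; apply: eq_bigr => k _; rewrite !mxE rmorphM /= Ar mulrC.
by rewrite -[in LHS]At mxE.
Qed.

Let toep_conj (a b c : F) i j : a^* = a -> b^* = b -> c^* = c ->
  (toep n a b c i j)^* = toep n a b c i j.
Proof.
move=> ar br cr; rewrite mxE; case: (_ + _)%N => [|[|[|k]]] //=.
by rewrite nth_nil rmorph0.
Qed.

Let linmx_split x : mxeval x linmx = toep n 2 eps 0 - x *: toep n 2 0 (-1).
Proof.
by rewrite linmx_eval toepZ toepN toepD; congr (toep _ _ _ _); ring.
Qed.

(** A kernel vector exhibits [x] as a quotient of two real Hermitian values, the denominator being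
    nonzero by definiteness. *)
Let root_real x : \det (mxeval x linmx) = 0 -> x^* = x.
Proof.
case/ker_singular => v v0 Mv.
have hA := herm_toep_neq0 v0.
have A_real := herm_real v (fun i j => toep_conj i j (conjC_nat F 2) (rmorph0 _)
  (rmorphN1 Num.conj))
  (trmx_toep _ _ _ _).
have B_real := herm_real v (fun i j => toep_conj i j (conjC_nat F 2) epsJ (rmorph0 _))
  (trmx_toep _ _ _ _).
have e : herm (toep n 2 eps 0) v = x * herm (toep n 2 0 (-1)) v.
  have : ((map_mx Num.conj v)^T *m (mxeval x linmx *m v)) 0 0 = 0.
    by rewrite Mv mulmx0 mxE.
  rewrite linmx_split mulmxBl mulmxBr -scalemxAl -scalemxAr !mulmxA !mxE /herm.
  by move/eqP; rewrite subr_eq0 => /eqP; rewrite !mxE.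
have := congr1 Num.conj e; rewrite rmorphM /= A_real B_real e.
by move/(mulIf hA).
Qed.

(** Since [M0] is singular, this diagonal entry is [\det (M0 + E)] with [E] the matrix unit at
    [(k, k)]. A kernel vector [z] of [M0 + E], paired with [v], has [z k 0 = 0]; so it lies in the
    kernel of [M0], is a multiple of [v], and is zero because [v k 0] is not. *)
Let adj_diag_neq0 x (v : 'cV[F]_n) k : mxeval x linmx *m v = 0 -> v k 0 != 0 ->
  (\adj (mxeval x linmx)) k k != 0.
Proof.
move=> Mv vk; set M0 := mxeval x linmx in Mv *.
have MT : M0^T = M0 by rewrite /M0 linmx_eval trmx_toep.
have v0 : v != 0 by apply: contraNneq vk => ->; rewrite mxE.
have D0 := singular_ker Mv v0.
have x0 : x != 0.
  by apply: contraNneq linmx0_det => x0; rewrite -[X in mxeval X _]x0 -/M0 D0.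
pose E : 'M[F]_n := delta_mx k k.
have detE : \det (M0 + E) = \adj M0 k k.
  rewrite (@determinant_multilinear _ _ _ M0
    (\matrix_(i, j) if i == k then E k j else M0 i j) k 1 1).
  - rewrite D0 mulr0 add0r mul1r mxE (expand_det_row _ k) (bigD1 k) //=.
    rewrite big1 ?addr0; last first.
      by move=> j jk; rewrite !mxE !eqxx (negPf jk) mul0r.
    rewrite !mxE !eqxx mul1r /cofactor; congr (_ * \det _).
    by apply/matrixP => i j; rewrite !mxE eq_sym (negPf (neq_lift _ _)).
  - by apply/rowP => j; rewrite !mxE !eqxx !mul1r.
  - by apply/matrixP => i j; rewrite !mxE eq_sym (negPf (neq_lift _ _)) addr0.
  - by apply/matrixP => i j; rewrite !mxE eq_sym (negPf (neq_lift _ _)) addr0.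
apply/eqP => a0; rewrite a0 in detE; have [z z0 Mz] := ker_singular detE.
have Ez : E *m z = z k 0 *: delta_mx k 0.
  apply/colP => i; rewrite !mxE (bigD1 k) //= big1 ?addr0; last first.
    by move=> j jk; rewrite !mxE (negPf jk) andbF mul0r.
  by rewrite !mxE !eqxx !andbT mulrC.
have zk : z k 0 = 0.
  have : (v^T *m ((M0 + E) *m z)) 0 0 = 0 by rewrite Mz mulmx0 mxE.
  rewrite mulmxDl mulmxDr mulmxA -{1}MT -trmx_mul Mv trmx0 mul0mx add0r Ez.
  rewrite -scalemxAr -colE !mxE => /eqP.
  by rewrite mulf_eq0 (negPf vk) orbF => /eqP.
have M0z : M0 *m z = 0 by move: Mz; rewrite mulmxDl Ez zk scale0r addr0.
have [c zE] := linmx_ker_line x0 Mv M0z v0.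
move/eqP: zk; rewrite zE mxE mulf_eq0 (negPf vk) orbF => /eqP c0.
by move: z0; rewrite zE c0 scale0r eqxx.
Qed.

(* If D(x) = D'(x) = 0, a nonzero column w of adj M(x) satisfies A w = M(x) w' for
   some w'; x being real, M(x) is Hermitian, so w^* A w = 0. *)
Lemma linmx_separable : separable_poly (\det linmx).
Proof.
rewrite separable_poly.unlock; apply: closed_coprimepP => x.
apply/negP => /andP[/rootP Dx /rootP D'x].
have Dx0 : \det (mxeval x linmx) = 0 by rewrite /mxeval det_map_mx.
have [v v0 Mv] := ker_singular Dx0.
have [k vk] : exists k, v k 0 != 0.
  by have /matrix0Pn[k [j]] := v0; rewrite ord1; exists k.
have akk := adj_diag_neq0 Mv vk.
pose w := col k (mxeval x (\adj linmx)).
have aE : mxeval x (\adj linmx) = \adj (mxeval x linmx) by rewrite /mxeval map_mx_adj.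
have w0 : w != 0.
  by apply: contraNneq akk => w0; have := congr1 (fun A : 'cV_n => A k 0) w0;
    rewrite /w aE [LHS]mxE => ->; rewrite mxE.
have Mw : mxeval x linmx *m w = 0.
  by rewrite /w aE colE mulmxA mul_mx_adj Dx0 mul_scalar_mx scale0r.
have e : toep n 2 0 (-1) *m w = mxeval x linmx *m col k (mxeval x (dermx (\adj linmx))).
  have := congr1 (fun A => mxeval x (dermx A) *m (delta_mx k 0 : 'cV_n)) (mul_mx_adj linmx).
  rewrite dermx_mul dermx_scalar linmx_der /mxeval map_mxD !map_mxM -!/(mxeval _ _).
  have -> : mxeval x (- toep n 2 0 (-1)) = - toep n 2 0 (-1).
    by rewrite /mxeval map_mxN -/(mxeval _ _) mxeval_toep !hornerE.
  have -> : mxeval x ((\det linmx)^`())%:M = 0%:M :> 'M[F]_n.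
    by rewrite /mxeval map_scalar_mx /= /horner_eval D'x.
  rewrite mul_scalar_mx scale0r mulmxDl -!mulmxA -!colE.
  by move/eqP; rewrite mulNmx addrC subr_eq0 => /eqP ->.
have xJ := root_real Dx0.
have := herm_toep_neq0 w0; rewrite /herm -mulmxA e dmx_conj ?eqxx //.
  move=> i j; rewrite linmx_eval; apply: toep_conj => //.
  by rewrite rmorphB rmorphM /= conjC_nat xJ.
by rewrite linmx_eval trmx_toep.
Qed.

End LinPencil.

(** For [e] equal to 1 or -1 this tests the form on one symmetric or antisymmetric vector, and it
    involves only two entries of the matrix. *)
Lemma qform_sym_anti (R : comNzRingType) n (i : 'I_n) (c0 c1 c2 e : R) : e ^+ 2 = 1 ->
  qform (toep n c0 c1 c2) ((1%:M + e *: revmx R n) *m delta_mx i 0) =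
  2 * (c0 + e * toep n c0 c1 c2 i (rev_ord i)).
Proof.
move=> e2; set T := toep _ _ _ _; set J := revmx R n; set E := 1%:M + _.
have ET : E^T = E by rewrite /E linearD /= linearZ /= trmx1 trmx_revmx.
have JT : J *m T = T *m J by exact: revmx_toep.
have TE : E^T *m T *m E = 2 *: (T *m E).
  have -> : E^T *m T = T *m E.
    by rewrite ET /E mulmxDl mulmxDr mul1mx mulmx1 -scalemxAl -scalemxAr JT.
  rewrite -mulmxA; suff -> : E *m E = 2 *: E by rewrite -scalemxAr.
  rewrite {1}/E mulmxDl mul1mx /E mulmxDr mulmx1 -scalemxAl -scalemxAr revmx_invol.
  rewrite scalerA -expr2 e2 scale1r.
  by apply/matrixP => a b; rewrite !mxE; ring.
rewrite qform_conj TE qformZ /qform trmx_delta -rowE -colE.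
have -> : col i (row i (T *m E)) 0 0 = (T *m E) i i by rewrite !mxE.
congr (_ * _); rewrite /E mulmxDr mulmx1 -scalemxAr mxE [X in _ + X]mxE; congr (_ + _ * _).
  by rewrite mxE subnn.
have -> : T *m J = (J *m T)^T by rewrite trmx_mul trmx_toep trmx_revmx.
have TT : T^T = T by exact: trmx_toep.
by rewrite mxE mul_revmx mxE -{1}TT mxE.
Qed.

Section ToepFamily.
Variables (F : numClosedFieldType) (n delta : nat) (c0 c1 c2 : {poly F}).
Local Notation M := (toep n c0 c1 c2).
Hypotheses (n_ge3 : (2 < n)%N) (delta_gt0 : (0 < delta)%N).
Hypotheses (s0 : (size c0 <= delta.+1)%N) (s1 : (size c1 <= delta.+1)%N)
  (s2 : (size c2 <= delta.+1)%N).
Hypothesis Mtop_unit : \det (mxcoef delta M) != 0.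
Hypothesis Mnext_neq : forall c, mxcoef delta.-1 M != c *: mxcoef delta M.
Hypothesis D_separable : separable_poly (\det M).
Hypothesis Mder_neq : forall t c, mxeval t (dermx M) != c *: mxeval t M.
Hypotheses (lead0 : c0`_delta != 0) (lead1 : c0`_delta + c2`_delta != 0)
  (lead2 : c0`_delta - c2`_delta != 0).

Let MJ : map_mx polyC (revmx F n) *m M = M *m map_mx polyC (revmx F n).
Proof. by rewrite map_revmx revmx_toep. Qed.

Let top_proj (e : F) : e ^+ 2 = 1 ->
  exists u, qform (mxcoef delta M) ((1%:M + e *: revmx F n) *m u) != 0.
Proof.
move=> e2; have n0 : (0 < n)%N by lia.
exists (delta_mx (Ordinal n0) 0); rewrite mxcoef_toep qform_sym_anti //.
rewrite mulf_neq0 ?pnatr_eq0 // mxE /= sub0n add0n subn0 subn1.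
(* For n = 3 the first index and its mirror image are at distance 2, so [c2] contributes; for larger
   n they lie outside the band. *)
have lead_e : c0`_delta + e * c2`_delta != 0.
  by have /eqP := e2; rewrite sqrf_eq1 => /orP[] /eqP ->; rewrite ?mul1r ?mulN1r.
case: n n_ge3 => [|[|[|[|k]]]] //= _.
by rewrite nth_nil mulr0 addr0.
Qed.

Let Mtop_sym : exists u, qform (mxcoef delta M) ((1%:M + revmx F n) *m u) != 0.
Proof. by have [u] := top_proj (expr1n _ 2); rewrite scale1r; exists u. Qed.

Let Mtop_anti : exists u, qform (mxcoef delta M) ((1%:M - revmx F n) *m u) != 0.
Proof. by have [|u] := @top_proj (-1); rewrite ?sqrrN ?expr1n // scaleN1r; exists u. Qed.

Let sM := size_toep (n := n) s0 s1 s2.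

Lemma toep_critical_generic : zgeneric (fun y =>
  [/\ size (pform (critmx M) y) = (delta * (2 * n - 1) - 2).+1,
      separable_poly (pform (critmx M) y) &
      forall t, root (pform (critmx M) y) t ->
        (\det M).[t] != 0 /\ (pform (\adj M) y).[t] != 0]).
Proof.
exact: (critical_points_generic n_ge3 delta_gt0 (trmx_revmx _ _) (revmx_invol _ _)
  (trmx_toep _ _ _ _) MJ sM Mtop_unit Mnext_neq D_separable Mder_neq Mtop_sym Mtop_anti).
Qed.

Lemma toep_critical_avoid t : zgeneric (fun y => (pform (critmx M) y).[t] != 0).
Proof.
exact: (critmx_horner_generic n_ge3 delta_gt0 (trmx_toep _ _ _ _) sM Mtop_unit
  D_separable Mder_neq).
Qed.

End ToepFamily.

Section Instances.
Variables (F : numClosedFieldType) (n : nat).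
Hypothesis n_ge3 : (2 < n)%N.

Let i0 : 'I_n := Ordinal (ltnW (ltnW n_ge3)).
Let i1 : 'I_n := Ordinal (ltnW n_ge3).
Let i2 : 'I_n := Ordinal n_ge3.

Let toep_neq (a0 a1 a2 b0 b1 b2 : F) :
  a1 != b1 \/ a2 != b2 -> toep n a0 a1 a2 != toep n b0 b1 b2.
Proof.
move=> h; apply/eqP => /matrixP e; move: (e i0 i1) (e i0 i2) h.
by rewrite !mxE /= => -> ->; rewrite !eqxx => -[].
Qed.

Let sX2 : (size ('X^2 : {poly F}) <= 3)%N. Proof. by rewrite size_polyXn. Qed.

Let quad_s0 : (size (2%:P + 'X ^+ 2 : {poly F})%R <= 3)%N.
Proof.
by rewrite (leq_trans (size_polyD _ _)) // geq_max sX2 size_polyC; case: eqP.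
Qed.
Let quad_s1 : (size (2 *: 'X : {poly F})%R <= 3)%N.
Proof. by rewrite (leq_trans (size_scale_leq _ _)) // size_polyX. Qed.
Let quad_s2 : (size (1 : {poly F})%R <= 3)%N. Proof. by rewrite size_poly1. Qed.

Let quad_top_unit : \det (mxcoef 2 (quadmx F n)) != 0.
Proof. by rewrite quadmx_top det1 oner_eq0. Qed.

Let quad_next c : mxcoef 1 (quadmx F n) != c *: mxcoef 2 (quadmx F n).
Proof.
rewrite !mxcoef_toep toepZ; apply: toep_neq; left; rewrite !coefE /= mulr0 mulr1 mulr0.
by rewrite pnatr_eq0.
Qed.

Let quad_der t c : mxeval t (dermx (quadmx F n)) != c *: mxeval t (quadmx F n).
Proof.
rewrite quadmx_der quadmx_eval mxeval_toep toepZ; apply: toep_neq.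
rewrite !hornerE; have [<-|] := eqVneq 0 c; last by right.
by left; rewrite /= !mul0r pnatr_eq0.
Qed.

Lemma quad_critical_generic : zgeneric (fun y =>
  [/\ size (pform (critmx (quadmx F n)) y) = (2 * (2 * n - 1) - 2).+1,
      separable_poly (pform (critmx (quadmx F n)) y) &
      forall t, root (pform (critmx (quadmx F n)) y) t ->
        (\det (quadmx F n)).[t] != 0 /\ (pform (\adj (quadmx F n)) y).[t] != 0]).
Proof.
apply: toep_critical_generic => //; try exact: quadmx_separable;
  by rewrite !coefE /= ?add0r ?addr0 ?subr0 oner_eq0.
Qed.

Lemma quad_critical_avoid t :
  zgeneric (fun y => (pform (critmx (quadmx F n)) y).[t] != 0).
Proof. by apply: (@toep_critical_avoid _ _ 2) => //; exact: quadmx_separable. Qed.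

Variable eps : F.
Hypothesis eps2 : eps ^+ 2 = 1.

Let lin_s0 : (size (2%:P - 2 *: 'X : {poly F})%R <= 2)%N.
Proof.
rewrite (leq_trans (size_polyD _ _)) // geq_max size_polyN size_polyC.
by rewrite (leq_trans (size_scale_leq _ _)) ?size_polyX //; case: eqP.
Qed.
Let lin_s1 : (size (eps%:P : {poly F})%R <= 2)%N.
Proof. by rewrite size_polyC; case: eqP. Qed.
Let lin_s2 : (size ('X : {poly F})%R <= 2)%N. Proof. by rewrite size_polyX. Qed.

Let eps0 : eps != 0. Proof. by rewrite -sqrf_eq0 eps2 oner_eq0. Qed.

Lemma det_toep_neq0 : \det (toep n 2 0 (-1) : 'M[F]_n) != 0.
Proof.
apply/eqP => /ker_singular[v v0 Mv]; have := herm_toep_neq0 v0.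
by rewrite /herm -mulmxA Mv mulmx0 mxE eqxx.
Qed.

Let lin_top_unit : \det (mxcoef 1 (linmx n eps)) != 0.
Proof. by rewrite linmx_top -scaleN1r detZ mulf_neq0 ?signr_eq0 ?det_toep_neq0. Qed.

Let lin_next c : mxcoef 0 (linmx n eps) != c *: mxcoef 1 (linmx n eps).
Proof.
rewrite !mxcoef_toep toepZ; apply: toep_neq; left.
by rewrite !coefE /= mulr0.
Qed.

Let lin_der t c : mxeval t (dermx (linmx n eps)) != c *: mxeval t (linmx n eps).
Proof.
rewrite dermx_toep linmx_eval mxeval_toep !derivE toepZ; apply: toep_neq.
rewrite !hornerE; have [c0|c0] := eqVneq c 0.
  by right; rewrite c0 mul0r oner_eq0.
by left; rewrite eq_sym mulf_neq0.
Qed.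

Lemma lin_critical_generic : zgeneric (fun y =>
  [/\ size (pform (critmx (linmx n eps)) y) = (1 * (2 * n - 1) - 2).+1,
      separable_poly (pform (critmx (linmx n eps)) y) &
      forall t, root (pform (critmx (linmx n eps)) y) t ->
        (\det (linmx n eps)).[t] != 0 /\ (pform (\adj (linmx n eps)) y).[t] != 0]).
Proof.
apply: toep_critical_generic => //; try exact: linmx_separable.
- by rewrite !coefE /= sub0r mulr1 oppr_eq0 pnatr_eq0.
- rewrite !coefE /= sub0r mulr1 (_ : - 2 + 1 = -1) ?oppr_eq0 ?oner_eq0 //; ring.
- by rewrite !coefE /= sub0r mulr1 -opprD oppr_eq0 natr1 pnatr_eq0.
Qed.

Lemma lin_critical_avoid t :
  zgeneric (fun y => (pform (critmx (linmx n eps)) y).[t] != 0).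
Proof. by apply: (@toep_critical_avoid _ _ 1) => //; exact: linmx_separable. Qed.

End Instances.

(** * The score along a curve *)

Lemma deriv_prod (R : comNzRingType) (I : finType) (f : I -> {poly R}) :
  (\prod_i f i)^`() = \sum_k \prod_i (if i == k then (f i)^`() else f i).
Proof.
elim: (index_enum I) (index_enum_uniq I) => [_|a r IH /andP[ar ur]].
  by rewrite !big_nil derivC.
rewrite !big_cons derivM IH // eqxx; congr (_ * _ + _).
  by apply: eq_big_seq => i ir; case: eqP ar => // <-; rewrite ir.
rewrite mulr_sumr; apply: eq_big_seq => k kr; rewrite big_cons.
by case: eqP ar => // ->; rewrite kr.
Qed.

(** Jacobi's formula: differentiate one row at a time and expand along that row. *)
Lemma deriv_det (R : comNzRingType) n (M : 'M[{poly R}]_n) :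
  (\det M)^`() = \tr (\adj M *m dermx M).
Proof.
pose Mk (k : 'I_n) : 'M_n := \matrix_(i, j) if i == k then (M i j)^`() else M i j.
transitivity (\sum_k \det (Mk k)).
  rewrite raddf_sum [RHS]exchange_big; apply: eq_bigr => s _.
  rewrite /= -mulr_sumr -![(-1) ^+ s]signr_odd !mulr_sign.
  have e : (\prod_i M i (s i))^`() = \sum_k \prod_i Mk k i (s i).
    by rewrite deriv_prod; apply: eq_bigr => k _; apply: eq_bigr => i _; rewrite mxE.
  by case: ifP => _; rewrite ?derivN e.
rewrite /mxtrace; under [RHS]eq_bigr => j _ do rewrite mxE.
rewrite [RHS]exchange_big; apply: eq_bigr => k _; rewrite (expand_det_row _ k).
apply: eq_bigr => j _; rewrite !mxE eqxx mulrC; congr (_ * _).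
rewrite /cofactor; congr (_ * \det _); apply/matrixP => a b.
by rewrite !mxE eq_sym (negPf (neq_lift _ _)).
Qed.

(** The directional derivative of the log-likelihood at [S]. It is linear in [X], so only the span
    of the partial derivatives of the covariance matters. *)
Definition score (K : fieldType) (n : nat) (S : 'M[K]_n) (y : 'cV[K]_n) (X : 'M[K]_n) : K :=
  - \tr (invmx S *m X) + (y^T *m invmx S *m X *m invmx S *m y) 0 0.

Section Score.
Variables (K : fieldType) (n : nat).
Implicit Types (S X Y : 'M[K]_n) (y : 'cV[K]_n).

Let mx11D (A B : 'M[K]_1) : (A + B) 0 0 = A 0 0 + B 0 0. Proof. by rewrite mxE. Qed.
Let mx11Z a (A : 'M[K]_1) : (a *: A) 0 0 = a * A 0 0. Proof. by rewrite mxE. Qed.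

Lemma scoreZ S y a X : score S y (a *: X) = a * score S y X.
Proof.
rewrite /score -!scalemxAr -!scalemxAl linearZ /= mx11Z; ring.
Qed.

Lemma scoreD S y X Y : score S y (X + Y) = score S y X + score S y Y.
Proof.
rewrite /score !mulmxDr !mulmxDl linearD /= mx11D; ring.
Qed.

Lemma scoreB S y X Y : score S y (X - Y) = score S y X - score S y Y.
Proof. by rewrite -scaleN1r scoreD scoreZ mulN1r. Qed.

Lemma invmx_scale_det (A : 'M[K]_n) c : c != 0 -> \det A != 0 ->
  invmx (c *: A) = (c * \det A)^-1 *: \adj A.
Proof.
move=> c0 D0; have Au : A \in unitmx by rewrite unitmxE unitfE.
have cAu : c *: A \in unitmx by rewrite unitmxE detZ unitfE mulf_neq0 ?expf_neq0.
by rewrite invmxZ // /invmx Au scalerA invfM.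
Qed.

Lemma sandwich_scale (A X : 'M[K]_n) k y :
  (y^T *m (k *: A) *m X *m (k *: A) *m y) 0 0 = k ^+ 2 * qform (A *m X *m A) y.
Proof.
rewrite -[y^T *m (k *: A)]scalemxAr -!scalemxAl -scalemxAr -!scalemxAl scalerA mx11Z.
by rewrite /qform !mulmxA expr2.
Qed.

Lemma score_scalar (A : 'M[K]_n) c y : c != 0 -> \det A != 0 ->
  c ^+ 2 * \det A * score (c *: A) y A = qform (\adj A) y - n%:R * c * \det A.
Proof.
move=> c0 D0; rewrite /score invmx_scale_det //.
set k := (c * _)^-1; rewrite -!scalemxAl mul_adj_mx linearZ /= mxtrace_scalar.
rewrite -!scalemxAr -!scalemxAl -[y^T *m _ *m A]mulmxA mul_adj_mx mul_mx_scalar.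
rewrite -!scalemxAl -?scalemxAr !mx11Z -/(qform (\adj A) y) -mulr_natr /k.
by field; rewrite c0 D0.
Qed.

End Score.

Section ScorePencil.
Variables (F : numClosedFieldType) (n : nat) (M : 'M[{poly F}]_n) (t c : F) (y : 'cV[F]_n).
Hypotheses (n_gt0 : (0 < n)%N) (c0 : c != 0) (Dt : (\det M).[t] != 0).

Let detE : \det (mxeval t M) = (\det M).[t].
Proof. by rewrite /mxeval det_map_mx. Qed.

Let adjE : mxeval t (\adj M) = \adj (mxeval t M).
Proof. by rewrite /mxeval map_mx_adj. Qed.

Let adj_der : \adj (mxeval t M) *m mxeval t (dermx M) *m \adj (mxeval t M) =
  (\det M)^`().[t] *: \adj (mxeval t M) - (\det M).[t] *: mxeval t (dermx (\adj M)).
Proof.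
have := congr1 (fun A => \adj (mxeval t M) *m mxeval t (dermx A)) (mul_mx_adj M).
rewrite dermx_mul dermx_scalar /mxeval map_mxD !map_mxM map_scalar_mx -!/(mxeval _ _).
rewrite mulmxDr mulmxA adjE mulmxA mul_adj_mx detE mul_scalar_mx mul_mx_scalar => <-.
by rewrite addrK.
Qed.

Lemma score_der : c ^+ 2 * (\det M).[t] ^+ 2 * score (c *: mxeval t M) y (mxeval t (dermx M)) =
  (\det M)^`().[t] * (pform (\adj M) y).[t] - (\det M).[t] * (pform (\adj M) y)^`().[t]
   - c * (\det M).[t] * (\det M)^`().[t].
Proof.
have D0 : \det (mxeval t M) != 0 by rewrite detE.
rewrite /score invmx_scale_det //.
have -> : \tr ((c * \det (mxeval t M))^-1 *: \adj (mxeval t M) *m mxeval t (dermx M)) =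
   (c * \det (mxeval t M))^-1 * (\det M)^`().[t].
  rewrite -scalemxAl linearZ /= deriv_det -adjE /mxeval -map_mxM -[_.[t]]/(horner_eval t _).
  by rewrite -trace_map_mx.
rewrite sandwich_scale adj_der.
rewrite qformD qformN !qformZ deriv_pform !horner_pform adjE detE.
by field; rewrite c0 Dt.
Qed.

(** Here [c] is the square of the scale. The direction M gives N = n c D; substituted in n times the
    numerator of [score_der], this leaves - P. *)
Lemma score_pencil :
  (score (c *: mxeval t M) y (mxeval t M) = 0 /\
   score (c *: mxeval t M) y (mxeval t (dermx M)) = 0) <->
  ((pform (critmx M) y).[t] = 0 /\ n%:R * c * (\det M).[t] = (pform (\adj M) y).[t]).
Proof.
have D0 : \det (mxeval t M) != 0 by rewrite detE.
have n0 : n%:R != 0 :> F by rewrite pnatr_eq0 -lt0n.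
have n1 : n%:R = n.-1%:R + 1 :> F by rewrite natr1 prednK.
have e1 := score_scalar y c0 D0; have e2 := score_der.
rewrite detE -adjE -horner_pform in e1; rewrite pform_critmx.
rewrite hornerD hornerN !hornerM -!polyC_natr !hornerC.
move: e1 e2; set s1 := score _ _ _; set s2 := score _ _ _.
move: (pform _ y).[t] (pform _ y)^`().[t] (\det M).[t] (\det M)^`().[t] Dt => N N' D D' Dn0 e1 e2.
have k1 : c ^+ 2 * D != 0 by rewrite mulf_neq0 // expf_neq0.
have k2 : c ^+ 2 * D ^+ 2 != 0 by rewrite mulf_neq0 // expf_neq0.
split=> [[z1 z2]|[z1 z2]].
  rewrite z1 mulr0 in e1; rewrite z2 mulr0 in e2.
  have NE : N = n%:R * c * D by apply/eqP; rewrite -subr_eq0 -e1.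
  split=> //; rewrite -[RHS](mulr0 (- n%:R)) e2 NE n1; ring.
split; first by apply: (mulfI k1); rewrite e1 mulr0 z2 subrr.
apply: (mulfI k2); rewrite e2 mulr0; apply: (mulfI n0); rewrite mulr0 -[RHS]oppr0 -z1.
rewrite -z2 n1; ring.
Qed.

End ScorePencil.

(** * The MA(2) model *)

Section Model.
Variables (K : fieldType) (n : nat).
Implicit Types (a : 'rV[K]_3) (y : 'cV[K]_n).

Lemma dist_absz (i j : nat) : `|i%:Z - j%:Z|%N = (i - j + (j - i))%N.
Proof. by lia. Qed.

Lemma evalmx_Sigma a : evalmx a (Sigma K n) =
  toep n (a 0 0 ^+ 2 + a 0 1 ^+ 2 + a 0 2 ^+ 2) (a 0 1 * (a 0 0 + a 0 2)) (a 0 0 * a 0 2).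
Proof.
apply/matrixP => i j; rewrite !mxE dist_absz /gamma.
case: (_ + _)%N => [|[|[|k]]] /=.
- by rewrite !expr2 !mevalD !mevalM !mevalXU.
- by rewrite mevalM mevalD !mevalXU.
- by rewrite mevalM !mevalXU.
- by rewrite !nth_nil meval0.
Qed.

Let dX (i j : 'I_3) : ('X_j : {mpoly K[3]})^`M(i) = (j == i)%:R.
Proof.
rewrite mderivX mnm1E; have [->|] := eqVneq j i; last by rewrite scale0r.
rewrite scale1r; have -> : (U_(i) - U_(i))%MM = 0%MM :> 'X_{1..3}.
  by apply/mnmP => k; rewrite mnmBE subnn mnm0E.
exact: mpolyX0.
Qed.

Lemma gamma_deriv a i k : ((gamma K k)^`M(i)).@[fun j => a 0 j] =
  [:: 2 * a 0 i; (1 == i)%:R * (a 0 0 + a 0 2) + a 0 1 * ((0 == i)%:R + (2 == i)%:R);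
      (0 == i)%:R * a 0 2 + a 0 0 * (2 == i)%:R]`_k.
Proof.
have aE : a 0 i = (0 == i)%:R * a 0 0 + (1 == i)%:R * a 0 1 + (2 == i)%:R * a 0 2.
  case: i => -[|[|[|//]]] ilt; rewrite -!val_eqE /= !mul0r mul1r ?addr0 ?add0r;
    by congr (a _ _); apply: val_inj.
have mb (b : bool) : (b%:R : {mpoly K[3]}).@[fun j => a 0 j] = b%:R.
  by case: b; rewrite ?meval1 ?meval0.
rewrite /gamma; case: k => [|[|[|m]]] /=.
- rewrite !expr2 !mderivD !mderivM !dX !mevalD !mevalM !mb !mevalXU aE; ring.
- by rewrite mderivM mderivD !dX mevalD !mevalM !mevalD !mb !mevalXU.
- by rewrite mderivM !dX mevalD !mevalM !mb !mevalXU.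
- by rewrite !nth_nil linear0 meval0.
Qed.

Lemma evalmx_dSigma a i : evalmx a (dSigma K n i) =
  toep n (2 * a 0 i)
    ((1 == i)%:R * (a 0 0 + a 0 2) + a 0 1 * ((0 == i)%:R + (2 == i)%:R))
    ((0 == i)%:R * a 0 2 + a 0 0 * (2 == i)%:R).
Proof. by apply/matrixP => k l; rewrite !mxE dist_absz gamma_deriv. Qed.

Lemma solutionE y a : likelihood_solution y a <->
  \det (evalmx a (Sigma K n)) != 0 /\
  forall i, score (evalmx a (Sigma K n)) y (evalmx a (dSigma K n i)) = 0.
Proof. by []. Qed.

Lemma det_jacobian a : \det (evalmx a (jacobian_g K))^T =
  2 * (a 0 0 - a 0 2) * (a 0 0 - a 0 1 + a 0 2) * (a 0 0 + a 0 1 + a 0 2).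
Proof.
have JE (k i : 'I_3) := gamma_deriv a i k.
rewrite det_tr (expand_det_row _ 0) !big_ord_recl big_ord0 /cofactor.
rewrite !(expand_det_row _ 0) !big_ord_recl !big_ord0 /cofactor !det_mx11 !mxE.
rewrite !JE /= /bump /=.
have -> : ord0 = 0 :> 'I_3 by exact: val_inj.
have -> : lift 0 ord0 = 1 :> 'I_3 by exact: val_inj.
have -> : lift 0 (lift ord0 ord0) = 2 :> 'I_3 by exact: val_inj.
by move: (a 0 0) (a 0 1) (a 0 2) => *; ring.
Qed.

Definition row3 (x y z : K) : 'rV[K]_3 := \row_i [:: x; y; z]`_i.

Lemma row3_0 x0 x1 x2 : row3 x0 x1 x2 0 0 = x0. Proof. by rewrite mxE. Qed.
Lemma row3_1 x0 x1 x2 : row3 x0 x1 x2 0 1 = x1. Proof. by rewrite mxE. Qed.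
Lemma row3_2 x0 x1 x2 : row3 x0 x1 x2 0 2 = x2. Proof. by rewrite mxE. Qed.

Lemma row3E a : a = row3 (a 0 0) (a 0 1) (a 0 2).
Proof.
apply/rowP => i; rewrite mxE; case: i => -[|[|[|//]]] ilt /=; congr (a _ _);
  exact: val_inj.
Qed.

Lemma solution_row3 y x0 x1 x2 : likelihood_solution y (row3 x0 x1 x2) <->
  let S := toep n (x0 ^+ 2 + x1 ^+ 2 + x2 ^+ 2) (x1 * (x0 + x2)) (x0 * x2) in
  \det S != 0 /\ [/\ score S y (toep n (2 * x0) x1 x2) = 0,
    score S y (toep n (2 * x1) (x0 + x2) 0) = 0 &
    score S y (toep n (2 * x2) x1 x0) = 0].
Proof.
rewrite /= solutionE evalmx_Sigma !row3_0 !row3_1 !row3_2.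
have d0 : evalmx (row3 x0 x1 x2) (dSigma K n 0) = toep n (2 * x0) x1 x2.
  rewrite evalmx_dSigma !row3_0 !row3_1 !row3_2 /=.
  by congr (toep _ _ _ _); rewrite ?(mulr0n, mulr1n); ring.
have d1 : evalmx (row3 x0 x1 x2) (dSigma K n 1) = toep n (2 * x1) (x0 + x2) 0.
  rewrite evalmx_dSigma !row3_0 !row3_1 !row3_2 /=.
  by congr (toep _ _ _ _); rewrite ?(mulr0n, mulr1n); ring.
have d2 : evalmx (row3 x0 x1 x2) (dSigma K n 2) = toep n (2 * x2) x1 x0.
  rewrite evalmx_dSigma !row3_0 !row3_1 !row3_2 /=.
  by congr (toep _ _ _ _); rewrite ?(mulr0n, mulr1n); ring.
split=> -[D s]; split=> //.
  by split; rewrite -?d0 -?d1 -?d2 s.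
case: s => s0 s1 s2 i.
have [->|->|->] : [\/ i = 0, i = 1 | i = 2].
  by case: i => -[|[|[|//]]] ilt; [constructor 1|constructor 2|constructor 3]; apply: val_inj.
- by rewrite d0.
- by rewrite d1.
- by rewrite d2.
Qed.

End Model.

(** * The likelihood equations on each component *)

Section Families.
Variables (F : numClosedFieldType) (n : nat).
Hypothesis n_gt0 : (0 < n)%N.
Implicit Types (y : 'cV[F]_n).

Let pencil_lift c (M : 'M[{poly F}]_n) t y : c != 0 ->
  \det (c ^+ 2 *: mxeval t M) != 0 /\
  (score (c ^+ 2 *: mxeval t M) y (mxeval t M) = 0 /\
   score (c ^+ 2 *: mxeval t M) y (mxeval t (dermx M)) = 0) <->
  [/\ (\det M).[t] != 0, (pform (critmx M) y).[t] = 0 &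
      n%:R * c ^+ 2 * (\det M).[t] = (pform (\adj M) y).[t]].
Proof.
move=> c0; have c2 : c ^+ 2 != 0 by rewrite expf_neq0.
rewrite detZ mulf_eq0 negb_or expf_neq0 //= /mxeval det_map_mx /= -!/(mxeval _ _).
by split=> [[D0 /(score_pencil _ n_gt0 c2 D0)[]]|[D0 P0 N]] //; split=> //; apply/score_pencil.
Qed.

(** When a_0 = a_2 the derivatives in a_0 and a_2 coincide; with t = a_1 / a_0 they equal
    [al (M - (t / 2) M')], and the derivative in a_1 is [al M']. *)
Lemma quad_solution y al t : al != 0 ->
  likelihood_solution y (row3 al (t * al) al) <->
  [/\ (\det (quadmx F n)).[t] != 0, (pform (critmx (quadmx F n)) y).[t] = 0 &
      n%:R * al ^+ 2 * (\det (quadmx F n)).[t] = (pform (\adj (quadmx F n)) y).[t]].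
Proof.
move=> al0; rewrite solution_row3 -pencil_lift //=.
have -> : toep n (al ^+ 2 + (t * al) ^+ 2 + al ^+ 2) (t * al * (al + al)) (al * al) =
   al ^+ 2 *: mxeval t (quadmx F n).
  by rewrite quadmx_eval toepZ; congr (toep _ _ _ _); ring.
set S := al ^+ 2 *: _.
have M'E : mxeval t (dermx (quadmx F n)) = toep n (2 * t) 2 0.
  by rewrite quadmx_der mxeval_toep !hornerE.
have -> : toep n (2 * (t * al)) (al + al) 0 = al *: mxeval t (dermx (quadmx F n)).
  by rewrite M'E toepZ; congr (toep _ _ _ _); ring.
have -> : toep n (2 * al) (t * al) al =
   al *: (mxeval t (quadmx F n) - (t / 2) *: mxeval t (dermx (quadmx F n))).
  by rewrite M'E quadmx_eval !toepZ toepN toepD toepZ; congr (toep _ _ _ _); field.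
rewrite !(scoreZ, scoreB); set s := score _ _ _; set s' := score _ _ _.
split=> -[D0 e]; split=> //.
  case: e => /eqP; rewrite mulf_eq0 (negPf al0) /= => /eqP e1 /eqP.
  by rewrite mulf_eq0 (negPf al0) /= => /eqP e2 _; move: e1; rewrite e2 mulr0 subr0.
by case: e => -> ->; rewrite !(mulr0, subr0).
Qed.

(* With a_0 + a_2 = c <> 0, a_0 = rho c and a_1 = eps c. *)
Lemma lin_solution y eps c rho : c != 0 -> eps ^+ 2 = 1 -> let x := rho * (1 - rho) in
  likelihood_solution y (row3 (rho * c) (eps * c) ((1 - rho) * c)) <->
  [/\ (\det (linmx n eps)).[x] != 0, (pform (critmx (linmx n eps)) y).[x] = 0 &
      n%:R * c ^+ 2 * (\det (linmx n eps)).[x] = (pform (\adj (linmx n eps)) y).[x]].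
Proof.
move=> c0 eps2 x; rewrite solution_row3 -pencil_lift //=.
have eps0 : eps != 0 by rewrite -sqrf_eq0 eps2 oner_eq0.
have ME : mxeval x (linmx n eps) = toep n (2 - 2 * x) eps x := linmx_eval _ _ _.
have M'E : mxeval x (dermx (linmx n eps)) = toep n (-2) 0 1.
  by rewrite linmx_der toepN mxeval_toep !hornerE /= oppr0 opprK.
have -> : toep n ((rho * c) ^+ 2 + (eps * c) ^+ 2 + ((1 - rho) * c) ^+ 2)
     (eps * c * (rho * c + (1 - rho) * c)) (rho * c * ((1 - rho) * c)) =
   c ^+ 2 *: mxeval x (linmx n eps).
  rewrite ME toepZ /x; congr (toep _ _ _ _); [|by ring|by ring].
  by rewrite [(eps * c) ^+ 2]exprMn eps2; ring.
set S := c ^+ 2 *: _; set M := mxeval x (linmx n eps) in ME *.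
set M' := mxeval x (dermx _) in M'E *.
have -> : toep n (2 * (eps * c)) (rho * c + (1 - rho) * c) 0 = (eps * c) *: (M - x *: M').
  rewrite ME M'E !toepZ toepN toepD toepZ; congr (toep _ _ _ _); try by ring.
  by transitivity (eps ^+ 2 * c); [rewrite eps2|]; ring.
have -> : toep n (2 * (rho * c)) (eps * c) ((1 - rho) * c) =
    c *: (M - x *: M' + (1 - rho) *: M').
  by rewrite ME M'E !toepZ toepN !toepD toepZ; congr (toep _ _ _ _); ring.
have -> : toep n (2 * ((1 - rho) * c)) (eps * c) (rho * c) =
    c *: (M - x *: M' + rho *: M').
  by rewrite ME M'E !toepZ toepN !toepD toepZ; congr (toep _ _ _ _); ring.
rewrite !(scoreZ, scoreB, scoreD); set s := score _ _ M; set s' := score _ _ M'.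
split=> -[D0 e]; split=> //; last first.
  by case: e => -> ->; rewrite !(mulr0, subr0, addr0).
case: e => /eqP; rewrite mulf_eq0 (negPf c0) /= => /eqP e1 /eqP.
rewrite !mulf_eq0 (negPf c0) (negPf eps0) /= => /eqP e2 /eqP; rewrite mulf_eq0 (negPf c0) /=.
move/eqP => e3; rewrite e2 !add0r in e1 e3.
(* Both [rho * s'] and [(1 - rho) * s'] vanish, and their sum is [s'], so no case distinction on
   [rho] is needed. *)
have s'0 : s' = 0 by rewrite -[s']mul1r -(subrK rho 1) mulrDl e1 e3 addr0.
by split=> //; move: e2; rewrite s'0 mulr0 subr0.
Qed.

(** The derivative in a_1 is zero and the other two are opposite multiples of the same matrix, so a
    single equation remains, and it fixes [r ^+ 2]. *)
Lemma anti_solution y r : r != 0 -> 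
  likelihood_solution y (row3 r 0 (- r)) <->
  n%:R * r ^+ 2 * \det (toep n 2 0 (-1) : 'M[F]_n) = qform (\adj (toep n 2 0 (-1))) y.
Proof.
move=> r0; rewrite solution_row3 /=; set A := toep n 2 0 (-1).
have -> : toep n (r ^+ 2 + 0 ^+ 2 + (- r) ^+ 2) (0 * (r - r)) (r * - r) = r ^+ 2 *: A.
  by rewrite toepZ; congr (toep _ _ _ _); ring.
have -> : toep n (2 * r) 0 (- r) = r *: A.
  by rewrite toepZ; congr (toep _ _ _ _); ring.
have -> : toep n (2 * - r) 0 r = (- r) *: A.
  by rewrite toepZ; congr (toep _ _ _ _); ring.
have -> : toep n (2 * 0) (r - r) 0 = 0 *: A.
  by rewrite toepZ; congr (toep _ _ _ _); ring.
have A0 : \det A != 0 := det_toep_neq0 _ _.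
have r2 : r ^+ 2 != 0 by rewrite expf_neq0.
have e := score_scalar y r2 A0.
have k : r ^+ 2 ^+ 2 * \det A != 0 by rewrite mulf_neq0 ?expf_neq0.
rewrite !scoreZ; split=> [[_ [/eqP]]|e1].
  rewrite mulf_eq0 (negPf r0) /= => /eqP s0 _ _.
  by move: e; rewrite s0 mulr0 => /esym/eqP; rewrite subr_eq0 => /eqP.
have s0 : score (r ^+ 2 *: A) y A = 0 by apply: (mulfI k); rewrite e e1 subrr mulr0.
by split; [rewrite detZ mulf_neq0 ?expf_neq0 | rewrite s0 !mulr0].
Qed.

(** The parametrization by t = a_1 / a_0 misses a_0 = a_2 = 0. There the covariance is [b ^+ 2]
    times the identity and the derivative in a_0 is [b] times the traceless [toep n 0 1 0], so a
    solution imposes a condition that generic data violate. *)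
Lemma middle_solution y b : likelihood_solution y (row3 0 b 0) ->
  qform (toep n 0 1 0) y = 0.
Proof.
rewrite solution_row3 /=.
have -> : toep n (0 ^+ 2 + b ^+ 2 + 0 ^+ 2) (b * (0 + 0)) (0 * 0) = b ^+ 2 *: (1%:M : 'M[F]_n).
  by rewrite -toep100 toepZ; congr (toep _ _ _ _); ring.
rewrite detZ det1 mulr1 => -[b2 [s _ _]].
have b0 : b ^+ 2 != 0.
  by apply: contraNneq b2 => ->; rewrite expr0n; move: n_gt0; case: n.
move: s; rewrite mulr0.
have -> : toep n 0 b 0 = b *: toep n 0 1 0 :> 'M[F]_n.
  by rewrite toepZ; congr (toep _ _ _ _); ring.
rewrite scoreZ => /eqP; rewrite mulf_eq0 -sqrf_eq0 (negPf b0) /= => /eqP.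
rewrite /score invmx_scale_det ?det1 ?oner_eq0 // adj1 sandwich_scale mul1mx mulmx1.
rewrite -scalemxAl mul1mx linearZ /= [\tr _]big1 => [|i _]; last by rewrite mxE subnn.
by rewrite mulr0 oppr0 add0r => /eqP; rewrite mulf_eq0 expf_eq0 invr_eq0 mulf_eq0
   (negPf b0) oner_eq0 => /eqP.
Qed.

End Families.

Local Open Scope classical_set_scope.
Local Open Scope card_scope.
Local Open Scope ring_scope.

(** For real data the complex equation splits into its real and imaginary parts. They do not both
    vanish identically: on the line [u + s *: v] through the real and imaginary parts of [z] the
    equation is nonzero at s = i, hence at some natural number, which gives a real point. *)
Lemma zgeneric_real (R : realType) (n : nat) (P : 'cV[R[i]]_n -> Prop) :
  zgeneric P -> generically (fun y : 'cV[R]_n => P (map_mx (real_complex R) y)).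
Proof.
move=> [p [[z pz] pP]]; 
pose part (f : R[i] -> R) : {mpoly R[n]} := \sum_(m <- msupp p) f p@_m *: 'X_[m].
have partE (f : {additive R[i] -> R}) (y : 'cV[R]_n) :
    (forall x r, f (x * real_complex R r) = f x * r) ->
    (part f).@[fun i => y i 0] = f (p.@[fun i => map_mx (real_complex R) y i 0]).
  move=> fM; rewrite [in RHS]mevalE /part !raddf_sum; apply: eq_bigr => m _ /=.
  rewrite mevalZ mevalX -fM rmorph_prod; congr (f (_ * _)).
  by apply: eq_bigr => i _; rewrite mxE rmorphXn.
have ReE := partE (@complex.Re R) _ _; have ImE := partE (@complex.Im R) _ _.
have Re_mul (x : R[i]) r : complex.Re (x * real_complex R r) = complex.Re x * r.
  by case: x => a b /=; rewrite mulr0 subr0.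
have Im_mul (x : R[i]) r : complex.Im (x * real_complex R r) = complex.Im x * r.
  by case: x => a b /=; rewrite mulr0 add0r.
pose V := [set y : 'cV[R]_n | p.@[fun i => map_mx (real_complex R) y i 0] = 0].
exists V; split.
- exists [set part (@complex.Re R); part (@complex.Im R)].
  apply/seteqP; split => y /=; rewrite /V /=.
    by move=> y0 q [->|->]; rewrite ?(ReE _ Re_mul) ?(ImE _ Im_mul) y0 raddf0.
  move=> yS; have := yS _ (or_introl erefl); have := yS _ (or_intror erefl).
  rewrite (ReE _ Re_mul) (ImE _ Im_mul) => im0 re0.
  by rewrite [LHS]complexE im0 re0 mulr0 addr0.
- move=> VT; pose u := map_mx (fun x : R[i] => (complex.Re x)%:C%C) z.
  pose v := map_mx (fun x : R[i] => (complex.Im x)%:C%C) z.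
  have [q qE] := meval_line p u v.
  have q0 : q != 0.
    apply: contraNneq pz => q0; have := qE 'i%C; rewrite q0 horner0 => /esym/eqP.
    rewrite (_ : u + 'i%C *: v = z) //; apply/colP => i.
    by rewrite !mxE [RHS]complexE.
  have [k] := poly_nat_nonroot q0; rewrite qE => /eqP; apply.
  pose y : 'cV[R]_n := \col_i (complex.Re (z i 0) + k%:R * complex.Im (z i 0)).
  have : V y by rewrite VT.
  rewrite /V /=; suff -> : map_mx (real_complex R) y = u + k%:R *: v by [].
  by apply/colP => i; rewrite !mxE rmorphD rmorphM rmorph_nat.
- by move=> y yV; apply: pP; apply/eqP.
Qed.

(** * The solutions with a_1 = 0 and a_0 = - a_2 *)

Lemma sum_parity (V : nmodType) (f : nat -> V) n :
  \sum_(a < n) f a = \sum_(i < uphalf n) f i.*2 + \sum_(i < n./2) f i.*2.+1.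
Proof.
elim: n => [|n IH]; first by rewrite !big_ord0 addr0.
rewrite big_ord_recr IH /=; have nE := odd_double_half n; case: (odd n) nE => /= nE.
  have uE : uphalf n = n./2.+1 by lia.
  rewrite uE [X in _ = _ + X]big_ord_recr /= addrA.
  by congr (_ + f _); lia.
have uE : uphalf n = n./2 by lia.
rewrite uE [X in _ = X + _]big_ord_recr /= addrAC.
by congr (_ + f _); lia.
Qed.

Section MinMax.
Variable R : realFieldType.

(* The inverse of the tridiagonal (-1, 2, -1) matrix of size k, with indices from 1. *)
Definition green (k I J : nat) : R :=
  (minn I J * (k + 1 - maxn I J))%:R / (k + 1)%:R.

(** As a function of [I] it is linear on both sides of [J], with slopes [(k + 1 - J) / (k + 1)] and
    [- J / (k + 1)], so the slope drops by 1 at [J]. *)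
Lemma green_diff2 k I J : (0 < J <= k)%N -> (I < k)%N ->
  2 * green k I.+1 J - green k I J - green k I.+2 J = (I.+1 == J)%:R.
Proof.
move=> /andP[J0 Jk] Ik; have k0 : (k + 1)%:R != 0 :> R by rewrite pnatr_eq0; lia.
apply: (mulIf k0); rewrite !mulrBl /green -mulrA !divfK //.
have [eq|neq] := eqVneq I.+1 J; last have [lt|gt] := boolP (I.+1 < J)%N.
- have e1 : (minn I.+1 J * (k + 1 - maxn I.+1 J) = J * (k - I))%N by nia.
  have e2 : (minn I J * (k + 1 - maxn I J) + (k + 1) = J * (k - I) + J)%N by nia.
  have e3 : (minn I.+2 J * (k + 1 - maxn I.+2 J) + J = J * (k - I))%N by nia.
  rewrite e1 -[X in _ - _ - X](addrK J%:R) -[X in _ - X - _](addrK (k + 1)%:R).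
  rewrite -!natrD e2 e3 !natrD mul1r; ring.
- have -> : (minn I.+1 J * (k + 1 - maxn I.+1 J) = (I + 1) * (k + 1 - J))%N by nia.
  have -> : (minn I J * (k + 1 - maxn I J) = I * (k + 1 - J))%N by nia.
  have -> : (minn I.+2 J * (k + 1 - maxn I.+2 J) = (I + 2) * (k + 1 - J))%N by nia.
  rewrite !natrM !natrD mul0r -natr1; ring.
- have e1 : (minn I.+1 J * (k + 1 - maxn I.+1 J) = J * (k - I))%N by nia.
  have e2 : (minn I J * (k + 1 - maxn I J) = J * (k - I + 1))%N by nia.
  have e3 : (minn I.+2 J * (k + 1 - maxn I.+2 J) + J = J * (k - I))%N by nia.
  rewrite e1 e2 -[X in _ - _ - X](addrK J%:R) -natrD e3 !natrM natrD mul0r; ring.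
Qed.

Lemma green0 k J : green k 0 J = 0.
Proof. by rewrite /green min0n mul0n mul0r. Qed.

Lemma green_out k J : (J <= k)%N -> green k k.+1 J = 0.
Proof.
move=> Jk; rewrite /green; have -> : (minn k.+1 J * (k + 1 - maxn k.+1 J) = 0)%N by nia.
by rewrite mul0r.
Qed.

End MinMax.

Section Explicit.
Variables (R : realType) (n : nat) (y : 'cV[R]_n).

Let len (p : bool) : nat := if p then n./2 else uphalf n.
Let yn a := padded y a.+2.

Let ynE (j : 'I_n) : yn j = y j 0. Proof. exact: padded_in. Qed.

(* The entries of one parity, at indices 2 I + p - 2, of the solution z of
   2 z_a - z_(a-2) - z_(a+2) = y_a; it vanishes at both ends I = 0 and I = len p + 1. *)
Let sol (p : bool) I := \sum_(j < len p) green R (len p) I j.+1 * yn (j.*2 + p).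
Let w l := sol (odd l) l./2.

Let sol0 p : sol p 0 = 0.
Proof. by rewrite /sol big1 // => j _; rewrite green0 mul0r. Qed.

Let sol_out p : sol p (len p).+1 = 0.
Proof. by rewrite /sol big1 // => j _; rewrite green_out ?mul0r. Qed.

Let sol_diff2 p I : (I < len p)%N ->
  2 * sol p I.+1 - sol p I - sol p I.+2 = yn (I.*2 + p).
Proof.
move=> Ik; rewrite /sol mulr_sumr -!sumrB (bigD1 (Ordinal Ik)) //= big1 ?addr0.
  transitivity ((2 * green R (len p) I.+1 I.+1 - green R (len p) I I.+1
    - green R (len p) I.+2 I.+1) * yn (I.*2 + p)); first by ring.
  by rewrite green_diff2 // eqxx mul1r.
move=> j; rewrite -val_eqE /= => jI.
transitivity ((2 * green R (len p) I.+1 j.+1 - green R (len p) I j.+1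
    - green R (len p) I.+2 j.+1) * yn (j.*2 + p)); first by ring.
by rewrite green_diff2 ?ltn_ord // eqSS eq_sym (negPf jI) mul0r.
Qed.

Let w_out0 : w n.+2 = 0.
Proof.
rewrite /w; have -> : (n.+2)./2 = (len (odd n.+2)).+1.
  by rewrite /= /len negbK; case: ifP => on //; lia.
exact: sol_out.
Qed.

Let w_out1 : w n.+3 = 0.
Proof.
rewrite /w; have -> : (n.+3)./2 = (len (odd n.+3)).+1.
  by rewrite /= /len !negbK; case: ifP => on //; lia.
exact: sol_out.
Qed.

Definition inverse_image : 'cV[R]_n := \col_j w j.+2.

Lemma toep_inverse_image : toep n 2 0 (-1) *m inverse_image = y.
Proof.
have w0 : w 0%N = 0 by exact: sol0.
have w1 : w 1%N = 0 by exact: sol0.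
apply/colP => i; rewrite /inverse_image (toep_mul _ _ _ i w0 w1 w_out0 w_out1).
have lt_in := ltn_ord i.
have Ik : (i./2 < len (odd i))%N by rewrite /len; case: ifP; lia.
rewrite !mul0r !addr0 /w /= !negbK; have := sol_diff2 Ik.
have -> : (i./2.*2 + odd i = i)%N by lia.
rewrite ynE => <-; ring.
Qed.

Lemma min_max_formE :
  min_max_form (y_odd y) + min_max_form (y_even y) = (y^T *m inverse_image) 0 0.
Proof.
have -> : (y^T *m inverse_image) 0 0 = \sum_(a < n) yn a * w a.+2.
  by rewrite mxE; apply: eq_bigr => a _; rewrite !mxE ynE.
rewrite (sum_parity (fun a => yn a * w a.+2)); congr (_ + _).
  apply: eq_bigr => i _; rewrite /w /sol /= odd_double doubleK mulr_sumr.
  apply: eq_bigr => j _; rewrite !mxE addn0 -!ynE /green /=; ring.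
apply: eq_bigr => i _; rewrite /w /sol /= odd_double /= uphalf_double mulr_sumr.
apply: eq_bigr => j _; rewrite !mxE [(j.*2 + _)%N]addn1 -!ynE /green /=; ring.
Qed.

End Explicit.

(** * Counting *)

Lemma card_uniq_seq (T : choiceType) (A : set T) (s : seq T) :
  uniq s -> (forall a, A a <-> a \in s) -> A #= `I_(size s).
Proof.
move=> us As; have -> : A = [set` seq_fset tt s].
  by apply/seteqP; split=> a; rewrite /mkset seq_fsetE => /As.
by apply/card_eq_fsetP; rewrite size_seq_fset undup_id.
Qed.

Lemma separable_roots (F : closedFieldType) (p : {poly F}) : separable_poly p ->
  exists rs : seq F, [/\ uniq rs, size rs = (size p).-1 & forall t, root p t = (t \in rs)].
Proof.
move=> sp; have p0 := separable_poly_neq0 sp.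
have l0 : lead_coef p != 0 by rewrite lead_coef_eq0.
have [rs pE] := closed_field_poly_normal p; exists rs; split.
- by move: sp; rewrite pE (eqp_separable (eqp_scale _ l0)) separable_prod_XsubC.
- by rewrite pE size_scale // size_prod_XsubC.
- by move=> t; rewrite pE rootZ // root_prod_XsubC.
Qed.

Section SqrtCover.
Variables (F : numClosedFieldType) (T : eqType) (rs : seq F) (q : F -> F) (phi : F -> F -> T).
(** All [phi t c] with [c ^+ 2 = q t]. It serves both for the scale over a root and for the two rho
    over a root x. *)
Definition sqrt_cover : seq T :=
  flatten [seq [:: phi t (sqrtC (q t)); phi t (- sqrtC (q t))] | t <- rs].

Lemma size_sqrt_cover : size sqrt_cover = (2 * size rs)%N.
Proof.
by rewrite /sqrt_cover; elim: rs => //= t r ->; lia.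
Qed.

Lemma mem_sqrt_cover a : (a \in sqrt_cover) <->
  exists t c, [/\ t \in rs, c ^+ 2 = q t & a = phi t c].
Proof.
split=> [/flatten_mapP[t trs]|[t [c [trs cq ->]]]].
  by rewrite !inE => /orP[] /eqP ->; [exists t, (sqrtC (q t))|exists t, (- sqrtC (q t))];
    rewrite ?sqrrN sqrtCK.
apply/flatten_mapP; exists t => //; rewrite !inE.
have /eqP : c ^+ 2 = sqrtC (q t) ^+ 2 by rewrite sqrtCK.
by rewrite eqf_sqr => /orP[] /eqP ->; rewrite eqxx ?orbT.
Qed.

Hypothesis uniq_rs : uniq rs.
Hypothesis q_neq0 : forall t, t \in rs -> q t != 0.
Hypothesis phi_inj : forall t t' c c',
  c ^+ 2 = q t -> c' ^+ 2 = q t' -> c != 0 -> phi t c = phi t' c' -> t = t' /\ c = c'.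

Lemma uniq_sqrt_cover : uniq sqrt_cover.
Proof.
have phi_mem t r c : c ^+ 2 = q t -> c != 0 -> t \notin r ->
    phi t c \notin flatten [seq [:: phi t (sqrtC (q t)); phi t (- sqrtC (q t))] | t <- r].
  move=> cq c0; apply: contra => /flatten_mapP[t' tr]; rewrite !inE.
  by case/orP => /eqP /phi_inj[] //; rewrite ?sqrrN ?sqrtCK // => ->.
rewrite /sqrt_cover; move: uniq_rs q_neq0; elim: rs => //= t r IH /andP[tr ur] qr.
have q0 : q t != 0 by apply: qr; rewrite inE eqxx.
have s0 : sqrtC (q t) != 0 by rewrite sqrtC_eq0.
rewrite inE negb_or !phi_mem ?sqrrN ?sqrtCK ?oppr_eq0 //= andbT IH ?andbT //; last first.
  by move=> t' t'r; apply: qr; rewrite inE t'r orbT.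
apply/eqP => /phi_inj[]; rewrite ?sqrrN ?sqrtCK // => _ /eqP.
by rewrite -addr_eq0 -mulr2n mulrn_eq0 (negPf s0).
Qed.

End SqrtCover.

Section Counting.
Variables (F : numClosedFieldType) (n : nat).
Hypothesis n_ge3 : (2 < n)%N.
Implicit Types (y : 'cV[F]_n) (a : 'rV[F]_3).

Let n_gt0 : (0 < n)%N. Proof. by lia. Qed.
Let n0 : n%:R != 0 :> F. Proof. by rewrite pnatr_eq0; lia. Qed.

Definition critical_data (M : 'M[{poly F}]_n) (d : nat) (avoid : seq F) y :=
  [/\ size (pform (critmx M) y) = d.+1, separable_poly (pform (critmx M) y),
      forall t, root (pform (critmx M) y) t ->
        (\det M).[t] != 0 /\ (pform (\adj M) y).[t] != 0 &
      forall t, t \in avoid -> (pform (critmx M) y).[t] != 0].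

(* t = 0 is a_1 = 0; t = 2, -2 and x = 1/4 are where the component a_0 = a_2 meets
   the components a_0 + a_2 = a_1 and a_0 + a_2 = - a_1. *)
Definition good_data y :=
  [/\ critical_data (quadmx F n) (4 * (n - 1)) [:: 0; 2; -2] y,
      critical_data (linmx n 1) (2 * n - 3) [:: 4^-1] y,
      critical_data (linmx n (-1)) (2 * n - 3) [:: 4^-1] y &
      qform (toep n 0 1 0) y != 0].

Lemma good_data_generic : zgeneric good_data.
Proof.
have bundle M d avoid :
    zgeneric (fun y => [/\ size (pform (critmx M) y) = d.+1,
      separable_poly (pform (critmx M) y) &
      forall t, root (pform (critmx M) y) t ->
        (\det M).[t] != 0 /\ (pform (\adj M) y).[t] != 0]) ->
    (forall t, zgeneric (fun y => (pform (critmx M) y).[t] != 0)) ->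
    zgeneric (critical_data M d avoid).
  move=> g1 g2; apply: zgenericW (zgeneric_and g1
    (zgeneric_all (fun t (_ : t \in avoid) => g2 t))).
  by move=> y [[? ? ?] ?]; split.
have gq : zgeneric (critical_data (quadmx F n) (4 * (n - 1)) [:: 0; 2; -2]).
  apply: bundle; last exact: quad_critical_avoid.
  have := quad_critical_generic F n_ge3.
  by have -> : (2 * (2 * n - 1) - 2 = 4 * (n - 1))%N by lia.
have gl e : e ^+ 2 = 1 -> zgeneric (critical_data (linmx n e) (2 * n - 3) [:: 4^-1]).
  move=> e2; apply: bundle; last exact: lin_critical_avoid.
  have := lin_critical_generic n_ge3 e2.
  by have -> : (1 * (2 * n - 1) - 2 = 2 * n - 3)%N by lia.
have g1 : exists y : 'cV[F]_n, qform (toep n 0 1 0) y != 0.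
  apply: qform_neq0; first exact: trmx_toep.
  pose i0 : 'I_n := Ordinal n_gt0; have lt1 : (1 < n)%N by lia.
  apply/matrix0Pn; exists i0, (Ordinal lt1); rewrite mxE /=; exact: oner_neq0.
apply: zgenericW (zgeneric_and (zgeneric_and gq (gl 1 (expr1n _ _)))
  (zgeneric_and (gl (-1) _) (zgeneric_qform g1))); last by rewrite sqrrN expr1n.
by move=> y [[? ?] [? ?]]; split.
Qed.

Definition singular_solution y a :=
  likelihood_solution y a /\ \det (evalmx a (jacobian_g F))^T = 0.

Lemma quad_count y : good_data y -> exists s : seq 'rV[F]_3,
  [/\ uniq s, size s = (2 * (4 * (n - 1)))%N &
   forall a, (singular_solution y a /\ a 0 0 = a 0 2 /\ a 0 1 != 0) <-> a \in s].
Proof.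
case=> -[sP sepP PDN av] _ _ T1y.
have [rs [urs srs rsE]] := separable_roots sepP; rewrite sP /= in srs.
pose D := \det (quadmx F n); pose N := pform (\adj (quadmx F n)) y.
pose q t := N.[t] / (n%:R * D.[t]); pose phi (t c : F) : 'rV[F]_3 := row3 c (t * c) c.
have qE t c : D.[t] != 0 -> c ^+ 2 = q t <-> n%:R * c ^+ 2 * D.[t] = N.[t].
  move=> D0; have nD : n%:R * D.[t] != 0 by rewrite mulf_neq0.
  split=> [->|e]; first by rewrite /q mulrAC mulrC divfK.
  by apply: (mulIf nD); rewrite /q divfK // -e; ring.
have q0 t : t \in rs -> q t != 0.
  by rewrite -rsE => /PDN[D0 N0]; rewrite mulf_neq0 // invr_eq0 mulf_neq0.
have phi_inj t t' c c' : c ^+ 2 = q t -> c' ^+ 2 = q t' -> c != 0 ->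
    phi t c = phi t' c' -> t = t' /\ c = c'.
  move=> _ _ c0 /rowP e; have := e 0; have := e 1; rewrite !row3_0 !row3_1 => e1 e0.
  by rewrite -e0 in e1; split=> //; apply: (mulIf c0).
exists (sqrt_cover rs q phi); split.
- exact: uniq_sqrt_cover.
- by rewrite size_sqrt_cover srs.
move=> a; rewrite mem_sqrt_cover; split.
  move=> [[sol _] [a02 a1]].
  have a0 : a 0 0 != 0.
    apply: contraNneq T1y => a0; apply/eqP; apply: (@middle_solution _ _ n_gt0 y (a 0 1)).
    by move: sol; rewrite {1}(row3E a) -a02 a0.
  have aE : a = row3 (a 0 0) ((a 0 1 / a 0 0) * a 0 0) (a 0 0).
    by rewrite {1}(row3E a) -a02 divfK.
  exists (a 0 1 / a 0 0), (a 0 0).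
  move: sol; rewrite {1}aE => /(quad_solution n_gt0 y _ a0)[D0 P0 e].
  by split=> //; [rewrite -rsE; exact/rootP|exact/qE].
move=> [t [c [trs cq aE]]]; have := trs; rewrite -rsE => tP; have [D0 N0] := PDN t tP.
have c0 : c != 0 by rewrite -sqrf_eq0 cq q0.
have t0 : t != 0.
  by apply: contraTneq tP => ->; apply: av; rewrite inE eqxx.
rewrite aE /singular_solution det_jacobian /phi !row3_0 !row3_1 !row3_2; split; last first.
  by rewrite mulf_neq0.
split; last by rewrite subrr mulr0 !mul0r.
by apply/(quad_solution n_gt0) => //; split=> //; [exact/rootP|exact/qE].
Qed.

Lemma lin_count y eps : eps ^+ 2 = 1 ->
  critical_data (linmx n eps) (2 * n - 3) [:: 4^-1] y -> exists s : seq 'rV[F]_3,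
  [/\ uniq s, size s = (4 * (2 * n - 3))%N &
   forall a, (singular_solution y a /\ a 0 1 = eps * (a 0 0 + a 0 2) /\ a 0 1 != 0)
     <-> a \in s].
Proof.
move=> eps2 [sP sepP PDN av].
have eps0 : eps != 0 by rewrite -sqrf_eq0 eps2 oner_eq0.
have [rs [urs srs rsE]] := separable_roots sepP; rewrite sP /= in srs.
pose D := \det (linmx n eps); pose N := pform (\adj (linmx n eps)) y.
have two0 : 2 != 0 :> F by rewrite pnatr_eq0.
(* Writing [rho = 2^-1 + c] turns [rho * (1 - rho) = x] into [c ^+ 2 = 4^-1 - x]; the two values
   differ because 1/4 is avoided as a root. *)
pose rhos := sqrt_cover rs (fun x => 4^-1 - x) (fun _ c => 2^-1 + c).
have e4 : (2^-1 : F) ^+ 2 = 4^-1 by rewrite exprVn -natrX.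
have rhoE (c : F) : (2^-1 + c) * (1 - (2^-1 + c)) = 4^-1 - c ^+ 2.
  by rewrite -e4; field.
have rhoP rho : (rho \in rhos) = (rho * (1 - rho) \in rs).
  have rE : rho = 2^-1 + (rho - 2^-1) by rewrite addrC subrK.
  apply/idP/idP.
    move/mem_sqrt_cover => [x [c [xrs cx ->]]].
    by rewrite rhoE cx opprB addrC subrK.
  move=> h; apply/mem_sqrt_cover; exists (rho * (1 - rho)), (rho - 2^-1); split=> //.
  by rewrite -e4; field.
have urhos : uniq rhos.
  apply: uniq_sqrt_cover => // [t trs|t t' c c' e e' _ /addrI cc].
    rewrite subr_eq0; apply: contraTneq trs => <-; rewrite -rsE.
    by apply: av; rewrite inE eqxx.
  by split=> //; apply: (addrI (- 4^-1)); apply: oppr_inj; rewrite !opprD opprK -e -e' cc.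
pose q rho := N.[rho * (1 - rho)] / (n%:R * D.[rho * (1 - rho)]).
pose phi (rho c : F) : 'rV[F]_3 := row3 (rho * c) (eps * c) ((1 - rho) * c).
have qE t c : D.[t * (1 - t)] != 0 ->
    c ^+ 2 = q t <-> n%:R * c ^+ 2 * D.[t * (1 - t)] = N.[t * (1 - t)].
  move=> D0; have nD : n%:R * D.[t * (1 - t)] != 0 by rewrite mulf_neq0.
  split=> [->|e]; first by rewrite /q mulrAC mulrC divfK.
  by apply: (mulIf nD); rewrite /q divfK // -e; ring.
have q0 t : t \in rhos -> q t != 0.
  by rewrite rhoP -rsE => /PDN[D0 N0]; rewrite mulf_neq0 // invr_eq0 mulf_neq0.
have phi_inj t t' c c' : c ^+ 2 = q t -> c' ^+ 2 = q t' -> c != 0 ->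
    phi t c = phi t' c' -> t = t' /\ c = c'.
  move=> _ _ c0 /rowP e; have := e 0; have := e 1; rewrite !row3_0 !row3_1.
  by move/(mulfI eps0) => <- /(mulIf c0).
exists (sqrt_cover rhos q phi); split.
- exact: uniq_sqrt_cover.
- by rewrite !size_sqrt_cover srs mulnA.
move=> a; rewrite mem_sqrt_cover; split.
  move=> [[sol _] [a1E a1]].
  pose c := a 0 0 + a 0 2; pose rho := a 0 0 / c.
  have c0 : c != 0 by apply: contraNneq a1 => c0; rewrite a1E -/c c0 mulr0.
  have aE : a = row3 (rho * c) (eps * c) ((1 - rho) * c).
    rewrite {1}(row3E a) a1E mulrBl mul1r /rho divfK //.
    by congr row3; rewrite /c addrAC subrr add0r.
  exists rho, c.
  move: sol; rewrite {1}aE => /(lin_solution n_gt0 y _ c0 eps2)[D0 P0 e].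
  by split=> //; [rewrite rhoP -rsE; exact/rootP|exact/qE].
move=> [t [c [trs cq aE]]]; have := trs; rewrite rhoP -rsE => tP; have [D0 N0] := PDN _ tP.
have c0 : c != 0 by rewrite -sqrf_eq0 cq q0.
rewrite aE /singular_solution det_jacobian /phi !row3_0 !row3_1 !row3_2; split; last first.
  by split; [congr (_ * _); ring | rewrite mulf_neq0].
split.
  by apply/(lin_solution n_gt0) => //; split=> //; [exact/rootP|exact/qE].
have : (eps - 1) * (eps + 1) = 0 by rewrite -subr_sqr eps2 expr1n subrr.
have -> : 2 * (t * c - (1 - t) * c) * (t * c - eps * c + (1 - t) * c) *
   (t * c + eps * c + (1 - t) * c) =
   - (2 * (t * c - (1 - t) * c) * c ^+ 2) * ((eps - 1) * (eps + 1)) by ring.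
by move=> ->; rewrite mulr0.
Qed.

End Counting.

Section AntisymmetricSolutions.
Variables (R : realType) (n : nat) (y : 'cV[R]_n).
Hypotheses (n_gt0 : (0 < n)%N) (y_neq0 : y != 0).

Let form := min_max_form (y_odd y) + min_max_form (y_even y).
Let A : 'M[R[i]]_n := toep n 2 0 (-1).
Let z := map_mx (real_complex R) (inverse_image y).

Let mapA : map_mx (real_complex R) (toep n 2 0 (-1)) = A.
Proof. by rewrite map_toep; congr (toep _ _ _ _); rewrite /= ?rmorph_nat ?rmorph0 ?rmorphN1. Qed.

Let Az : A *m z = map_mx (real_complex R) y.
Proof.
by rewrite -[in RHS](toep_inverse_image y) map_mxM mapA.
Qed.

Let formE : real_complex R form = qform A z.
Proof.
rewrite /form min_max_formE -{1}(toep_inverse_image y) trmx_mul trmx_toep.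
by rewrite -/(qform _ _) map_qform mapA.
Qed.

Let qform_adj : qform (\adj A) (map_mx (real_complex R) y) = \det A * real_complex R form.
Proof.
rewrite -Az qform_conj trmx_toep mul_mx_adj mul_scalar_mx.
by rewrite qformZ formE.
Qed.

(** The form is [z^T A z] with [A] positive definite and [A *m z] the data. Positivity matters
    because [Num.sqrt] returns 0 on negative numbers. *)
Let form_gt0 : 0 < form.
Proof.
have z0 : z != 0.
  apply: contraNneq y_neq0 => z0; have := Az; rewrite z0 mulmx0 => /esym/matrixP e.
  apply/eqP/matrixP => i j; have := e i j; rewrite !mxE => -[]; exact.
rewrite -ltcR [X in _ < X]formE.
have zc : map_mx Num.conj z = z.
  by apply/matrixP => i j; rewrite !mxE; exact: conjc_real.
by have := herm_toep_gt0 z0; rewrite /herm zc.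
Qed.

Lemma explicit_a0_sqr : n%:R * explicit_a0 y ^+ 2 = form.
Proof.
have n0 : n%:R != 0 :> R by rewrite pnatr_eq0 -lt0n.
rewrite /explicit_a0 exprMn expr_div_n expr1n !sqr_sqrtr ?ler0n ?(ltW form_gt0) //.
by rewrite mulrA div1r divff // mul1r.
Qed.

Lemma explicit_a0_neq0 : explicit_a0 y != 0.
Proof.
apply/eqP => e; have := explicit_a0_sqr; rewrite e expr0n mulr0 => f0.
by have := form_gt0; rewrite -f0 ltxx.
Qed.

Lemma antisymmetric_solutionP (r : R[i]) : r != 0 ->
  likelihood_solution (map_mx (real_complex R) y) (row3 r 0 (- r)) <->
  (r = real_complex R (explicit_a0 y) \/ r = - real_complex R (explicit_a0 y)).
Proof.
move=> r0; rewrite anti_solution // qform_adj mulrC.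
have A0 : \det A != 0 := det_toep_neq0 _ _.
have n0 : n%:R != 0 :> R[i] by rewrite pnatr_eq0 -lt0n.
rewrite -explicit_a0_sqr rmorphM rmorphXn rmorph_nat /=; split.
  by move/(mulfI A0)/(mulfI n0)/eqP; rewrite eqf_sqr => /orP[] /eqP; [left|right].
by case=> ->; rewrite ?sqrrN.
Qed.

Lemma antisymmetric_pointE (r : R) :
  antisymmetric_point r = row3 (real_complex R r) 0 (- real_complex R r).
Proof. by []. Qed.

End AntisymmetricSolutions.

Unset Implicit Arguments.

Theorem theorem3p5 (R : realType) (n : nat) (hn : (3 <= n)%N) :
  generically (fun y : 'cV[R]_n =>
    [/\ singular_solutions y #= `I_(24 * n - 30)%N,
        [set a | singular_solutions y a /\ a 0 1 = 0 /\ a 0 0 = - a 0 2]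
          #= `I_2,
        [set a | singular_solutions y a /\ a 0 0 = a 0 2 /\ a 0 1 != 0]
          #= `I_(2 * (4 * (n - 1)))%N,
        [set a | singular_solutions y a /\ a 0 0 - a 0 1 + a 0 2 = 0 /\
                 a 0 1 != 0]
          #= `I_(4 * (2 * n - 3))%N &
        [set a | singular_solutions y a /\ a 0 0 + a 0 1 + a 0 2 = 0 /\
                 a 0 1 != 0]
          #= `I_(4 * (2 * n - 3))%N] /\
    [set a | singular_solutions y a /\ a 0 1 = 0 /\ a 0 0 = - a 0 2]
      = [set antisymmetric_point (explicit_a0 y);
             antisymmetric_point (- explicit_a0 y)]).
Proof.
have [V [algV VT VP]] := zgeneric_real (good_data_generic R[i] hn).
exists V; split=> // y /VP{V algV VT VP} gd; set yC := map_mx _ y in gd.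
have n_gt0 : (0 < n)%N by apply: leq_trans hn.
have [[_ _ _ avoid] lin1 linN1 T1y] := gd.
have y0 : y != 0.
  apply: contraNneq T1y => y0.
  by rewrite /yC y0 map_mx0 /qform mulmx0 mxE.
have e0 := explicit_a0_neq0 n_gt0 y0; set e := explicit_a0 y in e0.
pose s1 := [:: antisymmetric_point e; antisymmetric_point (- e)].
have u1 : uniq s1.
  rewrite /= andbT inE !antisymmetric_pointE; apply/eqP => /rowP /(_ 0).
  rewrite !row3_0 rmorphN => /eqP; rewrite -addr_eq0 -mulr2n mulrn_eq0 /=.
  by rewrite fmorph_eq0 (negPf e0).
have P1 a : (singular_solutions y a /\ a 0 1 = 0 /\ a 0 0 = - a 0 2) <-> a \in s1.
  split.
    move=> [[sol _] [a1 a02]]; have aE : a = row3 (a 0 0) 0 (- a 0 0).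
      by rewrite {1}(row3E a) a1 a02 opprK.
    have a0 : a 0 0 != 0.
      apply: contraNneq T1y => a0; apply/eqP; apply: (middle_solution n_gt0 (b := 0)).
      by move: sol; rewrite aE a0 oppr0.
    move: sol; rewrite {1}aE => /(antisymmetric_solutionP n_gt0 y0 a0) sol.
    rewrite !inE !antisymmetric_pointE rmorphN aE.
    by case: sol => ->; rewrite eqxx ?orbT.
  have sol1 r : r = real_complex R e \/ r = - real_complex R e ->
      singular_solutions y (row3 r 0 (- r)) /\ row3 r 0 (- r) 0 1 = 0 /\
      row3 r 0 (- r) 0 0 = - row3 r 0 (- r) 0 2.
    move=> re; have r0 : r != 0.
      by case: re => ->; rewrite ?oppr_eq0 fmorph_eq0.
    rewrite /singular_solutions /= det_jacobian !row3_0 !row3_1 !row3_2 opprK.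
    split=> //; split; first exact/(antisymmetric_solutionP n_gt0 y0 r0).
    by rewrite addr0 subrr mulr0.
  rewrite !inE => /orP[] /eqP ->; rewrite antisymmetric_pointE.
    by apply: sol1; left.
  by apply: sol1; right; rewrite rmorphN.
have [s2 [u2 z2 P2]] := quad_count hn gd.
have [s3 [u3 z3 P3]] := lin_count hn (expr1n _ 2) lin1.
have eN : (-1) ^+ 2 = 1 :> R[i] by rewrite sqrrN expr1n.
have [s4 [u4 z4 P4]] := lin_count hn eN linN1.
have two0 : 2 != 0 :> R[i] by rewrite pnatr_eq0.
have P2' a : (singular_solutions y a /\ a 0 0 = a 0 2 /\ a 0 1 != 0) <-> a \in s2.
  exact: P2.
have P3' a : (singular_solutions y a /\ a 0 0 - a 0 1 + a 0 2 = 0 /\ a 0 1 != 0)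
    <-> a \in s3.
  rewrite -P3 mul1r; split=> -[sa [ea na]]; split=> //; split=> //.
    by apply/esym/eqP; rewrite -subr_eq0 addrAC ea.
  by rewrite ea; ring.
have P4' a : (singular_solutions y a /\ a 0 0 + a 0 1 + a 0 2 = 0 /\ a 0 1 != 0)
    <-> a \in s4.
  rewrite -P4 mulN1r; split=> -[sa [ea na]]; split=> //; split=> //.
    by apply/eqP; rewrite -addr_eq0 addrC addrAC ea.
  by rewrite ea; ring.
(* On a_0 = a_2 the other two components are a_1 = 2 a_0 and a_1 = - 2 a_0, that is t = 2 and t =
   -2; this keeps the lists disjoint. *)
have not_double (a : 'rV[R[i]]_3) : singular_solutions y a -> a 0 0 = a 0 2 ->
    a 0 1 != 0 -> a 0 1 ^+ 2 != 4 * a 0 0 ^+ 2.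
  move=> [sol _] a02 a1.
  have a0 : a 0 0 != 0.
    apply: contraNneq T1y => a0; apply/eqP; apply: (@middle_solution _ _ n_gt0 _ (a 0 1)).
    by move: sol; rewrite {1}(row3E a) -a02 a0.
  have aE : a = row3 (a 0 0) ((a 0 1 / a 0 0) * a 0 0) (a 0 0).
    by rewrite {1}(row3E a) -a02 divfK.
  move: sol; rewrite {1}aE => /(quad_solution n_gt0 _ _ a0)[_ P0 _].
  apply/eqP => a14; have : (a 0 1 / a 0 0) \in [:: 0; 2; -2].
    have /eqP : (a 0 1 / a 0 0) ^+ 2 = 2 ^+ 2.
      by rewrite expr_div_n a14 mulfK ?expf_neq0 // -natrX.
    by rewrite eqf_sqr !inE => /orP[] ->; rewrite !orbT.
  by move/avoid; rewrite P0 eqxx.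
have d12 a : a \in s1 -> a \notin s2.
  by move/P1 => [_ [a1 _]]; apply/negP => /P2'[_ [_]]; rewrite a1 eqxx.
have d13 a : a \in s1 -> a \notin s3.
  by move/P1 => [_ [a1 _]]; apply/negP => /P3'[_ [_]]; rewrite a1 eqxx.
have d14 a : a \in s1 -> a \notin s4.
  by move/P1 => [_ [a1 _]]; apply/negP => /P4'[_ [_]]; rewrite a1 eqxx.
have d23 a : a \in s2 -> a \notin s3.
  move/P2' => [sa [a02 a1]]; apply/negP => /P3[_ [a1E _]].
  have /eqP := not_double _ sa a02 a1; apply.
  by rewrite a1E -a02; ring.
have d24 a : a \in s2 -> a \notin s4.
  move/P2' => [sa [a02 a1]]; apply/negP => /P4[_ [a1E _]].
  have /eqP := not_double _ sa a02 a1; apply.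
  by rewrite a1E -a02; ring.
have d34 a : a \in s3 -> a \notin s4.
  move/P3 => [_ [a1E a1]]; apply/negP => /P4[_ [a1E' _]].
  move/negP: a1; apply; have : a 0 1 *+ 2 == 0.
    by rewrite mulr2n {1}a1E a1E' mulN1r mul1r subrr.
  by rewrite mulrn_eq0.
pose s := s1 ++ (s2 ++ (s3 ++ s4)).
have us : uniq s.
  rewrite !cat_uniq u1 u2 u3 u4 !has_cat !negb_or /=.
  have nh (r r' : seq 'rV[R[i]]_3) : (forall a, a \in r -> a \notin r') -> ~~ has (mem r) r'.
    by move=> d; apply/hasPn => a ar'; apply/negP => /d; rewrite ar'.
  by rewrite !nh.
have Ps a : singular_solutions y a <-> a \in s.
  rewrite !mem_cat; split; last first.
    by case/orP => [/P1[]|/orP[/P2'[]|/orP[/P3'[]|/P4'[]]]].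
  (* With a_1 = 0 the determinant is 2 (a_0 - a_2) (a_0 + a_2)^2, so outside case (i) one has a_0 =
     a_2, which is the avoided value t = 0 or the excluded a_0 = 0. *)
  move=> sa; have [a1|a1] := eqVneq (a 0 1) 0.
    have [a02|a02] := eqVneq (a 0 0) (- a 0 2).
      by apply/orP; left; apply/P1.
    have /eqP := sa.2; rewrite det_jacobian a1 subr0 addr0 !mulf_eq0 (negPf two0) /=.
    rewrite !addr_eq0 (negPf a02) !orbF opprK => /eqP a0E.
    have [sol _] := sa.
    have a0 : a 0 0 != 0.
      apply: contraNneq T1y => a0; apply/eqP; apply: (middle_solution n_gt0 (b := 0)).
      by move: sol; rewrite (row3E a) -a0E a0 a1.
    move: sol; rewrite (row3E a) -a0E a1 -[X in row3 _ X _](mul0r (a 0 0)).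
    move/(quad_solution n_gt0 _ _ a0) => [_ P0 _].
    have /avoid : (0 : R[i]) \in [:: 0; 2; -2] by rewrite inE eqxx.
    by rewrite P0 eqxx.
  have /eqP := sa.2; rewrite det_jacobian !mulf_eq0 (negPf two0) /= -orbA.
  case/or3P => /eqP h.
  - apply/orP; right; apply/orP; left; apply/P2'; split=> //; split=> //.
    by apply/eqP; rewrite -subr_eq0 h.
  - by apply/orP; right; apply/orP; right; apply/orP; left; apply/P3'.
  - by apply/orP; right; apply/orP; right; apply/orP; right; apply/P4'.
have sz : size s = (24 * n - 30)%N.
  by rewrite !size_cat z2 z3 z4 /=; lia.
split; last first.
  by apply/seteqP; split=> a /=; [move/P1 | move=> h; apply/P1]; rewrite !inE;
    [move=> /orP[] /eqP; [left|right] | case: h => ->; rewrite eqxx ?orbT].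
split.
- by rewrite -sz; apply: card_uniq_seq.
- exact: (card_uniq_seq u1 P1).
- by rewrite -z2; exact: (card_uniq_seq u2 P2').
- by rewrite -z3; exact: (card_uniq_seq u3 P3').
- by rewrite -z4; exact: (card_uniq_seq u4 P4').
Qed.
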